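(* Let $\alpha_0,\alpha_1,\tau\in C^{\log}_{\mathrm{loc}}$ with $\tau^->0$, and let $p_0,p_1,q\in\mathcal P_0^{\log}$ with $0<p_0^+,p_1^+,q^+<\infty$. If $\alpha_0>\alpha_1$ and $$\alpha_0(x)-\frac{n}{p_0(x)}=\alpha_1(x)-\frac{n}{p_1(x)}\qquad (x\in\mathbb R^n)$$ with $0<\big(\frac{p_0}{p_1}\big)^+<1$, then $$\mathfrak F^{\alpha_0(\cdot),\tau(\cdot)}_{p_0(\cdot),q(\cdot)}\hookrightarrow\mathfrak F^{\alpha_1(\cdot),\tau(\cdot)}_{p_1(\cdot),\infty}.$$
   Context: $A_1\hookrightarrow A_2$ for quasi-normed spaces means $A_1\subset A_2$ and there is $c>0$ with $\|f\|_{A_2}\le c\|f\|_{A_1}$ for all $f\in A_1$. Exponents. $\mathcal P_0$ is the set of measurable functions $p$ on $\mathbb R^n$ with range in $[c,\infty)$ for some $c>0$. For a measurable function $g$, $g^-$ and $g^+$ denote its essential infimum and essential supremum. $g\in C^{\log}_{\mathrm{loc}}$ means that $g:\mathbb R^n\to\mathbb R$ and there is a constant $c_{\log}(g)>0$ with $|g(x)-g(y)|\le c_{\log}(g)/\log(e+1/|x-y|)$ for all $x,y\in\mathbb R^n$; $g\in C^{\log}$ means that in addition there are $g_\infty\in\mathbb R$ and $c_{\log}>0$ with $|g(x)-g_\infty|\le c_{\log}/\log(e+|x|)$ for all $x$. $\mathcal P_0^{\log}=\{p\in\mathcal P_0:1/p\in C^{\log}\}$. Norms. $\|f\|_{p(\cdot)}=\inf\{\mu>0:\int_{\mathbb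 R^n}|f(x)/\mu|^{p(x)}dx\le1\}$, and $\|(f_v)_v\|_{L^{p(\cdot)}(\ell^{q(\cdot)})}=\big\|\,\|(f_v(x))_v\|_{\ell^{q(x)}}\big\|_{p(\cdot)}$. Dyadic cubes. $Q_{v,m}=\{x: m_i\le 2^vx_i<m_i+1,\ i=1,\dots,n\}$ for $v\in\mathbb Z$, $m\in\mathbb Z^n$; $\mathcal Q$ is the set of all of them; for a cube $P$ of side length $l(P)$, $v_P=-\log_2 l(P)$ and $v_P^+=\max(v_P,0)$. Function space. Fix $\Phi,\varphi\in\mathcal S(\mathbb R^n)$ such that, for some $c>0$ ($\mathcal F$ is the Fourier transform), $\operatorname{supp}\mathcal F\Phi\subset\overline{B(0,2)}$ and $|\mathcal F\Phi(\xi)|\ge c$ if $|\xi|\le 5/3$, and $\operatorname{supp}\mathcal F\varphi\subset\overline{B(0,2)}\setminus B(0,1/2)$ and $|\mathcal F\varphi(\xi)|\ge c$ if $3/5\le|\xi|\le5/3$. Put $\varphi_v=2^{vn}\varphi(2^v\cdot)$ for $v\ge1$, with $\varphi_0$ replaced by $\Phi$. Then $\mathfrak F^{\alpha(\cdot),\tau(\cdot)}_{p(\cdot),q(\cdot)}$ is the set of all $f\in\mathcal S'(\mathbb R^n)$ with $$\|f\|_{\mathfrak F^{\alpha(\cdot),\tau(\cdot)}_{p(\cdot),q(\cdot)}}=\sup_{P\in\mathcal Q}\Big\|\Big(\frac{2^{v\alpha(\cdot)}\varphi_v*f}{|P|^{\tau(\cdot)}}\chi_P\Big)_{v\ge v_P^+}\Big\|_{L^{p(\cdot)}(\ell^{q(\cdot)})}<\infty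 .$$ For $q=\infty$, the $\ell^{q(x)}$ quasi-norm is replaced by the supremum over $v\ge v_P^+$, i.e. $\|f\|_{\mathfrak F^{\alpha(\cdot),\tau(\cdot)}_{p(\cdot),\infty}}=\sup_{P\in\mathcal Q}\big\|\sup_{v\ge v_P^+}\frac{2^{v\alpha(\cdot)}|\varphi_v*f|}{|P|^{\tau(\cdot)}}\chi_P\big\|_{p(\cdot)}$. *)

(* Defs.v *)
From HB Require Import structures.
From mathcomp Require Import all_boot all_order all_algebra.
From mathcomp Require Import complex.
From mathcomp Require Import all_classical all_reals all_analysis.

Set Implicit Arguments.
Unset Strict Implicit.
Unset Printing Implicit Defensive.

Import Order.TTheory GRing.Theory Num.Theory.
Import numFieldNormedType.Exports.

Local Open Scope classical_set_scope.
Local Open Scope ring_scope.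

Definition measure_rV_display : measure_display -> measure_display.
Proof. exact. Qed.

Section measurable_rV.
Context {d} {T : sigmaRingType d}.
Variable n : nat.

Let coors : 'I_n -> 'rV[T]_n -> T := fun i x => x ord0 i.

Let rV_set0 : g_sigma_preimage coors set0.
Proof. exact: sigma_algebra0. Qed.

Let rV_setC A : g_sigma_preimage coors A -> g_sigma_preimage coors (~` A).
Proof. exact: sigma_algebraC. Qed.

Let rV_bigcup (F : _^nat) : (forall i, g_sigma_preimage coors (F i)) ->
  g_sigma_preimage coors (\bigcup_i (F i)).
Proof. exact: sigma_algebra_bigcup. Qed.

HB.instance Definition _ := @isMeasurable.Build (measure_rV_display d)
  'rV[T]_n (g_sigma_preimage coors) rV_set0 rV_setC rV_bigcup.

End measurable_rV.

Lemma measurable_coord d (T : sigmaRingType d) n (i : 'I_n) :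
  measurable_fun [set: 'rV[T]_n] (fun x : 'rV[T]_n => x ord0 i).
Proof.
move=> _ Y mY; rewrite setTI; apply: sub_sigma_algebra => /=.
rewrite -bigcup_seq/=; exists i => /=; first by rewrite mem_index_enum.
by exists Y => //; rewrite setTI.
Qed.

Lemma measurable_fun_rV d1 d2 (T1 : measurableType d1) (T2 : measurableType d2)
    n (f : T1 -> 'rV[T2]_n) :
  (forall i, measurable_fun [set: T1] (fun x => f x ord0 i)) ->
  measurable_fun [set: T1] f.
Proof.
move=> mf.
have H : g_sigma_preimage (fun i => (fun y : 'rV[T2]_n => y ord0 i) \o f)
    `<=` measurable.
  apply: smallest_sub; first exact: sigma_algebra_measurable.
  case: n => [|n] in f mf *; first by rewrite big_ord0.
  rewrite -bigcup_mkord_ord; apply: bigcup_sub => i Ii.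
  by move=> A [B mB <-]; exact: mf.
rewrite g_sigma_preimage_comp in H.
by move=> _ A mA; apply: H; exists A.
Qed.

Section lebesgue_rV.
Variable R : realType.

Definition cons_rV n (z : measurableTypeR R * 'rV[R]_n) : 'rV[R]_n.+1 :=
  \row_i (if unlift ord0 i is Some j then z.2 ord0 j else z.1).

Definition uncons_rV n (x : 'rV[R]_n.+1) : measurableTypeR R * 'rV[R]_n :=
  (x ord0 ord0, \row_i x ord0 (lift ord0 i)).

Lemma cons_rVE0 n z : @cons_rV n z ord0 ord0 = z.1.
Proof.
by rewrite mxE unlift_none.
Qed.

Lemma cons_rVES n z i : @cons_rV n z ord0 (lift ord0 i) = z.2 ord0 i.
Proof.
by rewrite mxE liftK.
Qed.

Lemma cons_rVK n : cancel (@cons_rV n) (@uncons_rV n).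
Proof.
move=> z; rewrite /uncons_rV cons_rVE0 [RHS]surjective_pairing; congr (_, _).
by apply/rowP => i; rewrite mxE cons_rVES.
Qed.

Lemma measurable_cons_rV n : measurable_fun [set: _] (@cons_rV n).
Proof.
apply: measurable_fun_rV => i; case: (unliftP ord0 i) => [j|] ->.
- under eq_fun do rewrite cons_rVES.
  exact: (measurableT_comp (@measurable_coord _ _ n j) measurable_snd).
- under eq_fun do rewrite cons_rVE0.
  exact: measurable_fst.
Qed.

Lemma measurable_uncons_rV n : measurable_fun [set: _] (@uncons_rV n).
Proof.
apply: measurable_fun_pair; first exact: measurable_coord.
apply: measurable_fun_rV => i; under eq_fun do rewrite mxE.
exact: measurable_coord.
Qed.

Section step.
Variables (n : nat) (mu : {sigma_finite_measure set 'rV[R]_n -> \bar R}).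

Definition lebesgue_rV_step : set 'rV[R]_n.+1 -> \bar R :=
  pushforward (@lebesgue_measure R \x mu)%E (@cons_rV n).

Let step_measure : {measure set 'rV[R]_n.+1 -> \bar R} :=
  measure_function_pushforward__canonical__measure_function_Measure
    (@lebesgue_measure R \x mu)%E (@measurable_cons_rV n).

HB.instance Definition _ := isMeasure.Build _ _ _ lebesgue_rV_step
  (measure0 step_measure) (measure_ge0 step_measure)
  (@measure_semi_sigma_additive _ _ _ step_measure).

Let step_sigma_finite : sigma_finite setT lebesgue_rV_step.
Proof.
have /sigma_finiteP[F [FT ndF Foo]] := sigma_finiteT (@lebesgue_measure R).
have /sigma_finiteP[G [GT ndG Goo]] := sigma_finiteT mu.
exists (fun k => @uncons_rV n @^-1` (F k `*` G k)).
  rewrite -preimage_bigcup (_ : \bigcup_k _ = setT) ?preimage_setT//.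
  rewrite -setXTT FT GT predeqE => -[x y]; split => [[k _ [/= ? ?]]|].
    by split; exists k.
  move=> [/= [k _ Fkx] [l _ Gly]]; exists (maxn k l) => //; split.
  - by move: x Fkx; exact/subsetPset/ndF/leq_maxl.
  - by move: y Gly; exact/subsetPset/ndG/leq_maxr.
move=> k; have [mF Fk] := Foo k; have [mG Gk] := Goo k; split.
  rewrite -[X in measurable X]setTI; apply: measurable_uncons_rV => //.
  exact: measurableX.
rewrite /lebesgue_rV_step /pushforward -comp_preimage.
rewrite (_ : _ \o _ = id); last by apply/funext => z /=; exact: cons_rVK.
by rewrite preimage_id product_measure1E// lte_mul_pinfty// ge0_fin_numE.
Qed.

HB.instance Definition _ := Measure_isSigmaFinite.Build _ _ _
  lebesgue_rV_step step_sigma_finite.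

End step.

Fixpoint lebesgue_rV n : {sigma_finite_measure set 'rV[R]_n -> \bar R} :=
  if n is m.+1 then lebesgue_rV_step (lebesgue_rV m) else \d_(0 : 'rV[R]_0).

End lebesgue_rV.

Section tempered_distributions.
Context {R : realType} {n : nat}.
Local Notation E := 'rV[R]_n.

(* The library's norm on 'rV[R]_n is the sup norm. *)
Definition enorm (x : E) : R := Num.sqrt (\sum_i x ord0 i ^+ 2).

Definition dotp (x y : E) : R := \sum_i x ord0 i * y ord0 i.

Definition pderivs (s : seq 'I_n) (f : E -> R) : E -> R :=
  foldr (fun i g x => 'D_(delta_mx ord0 i) g x) f s.

Definition cpderivs (s : seq 'I_n) (f : E -> R[i]) (x : E) : R[i] :=
  (pderivs s (@complex.Re R \o f) x +i* pderivs s (@complex.Im R \o f) x)%C.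

(* Differentiability of all iterated partial derivatives also yields their
   continuity, which their mere existence would not. *)
Definition smooth (f : E -> R[i]) : Prop := forall s x,
  differentiable (pderivs s (@complex.Re R \o f)) x /\
  differentiable (pderivs s (@complex.Im R \o f)) x.

Definition schwartz_seminorm (N : nat) (f : E -> R[i]) : \bar R :=
  ereal_sup [set y | exists s x, (size s <= N)%N /\
    y = ((1 + enorm x) ^+ N * Normc.normc (cpderivs s f x))%:E].

Definition schwartz (f : E -> R[i]) : Prop :=
  smooth f /\ forall N, (schwartz_seminorm N f < +oo)%E.

(* Continuous linear functionals on the Schwartz space. They are represented as
   total functionals; only their values on Schwartz functions are constrained,
   and only these are ever used. The seminorms increase with N, so that the sets
   {psi | schwartz_seminorm N (psi - phi) < delta} form a neighbourhood basis
   of phi. *)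
Record tempered_distribution := TemperedDistribution {
  tempered_val :> (E -> R[i]) -> R[i] ;
  tempered_linear : forall (a : R[i]) (phi psi : E -> R[i]),
    schwartz phi -> schwartz psi ->
    tempered_val (fun x => a * phi x + psi x) =
    a * tempered_val phi + tempered_val psi ;
  tempered_continuous : forall phi : E -> R[i], schwartz phi ->
    forall e : R, 0 < e -> exists N (delta : R), 0 < delta /\
    forall psi : E -> R[i], schwartz psi ->
    (schwartz_seminorm N (fun x => psi x - phi x)%R < delta%:E)%E ->
    Normc.normc (tempered_val psi - tempered_val phi) < e }.

Definition convolution (phi : E -> R[i]) (f : tempered_distribution) (x : E) :
  R[i] := f (fun y => phi (x - y)).

Definition cintegral (f : E -> R[i]) : R[i] :=
  ((\int[lebesgue_rV R n]_x complex.Re (f x))%R +i*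
   (\int[lebesgue_rV R n]_x complex.Im (f x))%R)%C.

Definition expi (t : R) : R[i] := (cos t +i* sin t)%C.

(* (2 pi)^(-n/2) * \int exp(- i <x, xi>) f(x) dx *)
Definition fourier (f : E -> R[i]) (xi : E) : R[i] :=
  ((2 * pi) `^ (- (n%:R / 2)))%:C%C *
  cintegral (fun x => expi (- dotp x xi) * f x).

Definition support (f : E -> R[i]) : set E := closure [set x | f x != 0].

Definition admissible_pair (Phi phi : E -> R[i]) : Prop :=
  [/\ schwartz Phi, schwartz phi & exists c : R,
   [/\ 0 < c,
       support (fourier Phi) `<=` [set xi | enorm xi <= 2],
       (forall xi, enorm xi <= 5 / 3 -> c <= Normc.normc (fourier Phi xi)),
       support (fourier phi) `<=` [set xi | enorm xi <= 2] `\`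
                                  [set xi | enorm xi < 1 / 2] &
       forall xi, 3 / 5 <= enorm xi <= 5 / 3 ->
         c <= Normc.normc (fourier phi xi)]].

Definition lp_kernel (Phi phi : E -> R[i]) (v : nat) : E -> R[i] :=
  if v == 0%N then Phi
  else fun x => (2 ^+ (v * n))%:C%C * phi (2 ^+ v *: x).

End tempered_distributions.

Section variable_exponents.
Context {R : realType} {n : nat}.
Local Notation E := 'rV[R]_n.
Local Notation leb := (lebesgue_rV R n).

(* For x = y the right-hand side is the junk value c, the left-hand side 0. *)
Definition Clog_loc (g : E -> R) : Prop := exists c : R, 0 < c /\
  forall x y, `|g x - g y| <= c / ln (expR 1 + (enorm (x - y))^-1).

Definition Clog (g : E -> R) : Prop := Clog_loc g /\
  exists ginf c : R, 0 < c /\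
  forall x, `|g x - ginf| <= c / ln (expR 1 + enorm x).

Definition P0 (p : E -> R) : Prop :=
  measurable_fun [set: E] p /\ exists c : R, 0 < c /\ forall x, c <= p x.

Definition P0log (p : E -> R) : Prop := P0 p /\ Clog (fun x => (p x)^-1).

Definition luxemburg (p : E -> R) (f : E -> \bar R) : \bar R :=
  ereal_inf [set mu%:E | mu in [set mu : R | 0 < mu /\
    (\int[leb]_x ((`|f x| * (mu^-1)%:E) `^ p x) <= 1)%E]].

Definition dyadic_cube (v : int) (m : 'rV[int]_n) : set E :=
  [set x | forall i, (m ord0 i)%:~R <= (2 : R) ^ v * x ord0 i
                     < (m ord0 i)%:~R + 1].

(* A sequence indexed by v >= v0 is extended by 0 to all of nat. The Lnorm of
   exponent +oo for the counting measure is the supremum. *)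
Definition lq_norm_from (v0 : nat) (q : \bar R) (a : nat -> R) : \bar R :=
  Lnorm (@counting nat R) q (fun v => (if (v0 <= v)%N then a v else 0)%:E).

(* q takes extended real values, q = +oo being the case of the supremum. *)
Definition Fnorm (Phi phi : E -> R[i]) (alpha tau p : E -> R) (q : E -> \bar R)
    (f : tempered_distribution) : \bar R :=
  ereal_sup [set y | exists (vP : int) (m : 'rV[int]_n),
    let P := dyadic_cube vP m in
    y = luxemburg p (fun x => lq_norm_from `|Num.max vP 0|%N (q x)
      (fun v => 2 `^ (v%:R * alpha x) *
                Normc.normc (convolution (lp_kernel Phi phi v) f x) /
                (fine (leb P)) `^ tau x * \1_P x))].

Definition Fspace (Phi phi : E -> R[i]) (alpha tau p : E -> R)
    (q : E -> \bar R) : set tempered_distribution :=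
  [set f | (Fnorm Phi phi alpha tau p q f < +oo)%E].

End variable_exponents.

Definition embeds (R : realType) (V : Type) (A1 : set V) (N1 : V -> \bar R)
    (A2 : set V) (N2 : V -> \bar R) : Prop :=
  A1 `<=` A2 /\
  exists c : R, 0 < c /\ forall f, A1 f -> (N2 f <= c%:E * N1 f)%E.

(* Main.v *)
Require Import Defs.
From HB Require Import structures.
From mathcomp Require Import all_boot all_order all_algebra.
From mathcomp Require Import complex.
From mathcomp Require Import all_classical all_reals all_analysis.
From mathcomp Require Import ess_sup_inf.
From mathcomp Require Import measurable_realfun.
From mathcomp Require Import ring lra.

Set Implicit Arguments.
Unset Strict Implicit.
Unset Printing Implicit Defensive.

Import Order.TTheory GRing.Theory Num.Theory.
Import numFieldNormedType.Exports.

Local Open Scope classical_set_scope.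
Local Open Scope ring_scope.

(** The embedding follows from one pointwise estimate. Put
    s = alpha0 + n tau - n / p0 and g_v = phi_v * f. If the source norm of f is
    less than lam, then 2^(v s(x)) |g_v(x)| <= C lam for all v and x, with C
    independent of f, lam, v and x ([local_bound]).

    Given this, fix a cube P and let r(x) be the l^q(x) norm of the source
    sequence 2^(v alpha0) |g_v| / |P|^tau, v >= v_P^+, at a point x of P. Each
    term a_v of the target sequence has two bounds: a_v <= 2^(-v n (1/p0 - 1/p1)) r,
    from the relation between the exponents, and a_v <= C lam 2^(v n / p1), from
    the pointwise estimate, since 2^(v_P n tau) <= 2^(v n tau) for tau >= 0. Their
    geometric mean with weights p0/p1 and 1 - p0/p1 is free of v
    ([interpolation]): sup_v a_v <= C lam (r / (C lam))^(p0/p1). Hence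
    (sup_v a_v / (C lam))^p1 <= (r / lam)^p0, so the modular of the target is at
    most that of the source ([Fnorm_le]).

    The pointwise estimate replaces the usual eta-function and maximal function
    arguments by a sampling argument. If the source norm is less than lam, each
    dyadic cube of side 2^-(v+l) contains a point y with
    2^(v s(y)) |g_v(y)| <= lam 2^((1 + l n) / c), where p0 >= c > 0, as otherwise the modular over
    the cube of side 2^-v containing it would be at least 2 ([selected_point]).
    It remains to pass from these points to all points.

    For this, g_v is rescaled to G(b) = f(P(b - 2^v .)), which behaves like a
    function with spectrum in the ball of radius 2, and the weight 2^(v s) becomes
    a weight with polynomially bounded quotients, with constants independent of v
    (log-Hoelder continuity, [Clog_loc_moderate]). On the spectrum, d/dx_j is an
    absolutely convergent series of shifts: the sawtooth expansion
    t = sum_k 2 c_k sin(k t) on |t| <= 1, with c_k rapidly decreasing after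
    averaging the function t over short symmetric intervals
    ([sine_sum_cvg_bound], [scoef_decay]), gives
    d_j u(x) = lim_K 2 sum_(k <= K) c_k (u(x + (k/2) e_j) - u(x - (k/2) e_j))
    for Schwartz functions u with spectrum in that ball ([pderiv_shift_sum];
    both sides have the same Fourier transform, and the transform is injective
    by [fourier_injective]). The quantitative form of this identity passes to G
    by the continuity of f ([rescaled_conv_taylor]), and is a Bernstein
    inequality: increments of G are bounded by the weighted supremum of |G|.
    So, if the weighted supremum is finite, it is controlled by the values on a
    sufficiently fine net ([bounded_net_bound]). Finiteness follows by first
    using weights that also decay faster than the growth of the tempered
    distribution ([net_bound]). *)

(** * The coordinate function as a rapidly convergent sine series *)

(** Unlike the segment form of the mean value theorem, the endpoints come in
    either order. *)
Lemma MVT_abs (R : realType) (f df : R -> R) (a b M : R) :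
  (forall x, Num.min a b <= x <= Num.max a b ->
     is_derive x 1 f (df x) /\ `|df x| <= M) ->
  `|f b - f a| <= M * `|b - a|.
Proof.
wlog ab : a b / a <= b => [H|].
  move=> h; have [ab|/ltW ba] := leP a b; first exact: H.
  by rewrite distrC (distrC b); apply: H => // x; rewrite minC maxC; exact: h.
rewrite (min_idPl ab) (max_idPr ab) => h.
have [||c] := @MVT_segment R f df a b ab.
- by move=> x; rewrite in_itv/= => /andP[xa xb]; apply: (h _ _).1; rewrite !ltW.
- apply: derivable_within_continuous => x; rewrite in_itv/= => /h[hd _].
  exact: ex_derive.
rewrite in_itv/= => /h[_ dM] ->; rewrite normrM ler_wpM2r//.
Qed.

Section sine_series.
Context {R : realType}.
Implicit Types (x t : R) (k K L : nat).

(** The factor (-1)^k / (k+1) is half a Fourier coefficient of the sawtooth; the i-th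
    factor of the product is the effect on sin((k+1) t) of averaging over
    [t - 2^-(i+1), t + 2^-(i+1)]. *)
Definition scoef L k : R := (-1) ^+ k / k.+1%:R *
  \prod_(i < L) (sin (k.+1%:R / 2 ^+ i.+1) / (k.+1%:R / 2 ^+ i.+1)).

Definition sine_sum L K t : R := \sum_(k < K) 2 * scoef L k * sin (k.+1%:R * t).

(** The closed form of the Dirichlet kernel at t + pi, written in a way that avoids the division by
    cos(t/2). *)
Lemma dirichlet_sum K t :
  cos (t / 2) * (1 - \sum_(k < K) 2 * (-1) ^+ k * cos (k.+1%:R * t)) =
  (-1) ^+ K * cos ((K%:R + 1 / 2) * t).
Proof.
elim: K => [|K IH].
  by rewrite big_ord0 subr0 mulr1 expr0 mul1r add0r mulrC mul1r.
rewrite big_ord_recr/= opprD addrA mulrDr IH.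
have -> : (K%:R + 1 / 2) * t = K.+1%:R * t - t / 2.
  by rewrite -natr1; field.
have -> : (K.+1%:R + 1 / 2) * t = K.+1%:R * t + t / 2 by field.
by rewrite cosB cosD exprS; ring.
Qed.

Lemma is_derive_sum_ord (F dF : nat -> R -> R) K t :
  (forall k, is_derive t 1 (F k) (dF k t)) ->
  is_derive t 1 (fun t => \sum_(k < K) F k t) (\sum_(k < K) dF k t).
Proof.
move=> h; elim: K => [|K IH].
  rewrite big_ord0 (_ : (fun _ => _) = cst 0); last first.
    by apply/funext => x; rewrite big_ord0.
  exact: is_derive_cst.
rewrite big_ord_recr/= (_ : (fun _ => _) = (fun t => \sum_(k < K) F k t) + F K).
  exact: is_deriveD.
by apply/funext => x; rewrite big_ord_recr.
Qed.

Lemma is_derive_sine_sum L K t : is_derive t 1 (sine_sum L K)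
  (\sum_(k < K) 2 * scoef L k * (k.+1%:R * cos (k.+1%:R * t))).
Proof.
apply: (@is_derive_sum_ord (fun k t => 2 * scoef L k * sin (k.+1%:R * t))
  (fun k t => 2 * scoef L k * (k.+1%:R * cos (k.+1%:R * t)))) => k.
move: (2 * _) => c; apply: is_derive_eq.
by rewrite /GRing.scale/=; ring.
Qed.

Lemma cos_half_ge t : `|t| <= 2 -> cos 1 <= cos (t / 2).
Proof.
move=> t2; have -> : cos (t / 2) = cos (`|t| / 2).
  by have [//|_] := ger0P t; rewrite mulNr cosN.
have [/eqP ->|ne] := boolP (`|t| / 2 == 1); first by [].
apply/ltW; have pi2 := @pi_ge2 R.
have t0 : 0 <= `|t| := normr_ge0 t.
rewrite ltr_cos ?in_itv/=.
- by rewrite lt_neqAle eq_sym; move: ne; rewrite neq_lt; lra.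
- by apply/andP; split; lra.
- by apply/andP; split; lra.
Qed.

(** By [dirichlet_sum] the derivative of the error is
    (-1)^K cos(N s) / cos(s/2) with N = K + 1/2. Integrating by parts leaves the
    boundary term G, of size 1/N, and the integral of dG, whose integrand is of
    size 1/N too. The mean value theorem for the error minus G does
    this without integrals. On |t| <= 2 the denominator cos(t/2) stays away from 0. *)
Lemma sawtooth : exists C : R, 0 < C /\ forall K t, `|t| <= 2 ->
  `|t - sine_sum 0 K t| <= C / K.+1%:R.
Proof.
have k0 : 0 < cos 1 :> R.
  exact: cos1_gt0.
set kap := cos 1 in k0.
exists (2 / kap + 2 / kap ^+ 2); split.
  by rewrite addr_gt0 ?divr_gt0 ?exprn_gt0.
move=> K t t2.
set F := fun t => t - sine_sum 0 K t.
pose N : R := K%:R + 1 / 2.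
have N0 : 0 < N by rewrite /N ltr_wpDl// divr_gt0.
pose G (t : R) := (-1) ^+ K * sin (N * t) / (N * cos (t / 2)).
pose dG (s : R) := - ((-1) ^+ K * sin (N * s) * sin (s / 2) / (2 * N * cos (s / 2) ^+ 2)).
have H : `|(F t - G t) - (F 0 - G 0)| <= 1 / (2 * N * kap ^+ 2) * `|t - 0|.
  apply: (@MVT_abs R (fun t => F t - G t) dG) => s sint.
  have s2 : `|s| <= 2.
    rewrite (le_trans _ t2)//; have [t0|t0] := leP 0 t.
      move: sint; rewrite (min_idPl t0) (max_idPr t0) => /andP[s0 st].
      by rewrite !ger0_norm.
    move: sint; rewrite (min_idPr (ltW t0)) (max_idPl (ltW t0)) => /andP[s0 st].
    by rewrite ler0_norm// ltr0_norm// lerN2.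
  have cs := cos_half_ge s2; rewrite -/kap in cs.
  have cs0 : 0 < cos (s / 2) := lt_le_trans k0 cs.
  have csn0 : cos (s / 2) != 0 by rewrite gt_eqF.
  have Nn0 : N != 0 by rewrite gt_eqF.
  split; last first.
    have n1 : `|(-1) ^+ K * sin (N * s) * sin (s / 2)| <= 1.
      rewrite 2!normrM normrX normrN1 expr1n mul1r mulr_ile1//.
        by rewrite ler_norml sin_geN1 sin_le1.
      by rewrite ler_norml sin_geN1 sin_le1.
    rewrite /dG normrN normf_div.
    rewrite (@ger0_norm _ (2 * N * _)); last first.
      by rewrite mulr_ge0 ?sqr_ge0// mulr_ge0// ltW.
    apply: ler_pM => //.
      by rewrite invr_ge0 mulr_ge0 ?sqr_ge0// mulr_ge0// ltW.
    rewrite lef_pV2 ?posrE ?mulr_gt0 ?exprn_gt0//.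
    by rewrite ler_pM2l ?mulr_gt0// lerXn2r// nnegrE ltW.
  have dF : is_derive s 1 F
      (1 - \sum_(k < K) 2 * (-1) ^+ k * cos (k.+1%:R * s)).
    have h := @is_derive_sine_sum 0 K s.
    apply: is_derive_eq; congr (_ - _); apply: eq_bigr => k _.
    by rewrite /scoef big_ord0 mulr1; field.
  have dc : is_derive s 1 (fun t => (N * cos (t / 2))^-1)
      (N * sin (s / 2) / 2 / (N * cos (s / 2)) ^+ 2).
    have nn : N * cos (s / 2) != 0 by rewrite mulf_neq0.
    have d1 : is_derive s 1 (fun t => N * cos (t / 2)) (- (N * sin (s / 2) / 2)).
      by apply: is_derive_eq; rewrite /GRing.scale/=; field.
    have d2 := @is_deriveV R (fun t => N * cos (t / 2)) s _ 1 nn d1.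
    by apply: is_derive_eq; rewrite /GRing.scale/=; field; rewrite csn0 Nn0.
  have ds : is_derive s 1 (fun t => (-1) ^+ K * sin (N * t))
      ((-1) ^+ K * (N * cos (N * s))).
    by move: ((-1) ^+ K) => c; apply: is_derive_eq; rewrite /GRing.scale/=; ring.
  have dGs : is_derive s 1 G ((-1) ^+ K * (N * cos (N * s)) / (N * cos (s / 2)) +
     (-1) ^+ K * sin (N * s) * (N * sin (s / 2) / 2 / (N * cos (s / 2)) ^+ 2)).
    have := is_deriveM ds dc.
    rewrite (_ : _ * _ = G) => // h; apply: is_derive_eq.
    by rewrite /GRing.scale/=; ring.
  apply: is_derive_eq; rewrite /dG.
  have := dirichlet_sum K s; rewrite -/N => E.
  have -> : 1 - \sum_(k < K) 2 * (-1) ^+ k * cos (k.+1%:R * s) =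
    (-1) ^+ K * cos (N * s) / cos (s / 2).
    by apply: (mulfI csn0); rewrite E; field.
  by field; rewrite csn0 Nn0.
have F0 : F 0 = 0.
  rewrite /F /sine_sum big1 ?subr0// => k _.
  by rewrite mulr0 sin0 mulr0.
have G0 : G 0 = 0 by rewrite /G mulr0 sin0 mulr0 mul0r.
move: H; rewrite F0 G0 !subr0 => H.
have G1 : `|G t| <= 1 / (N * kap).
  have cs := cos_half_ge t2.
  have cs0 : 0 < cos (t / 2) := lt_le_trans k0 cs.
  rewrite /G normf_div normrM normrX normrN1 expr1n.
  rewrite (@gtr0_norm _ (N * cos _)) ?mulr_gt0//.
  apply: ler_pM => //.
  - by rewrite invr_ge0 ltW// mulr_gt0.
  - by rewrite mul1r ler_norml sin_geN1 sin_le1.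
  - by rewrite lef_pV2 ?posrE ?mulr_gt0// ler_pM2l.
rewrite -/(F t) -(subrK (G t) (F t)) (le_trans (ler_normD _ _))//.
have Nge : K.+1%:R / 2 <= N by rewrite /N -natr1; have : 0 <= K%:R :> R by []; lra.
have Ninv : N^-1 <= 2 / K.+1%:R.
  have K0 : 0 < K.+1%:R / 2 :> R by rewrite divr_gt0.
  by rewrite -(invf_div K.+1%:R 2) lef_pV2 ?posrE.
have k2 : 0 < kap ^+ 2 by rewrite exprn_gt0.
have h1 : `|F t - G t| <= N^-1 / kap ^+ 2.
  apply: (le_trans H); apply: (@le_trans _ _ (1 / (2 * N * kap ^+ 2) * 2)).
    by rewrite ler_wpM2l// divr_ge0// mulr_ge0 ?ltW// mulr_gt0.
  by rewrite le_eqVlt; apply/orP; left; apply/eqP; field; rewrite !gt_eqF.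
have h2 : `|G t| <= N^-1 / kap by apply: (le_trans G1); rewrite mul1r invfM.
apply: (le_trans (lerD h1 h2)).
rewrite [leRHS](_ : _ = 2 / K.+1%:R / kap ^+ 2 + 2 / K.+1%:R / kap); last first.
  by field; rewrite !gt_eqF.
by apply: lerD; apply: ler_wpM2r => //; rewrite invr_ge0 ltW.
Qed.

(** Averaging over [t - e, t + e] with e = 2^-(L+1) fixes the function t and
    multiplies sin((k+1) t) by sin((k+1) e) / ((k+1) e), which turns the
    coefficients for L into those for L + 1. The average of the error is the
    increment of its primitive H, so that it is bounded by the mean value
    theorem; the price is a loss e in the range of t. *)
Lemma sine_sum_average L K (a E : R) :
  (forall t, `|t| <= a + 2^-1 ^+ L.+1 -> `|t - sine_sum L K t| <= E) ->
  forall t, `|t| <= a -> `|t - sine_sum L.+1 K t| <= E.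
Proof.
set e := 2^-1 ^+ L.+1 => hE t ta.
have e0 : 0 < e by rewrite exprn_gt0.
have eE : e = (2 ^+ L.+1)^-1 by rewrite /e exprVn.
pose H (s : R) := s ^+ 2 / 2 + \sum_(k < K) 2 * scoef L k / k.+1%:R * cos (k.+1%:R * s).
have : `|H (t + e) - H (t - e)| <= E * `|(t + e) - (t - e)|.
  apply: (@MVT_abs R H (fun s => s - sine_sum L K s)) => s.
  rewrite minEle maxEle; have -> : (t - e <= t + e) by lra.
  move=> sint; split; last first.
    by apply: hE; move: sint ta; rewrite !ler_norml; lra.
  have d1 : is_derive s 1 (fun s => \sum_(k < K) 2 * scoef L k / k.+1%:R * cos (k.+1%:R * s)) (\sum_(k < K) - (2 * scoef L k * sin (k.+1%:R * s))).
    apply: (@is_derive_sum_ord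
      (fun k s => 2 * scoef L k / k.+1%:R * cos (k.+1%:R * s))
      (fun k s => - (2 * scoef L k * sin (k.+1%:R * s)))) => k.
    move: (2 * _) => c; apply: is_derive_eq.
    by rewrite /GRing.scale/=; field.
  rewrite sumrN in d1.
  rewrite /H; apply: is_derive_eq; congr (_ - _).
  by rewrite /GRing.scale/=; field.
have -> : t + e - (t - e) = 2 * e by ring.
have -> : H (t + e) - H (t - e) = 2 * e * (t - sine_sum L.+1 K t).
  rewrite /H opprD addrACA -sumrB mulrBr /sine_sum mulr_sumr -sumrN.
  congr (_ + _); first by field.
  apply: eq_bigr => k _.
  rewrite !mulrDr mulrN cosB cosD.
  have -> : scoef L.+1 k = scoef L k * (sin (k.+1%:R * e) / (k.+1%:R * e)).
    by rewrite /scoef big_ord_recr/= eE -!mulrA.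
  by field; rewrite !gt_eqF ?ltr0n//.
rewrite normrM (gtr0_norm (_ : 0 < 2 * e)) ?mulr_gt0// mulrC ler_pM2r//.
by rewrite mulr_gt0.
Qed.

(** The successive losses 2^-1, 2^-2, ... shrink the range |t| <= 2 of
    [sawtooth] to |t| <= 1 at worst, so the rate does not depend on L. *)
Lemma sine_sum_cvg_bound : exists C : R, 0 < C /\ forall L K t, `|t| <= 1 ->
  `|t - sine_sum L K t| <= C / K.+1%:R.
Proof.
have [C [C0 hC]] := sawtooth; exists C; split=> // L K.
suff h t : `|t| <= 1 + 2^-1 ^+ L -> `|t - sine_sum L K t| <= C / K.+1%:R.
  by move=> t t1; apply: h; rewrite ler_wpDr.
elim: L t => [t|L IH]; first by rewrite expr0; exact: hC.
apply: sine_sum_average => t tL; apply: IH; apply: (le_trans tL).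
by move: (2^-1 ^+ L) (exprS (2^-1 : R) L) => x ->; lra.
Qed.

Lemma sin_div_le1 x : `|sin x / x| <= 1.
Proof.
have [->|x0] := eqVneq x 0; first by rewrite invr0 mulr0 normr0.
rewrite normf_div ler_pdivrMr ?normr_gt0// -[sin x]subr0 -sin0 -[x in leRHS]subr0.
apply: (@MVT_abs R sin cos) => s _; split; first exact: is_derive_sin.
by rewrite ler_norml cos_geN1 cos_le1.
Qed.

(** N of the L averaging factors are bounded by 2^(i+1) / (k+1), and the others
    by 1, so the bound is uniform in L >= N. *)
Lemma scoef_decay N : exists C : R, 0 < C /\ forall L k, (N <= L)%N ->
  `|scoef L k| <= C / k.+1%:R ^+ N.
Proof.
exists (\prod_(i < N) 2 ^+ i.+1); split; first by apply: prodr_gt0.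
move=> L k NL.
rewrite /scoef normrM normf_div normrX normrN1 expr1n mul1r normr_nat.
rewrite -[X in _ <= X]mul1r; apply: ler_pM => //.
  by rewrite invr_le1 ?ler1n// unitfE.
rewrite normr_prod -(subnKC NL) big_split_ord/= -[X in _ <= X]mulr1.
apply: ler_pM.
- exact: prodr_ge0.
- exact: prodr_ge0.
- rewrite -[N in X in _ <= _ / X]card_ord -prodr_const -prodf_div.
  apply: ler_prod => i _; rewrite normr_ge0/=.
  have d0 : 0 < k.+1%:R / 2 ^+ i.+1 :> R by rewrite divr_gt0 ?exprn_gt0.
  rewrite normf_div (gtr0_norm d0).
  by rewrite invf_div ler_piMl ?divr_ge0 ?exprn_ge0// ler_norml sin_geN1 sin_le1.
- by apply: prodr_ile1 => i; rewrite normr_ge0 sin_div_le1.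
Qed.
End sine_series.

(** * Dyadic cubes, measurability and translation invariance on row vectors *)

Section row_space.
Context {R : realType}.

Lemma rV_norm_le n (x : 'rV[R]_n) (e : R) : 0 <= e ->
  (forall i, `|x ord0 i| <= e) -> `|x| <= e.
Proof.
move=> e0 xe; rewrite [leLHS]/Num.Def.normr/= mx_normrE (bigmax_le _ e0)//.
by move=> -[i j] _ /=; rewrite (ord1 i).
Qed.

Lemma measurable_dyadic_cube n v m : measurable (@dyadic_cube R n v m).
Proof.
rewrite (_ : dyadic_cube v m = \bigcap_(i in [set: 'I_n])
   ((fun x : 'rV[R]_n => x ord0 i) @^-1`
     [set r | (m ord0 i)%:~R <= 2 ^ v * r < (m ord0 i)%:~R + 1])); last first.
  by apply/seteqP; split=> [x h i _|x h i]; [exact: h|exact: (h i)].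
apply: fin_bigcap_measurable => // i _.
rewrite -[X in measurable X]setTI; apply: measurable_coord => //.
rewrite (_ : [set _ | _] =
  (fun r => 2 ^ v * r) @^-1` `[(m ord0 i)%:~R, (m ord0 i)%:~R + 1[%classic); last first.
  by apply/seteqP; split=> r /=; rewrite in_itv.
rewrite -[X in measurable X]setTI.
by apply: mulrl_measurable.
Qed.

Definition dyadic_index n (v : int) (x : 'rV[R]_n) : 'rV[int]_n :=
  \row_i Num.floor (2 ^ v * x ord0 i).

Lemma dyadic_indexP n v m (x : 'rV[R]_n) :
  dyadic_cube v m x <-> dyadic_index v x = m.
Proof.
split=> [h|<-].
  by apply/rowP => i; rewrite mxE; apply: floor_def; rewrite intrD; exact: h.
by move=> i; rewrite mxE -intrD1; exact: floor_itv.
Qed.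

Lemma dyadic_cube_dist n (v : nat) (x y : 'rV[R]_n) :
  dyadic_cube v (dyadic_index v x) y ->
  forall i, `|x ord0 i - y ord0 i| <= 2^-1 ^+ v.
Proof.
move=> Qy i; have := Qy i; have /(_ i) := (dyadic_indexP v _ x).2 erefl.
set z := (_)%:~R.
have p0 : 0 < 2 ^ v :> R by rewrite exprn_gt0.
have -> : x ord0 i - y ord0 i = (2 ^ v * x ord0 i - 2 ^ v * y ord0 i) / 2 ^ v.
  by field; rewrite gt_eqF.
move=> /andP[h1 h2] /andP[h3 h4].
rewrite normrM normfV (gtr0_norm p0) exprVn ler_piMl ?invr_ge0 ?(ltW p0)//.
by rewrite ler_norml; apply/andP; split; lra.
Qed.

Lemma dyadic_cube_nested n (v l : nat) (x y : 'rV[R]_n) :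
  dyadic_cube (v + l)%N (dyadic_index (v + l)%N x) y ->
  dyadic_cube v (dyadic_index v x) y.
Proof.
move=> /dyadic_indexP h; apply/dyadic_indexP.
have le_floor (a b : 'rV[R]_n) i : dyadic_index (v + l)%N a = dyadic_index (v + l)%N b ->
    Num.floor (2 ^ v * a ord0 i) <= Num.floor (2 ^ v * b ord0 i).
  move=> /rowP/(_ i); rewrite !mxE => e.
  have p0 : 0 < 2 ^+ l :> R by rewrite exprn_gt0.
  have scale : 2 ^ (v + l)%N = 2 ^ v * 2 ^+ l :> R by rewrite -!exprnP exprD.
  rewrite floor_ge_int; set m := Num.floor (2 ^ v * _).
  have : m * 2 ^+ l <= Num.floor (2 ^ (v + l)%N * a ord0 i).
    rewrite floor_ge_int intrM rmorphXn/= scale mulrAC ler_pM2r//.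
    exact: floor_le.
  by rewrite e floor_ge_int intrM rmorphXn/= scale mulrAC ler_pM2r.
by apply/rowP => i; rewrite !mxE; apply/eqP; rewrite eq_le !le_floor.
Qed.

(** The sigma-algebra is generated by the coordinates, not by the open sets.
    A continuous function is the limit of its samples at the corners of dyadic
    cubes, and each of these is constant on the countably many cubes of one size. *)
Lemma measurable_continuous_rV n (u : 'rV[R]_n -> R) :
  continuous u -> measurable_fun [set: 'rV[R]_n] u.
Proof.
move=> cu.
pose r (k : nat) (x : 'rV[R]_n) : 'rV[R]_n :=
  \row_i ((dyadic_index k x ord0 i)%:~R / 2 ^ k).
apply: (@measurable_fun_cvg _ _ _ setT (fun k => u \o r k)).
  move=> k _ B mB; rewrite setTI.
  rewrite (_ : _ @^-1` B = \bigcup_(m : 'rV[int]_n)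
     (dyadic_cube k m `&` [set _ | B (u (\row_i ((m ord0 i)%:~R / 2 ^ k)))])); last first.
    apply/seteqP; split=> [x Bx|x [m _ [/dyadic_indexP <- //]]].
    by exists (dyadic_index k x) => //; split=> //; exact/dyadic_indexP.
  apply: countable_bigcupT_measurable => // m.
  have [h|h] := pselect (B (u (\row_i ((m ord0 i)%:~R / 2 ^ k)))).
    rewrite (_ : [set _ | _] = setT) ?setIT; last by apply/seteqP; split=> y.
    exact: measurable_dyadic_cube.
  rewrite (_ : [set _ | _] = set0); last first.
    by apply/seteqP; split=> [y By|y []]; exact: (h By).
  by rewrite setI0; exact: measurable0.
move=> x _; apply: continuous_cvg; first exact: cu.
apply/cvgrPdist_le => e e0.
near=> k.
apply: rV_norm_le; first exact: ltW.
move=> i; rewrite !mxE.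
have p0 : 0 < 2 ^ k :> R by rewrite exprn_gt0.
have := floor_itv (2 ^ k * x ord0 i).
set z := (Num.floor _)%:~R; rewrite intrD1 -/z => /andP[h1 h2].
have -> : x ord0 i - z / 2 ^ k = (2 ^ k * x ord0 i - z) / 2 ^ k.
  by field; rewrite gt_eqF.
apply: (@le_trans _ _ (2 ^ k)^-1).
  rewrite normrM normfV (gtr0_norm p0) ler_piMl ?invr_ge0 ?(ltW p0)//.
  by rewrite ger0_norm; lra.
rewrite -exprVn.
near: k; have := @cvg_geometric R 1 2^-1.
rewrite ger0_norm// invf_lt1// ltr1n => /(_ isT)/cvgrPdist_le/(_ _ e0).
apply: filterS => k /=.
by rewrite sub0r normrN mul1r ger0_norm// exprn_ge0.
Unshelve. all: by end_near. Qed.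

Lemma measurable_translation_rV n (t : 'rV[R]_n) :
  measurable_fun [set: 'rV[R]_n] (fun x => x + t).
Proof.
apply: measurable_fun_rV => i; under eq_fun do rewrite mxE.
by apply: measurable_funD => //; exact: measurable_coord.
Qed.

Lemma lebesgue_measure_translation (t : R) (A : set R) : measurable A ->
  lebesgue_measure ((fun x => x + t) @^-1` A) = lebesgue_measure A.
Proof.
move=> mA.
pose f (x : measurableTypeR R) : measurableTypeR R := x + t.
have mt : measurable_fun setT f by apply: measurable_funD.
have := @lebesgue_measure_unique R
   (measure_function_pushforward__canonical__measure_function_Measure
      (@lebesgue_measure R) mt).
move=> /(_ _ A mA) -> // _ [[a b]] _ <-.
transitivity (@lebesgue_measure R `]a - t, b - t]%classic).
  rewrite !lebesgue_measure_itv/= !lte_fin ltrD2r.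
  by case: ifP => // _; rewrite -!EFinB; congr EFin; ring.
rewrite /= /pushforward; congr lebesgue_measure.
by apply/seteqP; split=> x /=; rewrite !in_itv/= /f ltrBlDr lerBrDr.
Qed.

(** By induction on the dimension, from the uniqueness of product measures. *)
Lemma lebesgue_rV_translation n (t : 'rV[R]_n) (A : set 'rV[R]_n) : measurable A ->
  lebesgue_rV R n ((fun x => x + t) @^-1` A) = lebesgue_rV R n A.
Proof.
elim: n => [|n IH] in t A *.
  move=> _; rewrite (_ : _ @^-1` A = A)//.
  by apply/seteqP; split=> x /=; rewrite (thinmx0 (x + t)) (thinmx0 x).
move=> mA.
rewrite /= /lebesgue_rV_step /pushforward.
pose t' : 'rV[R]_n := \row_i t ord0 (lift ord0 i).
pose s (z : measurableTypeR R * 'rV[R]_n) : measurableTypeR R * 'rV[R]_n :=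
  (z.1 + t ord0 ord0, z.2 + t').
have ms : measurable_fun setT s.
  apply: measurable_fun_pair.
    by apply: measurable_funD => //; exact: measurable_fst.
  exact: (measurableT_comp (@measurable_translation_rV n t') measurable_snd).
rewrite (_ : _ @^-1` (_ @^-1` A) = s @^-1` (@cons_rV R n @^-1` A)); last first.
  apply/seteqP; split=> z /=; congr (A _); apply/rowP => i;
  by rewrite /s !mxE; case: unliftP => [j|] ->; rewrite ?mxE.
pose m' := measure_function_pushforward__canonical__measure_function_Measure
    (@lebesgue_measure R \x lebesgue_rV R n)%E ms.
have := @product_measure_unique _ _ _ _ R (@lebesgue_measure R) (lebesgue_rV R n) m'.
move=> /(_ _ (@cons_rV R n @^-1` A)) -> //; last first.
  by rewrite -[X in measurable X]setTI; exact: measurable_cons_rV.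
move=> X Y mX mY.
rewrite /m' /= /pushforward (_ : s @^-1` _ =
   ((fun x => x + t ord0 ord0) @^-1` X) `*` ((fun x => x + t') @^-1` Y)); last first.
  by apply/seteqP; split.
rewrite product_measure1E; last 2 first.
- rewrite -[X in measurable X]setTI.
  by apply: (@measurable_funD _ _ _ setT (@id R)).
- by rewrite -[X in measurable X]setTI; exact: measurable_translation_rV.
by congr (_ * _)%E; [exact: lebesgue_measure_translation|exact: IH].
Qed.

Lemma integral_translation_rV n (t : 'rV[R]_n) (f : 'rV[R]_n -> \bar R) :
  measurable_fun setT f -> (forall x, 0 <= f x)%E ->
  (\int[lebesgue_rV R n]_x f (x + t)%R = \int[lebesgue_rV R n]_x f x)%E.
Proof.
move=> mf f0.
have mt := @measurable_translation_rV n t.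
rewrite -[LHS](@ge0_integral_pushforward _ _ _ _ R _ mt (lebesgue_rV R n) setT f)//.
apply: eq_measure_integral => A mA _ /=.
exact: lebesgue_rV_translation.
Qed.

(** An integrable majorant that factors over the coordinates. *)
Definition kappa n (x : 'rV[R]_n) : R := \prod_i (1 + x ord0 i ^+ 2)^-1.

Lemma kappa_gt0 n (x : 'rV[R]_n) : 0 < kappa x.
Proof. by apply: prodr_gt0 => i _; rewrite invr_gt0 ltr_pwDl// sqr_ge0. Qed.

Lemma measurable_kappa n : measurable_fun setT (@kappa n).
Proof.
rewrite /kappa.
apply: (@measurable_prod _ _ R setT _ _ (fun i (x : 'rV[R]_n) => (1 + x ord0 i ^+ 2)^-1)) => i _.
apply: (@measurableT_comp _ _ _ _ _ _ (fun r : R => (oneDsqr r)^-1)).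
  by apply: continuous_measurable_fun => x; exact: continuous_oneDsqrV.
exact: measurable_coord.
Qed.

Lemma integrable_kappa n : (lebesgue_rV R n).-integrable setT (EFin \o @kappa n).
Proof.
apply/integrableP; split; first by apply/measurable_EFinP; exact: measurable_kappa.
under eq_integral do rewrite /= (gtr0_norm (kappa_gt0 _)).
elim: n => [|n IH].
  rewrite integral_dirac//=; last by apply/measurable_EFinP; exact: measurable_kappa.
  by rewrite diracE mem_set//= mul1e ltry.
rewrite [X in (X < _)%E](@ge0_integral_pushforward _ _ _ _ R _
  (@measurable_cons_rV R n) (lebesgue_measure \x lebesgue_rV R n)%E setT
  (EFin \o @kappa n.+1))//=; last 2 first.
- apply/measurable_EFinP; exact: measurable_kappa.
- by move=> x _; rewrite lee_fin ltW// kappa_gt0.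
rewrite preimage_setT.
have mk : measurable_fun setT ((EFin \o @kappa n.+1) \o @cons_rV R n).
  apply: measurableT_comp; last exact: measurable_cons_rV.
  apply/measurable_EFinP; exact: measurable_kappa.
rewrite (@fubini_tonelli1 _ _ _ _ R lebesgue_measure (lebesgue_rV R n)
  ((EFin \o @kappa n.+1) \o @cons_rV R n))//; last first.
  by move=> z; rewrite lee_fin ltW// kappa_gt0.
rewrite /fubini_F/=.
have E x : (\int[lebesgue_rV R n]_y (kappa (cons_rV (x, y)))%:E =
   (oneDsqr x)^-1%:E * \int[lebesgue_rV R n]_y (kappa y)%:E)%E.
  rewrite -ge0_integralZl//.
  - apply: eq_integral => y _; rewrite -EFinM; congr EFin.
    rewrite /kappa big_ord_recl cons_rVE0; congr (_ * _).
    by apply: eq_bigr => i _; rewrite cons_rVES.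
  - apply/measurable_EFinP; exact: measurable_kappa.
  - by move=> y _; rewrite lee_fin ltW// kappa_gt0.
under eq_integral do rewrite E.
rewrite ge0_integralZr//=; last 2 first.
- apply/measurable_EFinP.
  by apply: (@continuous_measurable_fun R) => x; exact: continuous_oneDsqrV.
- by apply: integral_ge0 => y _; rewrite lee_fin ltW// kappa_gt0.
rewrite lte_mul_pinfty//.
- by apply: integral_ge0 => y _; rewrite lee_fin invr_ge0 addr_ge0 ?sqr_ge0.
rewrite ge0_symfun_integralT.
- have E0 := @integral0y_oneDsqr R.
  rewrite (_ : [set x | _] = `[0%R, +oo[%classic); last first.
    by apply/seteqP; split=> x; rewrite /= in_itv/= andbT.
  by rewrite E0 -EFinM.
- by move=> x; rewrite invr_ge0 addr_ge0 ?sqr_ge0.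
- by move=> x; exact: continuous_oneDsqrV.
- by move=> x /=; rewrite /oneDsqr sqrrN.
Qed.

Lemma lebesgue_dyadic_cube n v m :
  lebesgue_rV R n (dyadic_cube v m) = (((2 ^ v)^-1) ^+ n)%:E.
Proof.
have p0 : 0 < 2 ^ v :> R by rewrite exprz_gt0.
elim: n => [|n IH] in m *.
  rewrite /= diracE mem_set ?expr0// => -[]//.
rewrite /= /lebesgue_rV_step /pushforward.
pose m' : 'rV[int]_n := \row_i m ord0 (lift ord0 i).
rewrite (_ : _ @^-1` _ =
   `[(m ord0 ord0)%:~R / 2 ^ v, ((m ord0 ord0)%:~R + 1) / 2 ^ v[%classic
     `*` dyadic_cube v m'); last first.
  have e a (z : R) : (a <= 2 ^ v * z < a + 1) =
      (z \in `[a / 2 ^ v, (a + 1) / 2 ^ v[).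
    by rewrite in_itv/= ler_pdivrMr// ltr_pdivlMr// mulrC.
  apply/seteqP; split=> z /=.
    move=> h; split; first by rewrite /= -e; have := h ord0; rewrite cons_rVE0.
    by move=> i; have := h (lift ord0 i); rewrite cons_rVES mxE.
  move=> [h0 h1] i; case: (unliftP ord0 i) => [j|] ->.
    by rewrite cons_rVES; have := h1 j; rewrite mxE.
  by rewrite cons_rVE0 e.
rewrite product_measure1E//; last exact: measurable_dyadic_cube.
rewrite IH exprS EFinM; congr (_ * _)%E.
have := @lebesgue_measure_itv R
  `[(m ord0 ord0)%:~R / 2 ^ v, ((m ord0 ord0)%:~R + 1) / 2 ^ v[.
rewrite /= lte_fin ltr_pM2r ?invr_gt0// ltrDl ltr01 => ->.
by rewrite -EFinB; congr EFin; field; rewrite gt_eqF.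
Qed.

End row_space.

(** * Injectivity of the Fourier transform *)

Section dominated.
Context {R : realType} {n : nat}.
Local Notation E := 'rV[R]_n.
Local Notation mu := (lebesgue_rV R n).

(** These functions form a linear space of integrable functions, stable under
    products with bounded functions and under shifts. *)
Definition kdom (u : E -> R) : Prop :=
  measurable_fun [set: E] u /\ exists C, forall x, `|u x| <= C * kappa x.

Lemma integrable_kdom u : kdom u -> mu.-integrable setT (EFin \o u).
Proof.
move=> [mu_ [C uC]].
apply: (@le_integrable _ _ _ mu setT _ (EFin \o u) (fun x => (C%:E * (EFin \o @kappa R n) x)%E)) => //.
- exact/measurable_EFinP.
- by move=> x _; rewrite /= lee_fin (le_trans (uC x))// ler_norm.
- by apply: integrableZl => //; exact: integrable_kappa.
Qed.

Lemma kdom_bounded_mul u (F : E -> R) (B : R) : kdom u -> measurable_fun [set: E] F ->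
  (forall x, `|F x| <= B) -> kdom (fun x => u x * F x).
Proof.
move=> [mu_ [C uC]] mF FB; split; first exact: measurable_funM.
exists (C * B) => x; rewrite normrM mulrAC; apply: ler_pM => //.
Qed.

Lemma kdomD u v : kdom u -> kdom v -> kdom (fun x => u x + v x).
Proof.
move=> [mu_ [C uC]] [mv [D vD]]; split; first exact: measurable_funD.
exists (C + D) => x; rewrite mulrDl (le_trans (ler_normD _ _))//.
by rewrite lerD.
Qed.

Lemma kdomZ a u : kdom u -> kdom (fun x => a * u x).
Proof.
move=> [mu_ [C uC]]; split; first exact: measurable_funM.
exists (`|a| * C) => x; rewrite normrM -mulrA ler_wpM2l//.
Qed.

Lemma Rintegral_dominated_cvg (u_ : nat -> E -> R) u C :
  (forall k, measurable_fun setT (u_ k)) ->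
  (forall k x, `|u_ k x| <= C * kappa x) ->
  (forall x, u_ ^~ x @ \oo --> u x) ->
  kdom u /\ (\int[mu]_x u_ k x)%R @[k --> \oo] --> (\int[mu]_x u x)%R.
Proof.
move=> mu_ uC uu.
have mlim : measurable_fun setT u.
  by apply: (@measurable_fun_cvg _ _ _ setT u_) => // x _; exact: uu.
have ku : kdom u.
  split=> //; exists C => x.
  by apply: (cvgr_to_le (cvg_norm (uu x))); apply: nearW => k; exact: uC.
split=> //.
have uuE : {ae mu, forall x, setT x -> (EFin \o u_ k) x @[k --> \oo] --> (EFin \o u) x}.
  apply: aeW => x _; apply: cvg_EFin; first by apply: nearW => k.
  exact: uu.
have uCE : {ae mu, forall x k, setT x -> (`|(EFin \o u_ k) x| <= C%:E * (EFin \o @kappa R n) x)%E}.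
  by apply: aeW => x k _; rewrite /= lee_fin.
have [||_ _] := @dominated_convergence _ _ R mu setT measurableT
  (fun k => EFin \o u_ k) (EFin \o u) (fun x => (C%:E * (EFin \o @kappa R n) x)%E)
  _ _ uuE (integrableZl measurableT C (integrable_kappa n)) uCE.
- by move=> k; exact/measurable_EFinP.
- exact/measurable_EFinP.
rewrite /= => h; apply: fine_cvg.
rewrite fineK//; apply: integrable_fin_num => //.
exact: integrable_kdom.
Qed.

Lemma measurable_dotp (xi : E) : measurable_fun [set: E] (dotp ^~ xi).
Proof.
apply: measurable_sum => i; apply: measurable_funM => //.
exact: measurable_coord.
Qed.

Lemma measurable_wave (xi : E) th :
  measurable_fun [set: E] (fun x => cos (dotp x xi + th)).
Proof.
apply: (@measurableT_comp _ _ _ _ _ _ (@cos R)).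
  by apply: continuous_measurable_fun; exact: continuous_cos.
by apply: measurable_funD => //; exact: measurable_dotp.
Qed.

Lemma norm_cos_le1 (t : R) : `|cos t| <= 1.
Proof. by rewrite ler_norml cos_geN1 cos_le1. Qed.

Lemma norm_sin_le1 (t : R) : `|sin t| <= 1.
Proof. by rewrite ler_norml sin_geN1 sin_le1. Qed.

Lemma dotpDr (x y z : E) : dotp x (y + z) = dotp x y + dotp x z.
Proof. by rewrite /dotp -big_split; apply: eq_bigr => i _; rewrite mxE mulrDr. Qed.

Lemma dotpNr (x y : E) : dotp x (- y) = - dotp x y.
Proof. by rewrite /dotp -sumrN; apply: eq_bigr => i _; rewrite mxE mulrN. Qed.

Lemma dotpDl (x y z : E) : dotp (x + y) z = dotp x z + dotp y z.
Proof. by rewrite /dotp -big_split; apply: eq_bigr => i _; rewrite mxE mulrDl. Qed.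

Lemma dotpZl a (x z : E) : dotp (a *: x) z = a * dotp x z.
Proof. by rewrite /dotp mulr_sumr; apply: eq_bigr => i _; rewrite mxE mulrA. Qed.

Lemma dotp_delta (a : R) (x : E) (i : 'I_n) :
  dotp x (a *: delta_mx ord0 i) = a * x ord0 i.
Proof.
rewrite /dotp (bigD1 i)//= big1 ?addr0; last first.
  by move=> j ji; rewrite !mxE eqxx (negbTE ji)/= !mulr0.
by rewrite !mxE !eqxx/= mulr1 mulrC.
Qed.

Lemma dotp_deltal (xi : E) (i : 'I_n) : dotp (delta_mx ord0 i) xi = xi ord0 i.
Proof.
rewrite /dotp (bigD1 i)//= big1 ?addr0; last first.
  by move=> j ji; rewrite !mxE eqxx (negbTE ji)/= !mul0r.
by rewrite !mxE !eqxx/= mul1r.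
Qed.

End dominated.

Section sinc.
Context {R : realType}.

Definition sinc (t : R) : R := if t == 0 then 1 else sin t / t.

Lemma sinc_le1 t : `|sinc t| <= 1.
Proof. by rewrite /sinc; case: ifP => _; [rewrite normr1|exact: sin_div_le1]. Qed.

Lemma sinc_mean_value t : exists2 c, `|c| <= `|t| & sinc t = cos c.
Proof.
wlog t0 : t / 0 <= t.
  move=> H; have [|/ltW t0] := leP 0 t; first exact: H.
  have [|c ct e] := H (- t); first by rewrite oppr_ge0.
  exists c; first by rewrite -(normrN t).
  by rewrite -e /sinc oppr_eq0 sinN invrN mulrNN.
move: t0; rewrite le_eqVlt => /predU1P[<-|t0].
  by exists 0; rewrite ?normr0// /sinc eqxx cos0.
have [|c] := @MVT R sin cos 0 t t0.
  by apply: derivable_within_continuous => x _; exact: ex_derive.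
rewrite in_itv/= => /andP[c0 ct]; rewrite sin0 !subr0 => e.
exists c; first by rewrite !gtr0_norm// ltW.
by rewrite /sinc gt_eqF// e mulfK// gt_eqF.
Qed.

Lemma sinc_near0 : sinc t @[t --> (0 : R)] --> (1 : R).
Proof.
apply/cvgrPdist_le => e e0.
have /cvgrPdist_le/(_ _ e0)/nbhs_ballP[d /= d0 h] := @continuous_cos R 0.
apply/nbhs_ballP; exists d => //= t; rewrite /ball/= sub0r normrN => td.
have [c ct ->] := sinc_mean_value t.
by rewrite -(@cos0 R); apply: h; rewrite /ball/= sub0r normrN (le_lt_trans ct).
Qed.

(** Viete's product, from sinc(t) = sinc(t / 2^K) prod_(k < K) cos(t / 2^(k+1)). *)
Lemma viete t : (\prod_(k < K) cos (t / 2 ^+ k.+1)) @[K --> \oo] --> sinc t.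
Proof.
have e K : sinc t = sinc (t / 2 ^+ K) * \prod_(k < K) cos (t / 2 ^+ k.+1).
  elim: K => [|K IH]; first by rewrite big_ord0 mulr1 expr0 divr1.
  rewrite big_ord_recr/= {1}IH mulrA mulrAC; congr (_ * _).
  have [->|t0] := eqVneq t 0; first by rewrite !mul0r cos0 mulr1.
  set s := t / 2 ^+ K.+1.
  have -> : t / 2 ^+ K = 2 * s.
    by rewrite /s exprS; field; rewrite expf_eq0 pnatr_eq0 andbF.
  have s0 : s != 0 by rewrite mulf_neq0// invr_eq0 expf_eq0 pnatr_eq0 andbF.
  rewrite /sinc mulf_eq0 pnatr_eq0/= (negbTE s0) mulr_natl.
  have -> : s *+ 2 = s + s by [].
  rewrite sinD; field; rewrite s0/= .
  by rewrite -mulr2n mulrn_eq0.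
have c0 : sinc (t / 2 ^+ K) @[K --> \oo] --> (1 : R).
  have c1 : t * 2^-1 ^+ K @[K --> \oo] --> t * 0.
    apply: cvgM; first exact: cvg_cst.
    have := @cvg_geometric R 1 2^-1.
    rewrite ger0_norm// invf_lt1// ltr1n => /(_ isT).
    by apply: cvg_trans; apply: near_eq_cvg; apply: nearW => k /=; rewrite mul1r.
  apply: (@cvg_comp _ _ _ (fun K => t / 2 ^+ K) sinc _ (nbhs (0 : R))); last exact: sinc_near0.
  by rewrite mulr0 in c1; under eq_fun do rewrite -exprVn.
(* The identity e is divided by sinc (t / 2^K), which tends to 1. *)
have [K0 _ h] : \forall K \near \oo, sinc (t / 2 ^+ K) != 0.
  by apply: cvgr_neq0; [exact: c0|exact: oner_neq0].
have : sinc t / sinc (t / 2 ^+ K) @[K --> \oo] --> sinc t / 1.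
  by apply: cvgM; [exact: cvg_cst|apply: cvgV => //; exact: oner_neq0].
rewrite divr1; apply: cvg_trans; apply: near_eq_cvg; exists K0 => //= K K0K.
by rewrite (e K) mulrAC divff ?mul1r//; exact: h.
Qed.

End sinc.

Section injectivity.
Context {R : realType} {n : nat}.
Local Notation E := 'rV[R]_n.
Local Notation mu := (lebesgue_rV R n).

Section annihilated.
Variable D : E -> R.
Hypothesis kD : kdom D.
Hypothesis D0 : forall xi th, (\int[mu]_x (D x * cos (dotp x xi + th)))%R = 0.

(** The multipliers F for which F D, like D, is orthogonal to all plane waves.
    They are closed under products with plane waves, by the addition formulas, and
    under bounded pointwise limits. So they contain functions of x that are
    concentrated near a given point. *)
Definition annihilated (F : E -> R) : Prop :=
  [/\ measurable_fun setT F, forall x, `|F x| <= 1 &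
   forall xi th, (\int[mu]_x (D x * (F x * cos (dotp x xi + th))))%R = 0].

Lemma kdom_annihilated (F : E -> R) (xi : E) th : measurable_fun setT F ->
  (forall x, `|F x| <= 1) -> kdom (fun x => D x * (F x * cos (dotp x xi + th))).
Proof.
move=> mF F1; apply: (@kdom_bounded_mul _ _ _ _ 1) => //.
  by apply: measurable_funM => //; exact: measurable_wave.
by move=> x; rewrite normrM mulr_ile1// norm_cos_le1.
Qed.

Lemma annihilated1 : annihilated (cst 1).
Proof.
split=> //; first by move=> x; rewrite normr1.
by move=> xi th; under eq_Rintegral do rewrite mul1r; exact: D0.
Qed.

Lemma annihilated_wave (F : E -> R) (eta : E) om : annihilated F ->
  annihilated (fun x => F x * cos (dotp x eta + om)).
Proof.
move=> [mF F1 F0]; split.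
- by apply: measurable_funM => //; exact: measurable_wave.
- by move=> x; rewrite normrM mulr_ile1// norm_cos_le1.
move=> xi th.
have e x : D x * (F x * cos (dotp x eta + om) * cos (dotp x xi + th)) =
   2^-1 * (D x * (F x * cos (dotp x (eta + xi) + (om + th))) +
           D x * (F x * cos (dotp x (eta - xi) + (om - th)))).
  rewrite !dotpDr dotpNr.
  have -> : dotp x eta + dotp x xi + (om + th) = (dotp x eta + om) + (dotp x xi + th) by ring.
  have -> : dotp x eta - dotp x xi + (om - th) = (dotp x eta + om) - (dotp x xi + th) by ring.
  move: (dotp x eta + om) (dotp x xi + th) => A B.
  by rewrite cosD cosB; field.
under eq_Rintegral do rewrite e.
have k1 := kdom_annihilated (eta + xi) (om + th) mF F1.
have k2 := kdom_annihilated (eta - xi) (om - th) mF F1.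
rewrite RintegralZl//; last exact/integrable_kdom/kdomD.
rewrite RintegralD//; [|exact: integrable_kdom..].
by rewrite !F0 addr0 mulr0.
Qed.

Lemma annihilated_cvg (F_ : nat -> E -> R) (F : E -> R) : (forall k, annihilated (F_ k)) ->
  (forall x, F_ ^~ x @ \oo --> F x) -> annihilated F.
Proof.
move=> aF FF.
have mF : measurable_fun setT F.
  apply: (@measurable_fun_cvg _ _ _ setT F_) => [k|x _]; last exact: FF.
  by have [] := aF k.
have F1 x : `|F x| <= 1.
  apply: (cvgr_to_le (cvg_norm (FF x))).
  by apply: nearW => k; have [_ + _] := aF k; apply.
split=> // xi th.
have [_ [C DC]] := kD.
have [|||_] := @Rintegral_dominated_cvg R n
  (fun k x => D x * (F_ k x * cos (dotp x xi + th)))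
  (fun x => D x * (F x * cos (dotp x xi + th))) C.
- by move=> k; have [m1 m2 _] := aF k; have [] := kdom_annihilated xi th m1 m2.
- move=> k x; rewrite normrM (le_trans _ (DC x))// ler_piMr// normrM.
  by rewrite mulr_ile1// ?norm_cos_le1//; have [_ + _] := aF k; apply.
- move=> x; apply: cvgM; first exact: cvg_cst.
  by apply: cvgM; [exact: FF|exact: cvg_cst].
move=> h; rewrite -(cvg_lim (@Rhausdorff R) h).
rewrite (_ : (fun _ => _) = cst 0); first by rewrite lim_cst.
by apply/funext => k; have [_ _ ->] := aF k.
Qed.

(** By [viete], since each cosine factor is a plane wave in the i-th coordinate. *)
Lemma annihilated_sinc (F : E -> R) (a : R) (y : E) i : annihilated F ->
  annihilated (fun x => F x * sinc (a * (x ord0 i - y ord0 i))).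
Proof.
move=> aF.
apply: (@annihilated_cvg
  (fun K x => F x * \prod_(k < K) cos (a * (x ord0 i - y ord0 i) / 2 ^+ k.+1))).
  elim=> [|K IH].
    rewrite (_ : (fun _ => _) = F)//; apply/funext => x.
    by rewrite big_ord0 mulr1.
  have := @annihilated_wave _ ((a / 2 ^+ K.+1) *: delta_mx ord0 i)
     (- (a * y ord0 i / 2 ^+ K.+1)) IH.
  rewrite (_ : (fun _ => _) = (fun x => F x * \prod_(k < K.+1) cos (a * (x ord0 i - y ord0 i) / 2 ^+ k.+1)))//.
  apply/funext => x; rewrite big_ord_recr/= mulrA; congr (_ * cos _).
  by rewrite dotp_delta; ring.
by move=> x; apply: cvgM; [exact: cvg_cst|exact: viete].
Qed.

(** The square makes the factors nonnegative; a sets the width 1/a. *)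
Definition peak (a : R) (y x : E) : R :=
  \prod_i sinc (a * (x ord0 i - y ord0 i)) ^+ 2.

Lemma annihilated_peak (a : R) (y : E) m : annihilated (fun x => peak a y x ^+ m).
Proof.
elim: m => [|m IH].
  rewrite (_ : (fun _ => _) = cst 1); first exact: annihilated1.
  by apply/funext => x; rewrite expr0.
have h (s : seq 'I_n) : annihilated (fun x => peak a y x ^+ m *
    \prod_(i <- s) sinc (a * (x ord0 i - y ord0 i)) ^+ 2).
  elim: s => [|i s IHs].
    rewrite (_ : (fun _ => _) = (fun x => peak a y x ^+ m))//.
    by apply/funext => x; rewrite big_nil mulr1.
  have := annihilated_sinc a y i (annihilated_sinc a y i IHs).
  rewrite (_ : (fun _ => _) = (fun x => peak a y x ^+ m *
    \prod_(i <- i :: s) sinc (a * (x ord0 i - y ord0 i)) ^+ 2))//.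
  by apply/funext => x; rewrite big_cons; ring.
have := h (index_enum 'I_n).
rewrite (_ : (fun _ => _) = (fun x => peak a y x ^+ m.+1))//.
by apply/funext => x; rewrite exprSr.
Qed.

End annihilated.

Lemma peak_ge0 (a : R) (y x : E) : 0 <= peak a y x.
Proof. by apply: prodr_ge0 => i _; exact: sqr_ge0. Qed.

Lemma peak_far (a : R) (y x : E) i : 0 < a -> 2 / a <= `|x ord0 i - y ord0 i| ->
  peak a y x <= 1 / 4.
Proof.
move=> a0 h; rewrite /peak (bigD1 i)//=.
rewrite -[leRHS]mulr1; apply: ler_pM.
- exact: sqr_ge0.
- by apply: prodr_ge0 => j _; exact: sqr_ge0.
- set t := a * _.
  have t2 : 2 <= `|t| by rewrite /t normrM gtr0_norm// mulrC -ler_pdivrMr.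
  have s2 : `|sinc t| <= 1 / 2.
    rewrite /sinc ifF; last first.
      by apply/negbTE; rewrite -normr_gt0 (lt_le_trans _ t2).
    rewrite normf_div; apply: ler_pM => //; first exact: norm_sin_le1.
    by rewrite lef_pV2 ?posrE// (lt_le_trans _ t2).
  rewrite -real_normK ?num_real// (_ : 1 / 4 = (1 / 2) ^+ 2 :> R); last by field.
  by rewrite lerXn2r// nnegrE.
- apply: prodr_ile1 => j _; rewrite sqr_ge0/=.
  by rewrite -real_normK ?num_real// expr_le1// sinc_le1.
Qed.

Lemma peak_near (a : R) (y : E) : exists2 r : R, 0 < r &
  forall x : E, (forall i, `|x ord0 i - y ord0 i| <= r) -> 1 / 2 <= peak a y x.
Proof.
pose e : R := 1 / (4 * n.+1%:R).
have e0 : 0 < e by rewrite divr_gt0// mulr_gt0.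
have h : sinc (a * t) @[t --> (0 : R)] --> (1 : R).
  have c1 : a * t @[t --> (0 : R)] --> a * 0.
    by apply: cvgM; [exact: cvg_cst|exact: cvg_id].
  rewrite mulr0 in c1.
  apply: (@cvg_comp _ _ _ (fun t => a * t) sinc _ (nbhs (0 : R))); last exact: sinc_near0.
  exact: c1.
move/cvgrPdist_le : h => /(_ _ e0)/nbhs_ballP[d /= d0 h].
exists (d / 2); first by rewrite divr_gt0.
move=> x xy; rewrite /peak.
have e1 : e <= 1 / 4.
  by rewrite /e ler_pM2l// lef_pV2 ?posrE ?mulr_gt0// ler_peMr// ler1n.
apply: (@le_trans _ _ (\prod_(i < n) (1 - 2 * e))); last first.
  apply: ler_prod => i _; apply/andP; split; first lra.
  set t := x ord0 i - y ord0 i.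
  have ht : `|1 - sinc (a * t)| <= e.
    apply: h; rewrite /ball/= sub0r normrN (le_lt_trans (xy i))//.
    by rewrite ltr_pdivrMr// ltr_pMr// ltr1n.
  move: ht; set s := sinc _; rewrite ler_norml => /andP[h1 h2].
  by nra.
rewrite prodr_const card_ord.
have bern k : 1 - k%:R * (2 * e) <= (1 - 2 * e) ^+ k.
  elim: k => [|k IH]; first by rewrite mul0r subr0 expr0.
  rewrite exprS -natr1.
  have k0 : 0 <= k%:R :> R by [].
  by nra.
apply: (le_trans _ (bern n)).
have -> : n%:R * (2 * e) = 1 / 2 * (n%:R / n.+1%:R).
  have N0 : n.+1%:R != 0 :> R by rewrite pnatr_eq0.
  by rewrite /e; move: (n.+1%:R) N0 => N N0; field.
have : n%:R / n.+1%:R <= 1 :> R by rewrite ler_pdivrMr// mul1r ler_nat.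
by move: (n%:R / n.+1%:R) => z z1; lra.
Qed.

(** Suppose D y > 0. The powers of a peak at y annihilate D. Near y, where D is
    positive, the integral of D peak^m is at least a constant times 2^-m (on a small
    dyadic cube Q where the peak is at least 1/2), and away from y it is at most
    4^-m times the L^1 norm of D. This is absurd for large m. *)
Lemma fourier_injective (D : E -> R) (y : E) : kdom D ->
  (forall xi th, (\int[mu]_x (D x * cos (dotp x xi + th)))%R = 0) ->
  {for y, continuous D} -> D y = 0.
Proof.
move=> kD D0 cD; apply/eqP; apply: contraT => Dy; exfalso; move: kD D0.
wlog Dy0 : D cD Dy / 0 < D y.
  move=> H kD D0; have [Dy0|Dy0] := ltP 0 (D y); first exact: (H D).
  apply: (H (fun x => - D x)).
  - exact: continuousN.
  - by rewrite oppr_eq0.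
  - by rewrite oppr_gt0 lt_neqAle Dy.
  - have := kdomZ (-1) kD.
    by rewrite (_ : (fun _ => _) = (fun x => - D x))//; apply/funext => x; rewrite mulN1r.
  move=> xi th; under eq_Rintegral do rewrite mulNr -mulN1r.
  rewrite RintegralZl//; first by rewrite D0 mulr0.
  apply: integrable_kdom; apply: (@kdom_bounded_mul _ _ _ _ 1) => //.
    exact: measurable_wave.
  by move=> x; exact: norm_cos_le1.
move=> kD D0.
pose c := D y / 2.
have c0 : 0 < c by rewrite divr_gt0.
have : \forall x \near y, c <= D x.
  move/cvgrPdist_le : cD => /(_ _ c0); apply: filterS => x.
  by rewrite ler_norml /c => /andP[]; lra.
move=> /nbhs_ballP[d /= d0 Dc].
(* With this width the peak is at most 1/4 outside the cube of half-side d / 2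
   around y, while D >= D y / 2 holds up to the distance d. *)
pose a := 4 / d.
have a0 : 0 < a by rewrite divr_gt0.
have a2 : 2 / a = d / 2 by rewrite /a; field; rewrite gt_eqF.
have [r r0 hr] := peak_near a y.
pose r' := Num.min r (d / 4).
have r'0 : 0 < r' by rewrite lt_min r0 divr_gt0.
have [v vr] : exists v : nat, (2^-1 : R) ^+ v <= r'.
  have := @cvg_geometric R 1 2^-1.
  rewrite ger0_norm// invf_lt1// ltr1n => /(_ isT)/cvgrPdist_le/(_ _ r'0).
  move=> [v _ hv]; exists v; have := hv v (leqnn v).
  by rewrite /= sub0r normrN mul1r ger0_norm// exprn_ge0.
pose Q : set E := dyadic_cube v (dyadic_index v y).
have mQ : measurable Q := measurable_dyadic_cube _ _.
have Qr x : Q x -> forall i, `|x ord0 i - y ord0 i| <= r'.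
  by move=> Qx i; rewrite distrC; exact: le_trans (dyadic_cube_dist Qx i) vr.
pose M := (\int[mu]_x `|D x|)%R.
pose q : R := (2 ^ v)^-1 ^+ n.
have q0 : 0 < q by rewrite exprn_gt0// invr_gt0 exprn_gt0.
have muQ : mu Q = q%:E := lebesgue_dyadic_cube _ _.
have iQ : mu.-integrable setT (EFin \o (\1_Q : E -> R)).
  apply/integrableP; split; first exact/measurable_EFinP/measurable_indic.
  under eq_integral do rewrite /= ger0_norm//.
  by rewrite integral_indic// setIT [X in (X < _)%E]muQ ltry.
have kabs : kdom (fun x => `|D x|).
  have [mD [C DC]] := kD; split; first exact: measurableT_comp.
  by exists C => x; rewrite normr_id.
have key m : c * q * (1 / 2) ^+ m <= (1 / 4) ^+ m * M.
  have [mP P1 /(_ 0 0)] := annihilated_peak kD D0 a y m.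
  have e0 x : dotp x 0 = 0 :> R by rewrite /dotp big1// => i _; rewrite mxE mulr0.
  under eq_Rintegral do rewrite e0 addr0 cos0 mulr1.
  move=> I0.
  have kP : kdom (fun x => D x * peak a y x ^+ m).
    exact: (@kdom_bounded_mul _ _ _ _ 1).
  have iqe : (\int[mu]_x \1_Q x)%R = q.
    by rewrite /Rintegral integral_indic// setIT [X in fine X]muQ.
  have : (\int[mu]_x (c * (1 / 2) ^+ m * \1_Q x) <=
          \int[mu]_x (D x * peak a y x ^+ m + (1 / 4) ^+ m * `|D x|))%R.
    apply: le_Rintegral => //.
    - have := integrableZl measurableT (c * (1 / 2) ^+ m) iQ.
      by apply: eq_integrable => // x _ /=; rewrite EFinM.
    - by apply: integrable_kdom; apply: kdomD => //; exact: kdomZ.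
    move=> x _.
    have [near|far] := pselect (forall i, `|x ord0 i - y ord0 i| < 2 / a).
      have Dx : c <= D x.
        apply: Dc; rewrite -ball_normE/= (@le_lt_trans _ _ (d / 2))//.
          apply: rV_norm_le; first by rewrite divr_ge0// ltW.
          by move=> i; rewrite !mxE distrC ltW// -a2.
        by rewrite ltr_pdivrMr// ltr_pMr// ltr1n.
      apply: ler_wpDr; first by rewrite mulr_ge0// exprn_ge0.
      have [Qx|Qx] := pselect (Q x).
        rewrite indicE mem_set// mulr1; apply: ler_pM => //; first exact: ltW.
        rewrite lerXn2r ?nnegrE ?peak_ge0//; apply: hr => i.
        by rewrite (le_trans (Qr x Qx i))// ge_min lexx.
      rewrite indicE memNset// mulr0 mulr_ge0 ?exprn_ge0 ?peak_ge0//.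
      exact: le_trans (ltW c0) Dx.
    have [i xi] : exists i, 2 / a <= `|x ord0 i - y ord0 i|.
      move/existsNP : far => [i hi]; exists i; rewrite leNgt; exact/negP.
    have -> : \1_Q x = 0 :> R.
      rewrite indicE memNset// => /Qr/(_ i) xr; move: xi; apply/negP.
      rewrite -ltNge (le_lt_trans xr)// a2 (@le_lt_trans _ _ (d / 4))//.
        by rewrite ge_min lexx orbT.
      by lra.
    rewrite mulr0 -lerBlDr sub0r.
    have : `|D x * peak a y x ^+ m| <= (1 / 4) ^+ m * `|D x|.
      rewrite normrM mulrC ler_wpM2r// normrX ger0_norm ?peak_ge0//.
      by rewrite lerXn2r ?nnegrE ?peak_ge0// (peak_far a0 xi).
    by rewrite ler_norml => /andP[].
  rewrite RintegralZl// iqe RintegralD//; last 2 first.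
  - exact: integrable_kdom.
  - exact/integrable_kdom/kdomZ.
  rewrite [X in _ <= X + _]I0 add0r RintegralZl//; last exact: integrable_kdom.
  by rewrite mulrAC.
have cq0 : 0 < c * q by rewrite mulr_gt0.
(* Multiplied by 4^m, the comparison contradicts the divergence of 2^m. *)
have key2 m : c * q * 2 ^+ m <= M.
  have p4 : 0 < (4 : R) ^+ m by rewrite exprn_gt0.
  have := key m; rewrite !div1r !exprVn => h.
  have e4 : (4 : R) ^+ m = 2 ^+ m * 2 ^+ m by rewrite -exprMn; congr (_ ^+ _); ring.
  have p2 : (2 : R) ^+ m != 0 by rewrite expf_eq0 pnatr_eq0 andbF.
  move: h; rewrite -(ler_pM2l p4) mulrA (_ : 4 ^+ m * (_ * _) / _ = c * q * 2 ^+ m); last first.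
    by rewrite e4; field.
  by rewrite mulrA divff ?mul1r// gt_eqF.
have := key2 (Num.trunc (M / (c * q))).+1.
set m := (Num.trunc _).+1.
have Mm : M / (c * q) < m%:R.
  have M0 : 0 <= M by apply: Rintegral_ge0.
  by have /andP[] := truncn_itv (divr_ge0 M0 (ltW cq0)).
rewrite leNgt => /negP; apply.
rewrite ltr_pdivrMr// in Mm; apply: (lt_le_trans Mm).
rewrite mulrC ler_pM2l//.
have : (m < 2 ^ m)%N by exact: ltn_expl.
by move=> /ltnW; rewrite -(ler_nat R) natrX.
Qed.

End injectivity.

(** * Real-valued Schwartz functions *)

Section l1norm.
Context {R : realType} {n : nat}.
Local Notation E := 'rV[R]_n.
Implicit Types (x y : E) (i j : 'I_n).

Definition l1norm (x : E) : R := \sum_i `|x ord0 i|.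

(** The l^1 norm makes the weight submultiplicative and exact on coordinate
    shifts. *)
Definition wt (x : E) : R := 1 + l1norm x.

Lemma l1norm_ge0 x : 0 <= l1norm x.
Proof. exact: sumr_ge0. Qed.

Lemma l1norm_coord x i : `|x ord0 i| <= l1norm x.
Proof. by rewrite /l1norm (bigD1 i)//= ler_wpDr// sumr_ge0. Qed.

Lemma l1normD x y : l1norm (x + y) <= l1norm x + l1norm y.
Proof.
by rewrite /l1norm -big_split; apply: ler_sum => i _; rewrite mxE ler_normD.
Qed.

Lemma l1normN x : l1norm (- x) = l1norm x.
Proof. by apply: eq_bigr => i _; rewrite mxE normrN. Qed.

Lemma l1normZ a x : l1norm (a *: x) = `|a| * l1norm x.
Proof. by rewrite /l1norm mulr_sumr; apply: eq_bigr => i _; rewrite mxE normrM. Qed.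

Lemma l1norm_delta i : l1norm (delta_mx ord0 i) = 1.
Proof.
rewrite /l1norm (bigD1 i)//= big1 ?addr0 ?mxE ?eqxx ?normr1// => j ji.
by rewrite mxE (negbTE ji) andbF normr0.
Qed.

Lemma wt_ge1 x : 1 <= wt x.
Proof. by rewrite lerDl l1norm_ge0. Qed.

Lemma wt_gt0 x : 0 < wt x.
Proof. exact: lt_le_trans (wt_ge1 x). Qed.

Lemma wt_ge0 x : 0 <= wt x.
Proof. exact: ltW (wt_gt0 x). Qed.

Lemma wtN x : wt (- x) = wt x.
Proof. by rewrite /wt l1normN. Qed.

Lemma wtD x y : wt (x + y) <= wt x * wt y.
Proof.
rewrite /wt; have := l1normD x y; have := l1norm_ge0 x; have := l1norm_ge0 y.
by nra.
Qed.

Lemma wtX_gt0 x N : 0 < wt x ^+ N.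
Proof. by rewrite exprn_gt0// wt_gt0. Qed.

Lemma wt_shift x j t : wt x <= wt (x + t *: delta_mx ord0 j) * (1 + `|t|).
Proof.
have := wtD (x + t *: delta_mx ord0 j) (- (t *: delta_mx ord0 j)).
by rewrite addrK wtN [X in _ <= _ * X]/wt l1normZ l1norm_delta mulr1.
Qed.

Lemma kappa_wt x : (wt x ^+ (2 * n))^-1 <= kappa x.
Proof.
rewrite /kappa exprM -[n in _ ^+ n]card_ord -prodr_const -prodfV.
apply: ler_prod => i _; rewrite invr_ge0 sqr_ge0/=.
rewrite lef_pV2 ?posrE ?wtX_gt0//; last by rewrite ltr_pwDl// sqr_ge0.
have := l1norm_coord x i; rewrite -[x ord0 i ^+ 2]real_normK ?num_real// /wt.
by have := normr_ge0 (x ord0 i); nra.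
Qed.

Lemma enorm_coord (x : E) i : `|x ord0 i| <= enorm x.
Proof.
rewrite /enorm -sqrtr_sqr ler_wsqrtr// (bigD1 i)//= lerDl.
by apply: sumr_ge0 => j _; exact: sqr_ge0.
Qed.

Lemma enorm_ge0 (x : E) : 0 <= enorm x.
Proof. exact: sqrtr_ge0. Qed.

Lemma enorm_le_l1norm (x : E) : enorm x <= l1norm x.
Proof.
rewrite /enorm -(ger0_norm (l1norm_ge0 x)) -sqrtr_sqr ler_wsqrtr//.
rewrite expr2 {1}/l1norm mulr_suml; apply: ler_sum => i _.
by rewrite -real_normK ?num_real// expr2 ler_wpM2l// l1norm_coord.
Qed.

Lemma l1norm_le_enorm (x : E) : l1norm x <= n%:R * enorm x.
Proof.
rewrite -[n%:R]/(n%:R) -[n in n%:R]card_ord -sumr_const mulr_suml.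
by apply: ler_sum => i _; rewrite mul1r enorm_coord.
Qed.

End l1norm.

Section quadratic_tails.
Context {R : realType}.

Lemma sum_inv_sqr (K d : nat) :
  \sum_(k < d) (((K + k).+1%:R : R) ^+ 2)^-1 <= 2 / K.+1%:R.
Proof.
suff : \sum_(k < d) (((K + k).+1%:R : R) ^+ 2)^-1 <=
    2 / K.+1%:R - 2 / (K + d).+1%:R.
  by move=> h; apply: (le_trans h); rewrite gerBl.
elim: d => [|d IH]; first by rewrite big_ord0 addn0 subrr.
rewrite big_ord_recr/= addnS; move: IH; set S := \sum_(k < d) _.
set x : R := (K + d).+1%:R => IH.
have x1 : 1 <= x by rewrite /x ler1n.
have -> : (K + d).+2%:R = x + 1 :> R by rewrite /x -natr1.
apply: (le_trans (lerD IH (lexx _))); rewrite -addrA lerD2l.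
rewrite -subr_ge0 (_ : _ - _ = (x - 1) / (x ^+ 2 * (x + 1))); last first.
  by field; apply/andP; split; rewrite gt_eqF//; lra.
by rewrite divr_ge0// ?subr_ge0// mulr_ge0 ?sqr_ge0//; lra.
Qed.

Lemma cauchy_inv_cvg (s : nat -> R) B :
  (forall K d, `|s (K + d)%N - s K| <= B / K.+1%:R) ->
  exists2 l, s @ \oo --> l & forall K, `|l - s K| <= B / K.+1%:R.
Proof.
move=> sB.
have B0 : 0 <= B by have := sB 0%N 0%N; rewrite divr1; apply: le_trans.
have cs : cvgn s.
  apply/cauchy_cvgP/cauchy_exP => e e0.
  pose N := (Num.trunc (B / e)).+1.
  have BN : B / N.+1%:R < e.
    have /andP[_] := truncn_itv (divr_ge0 B0 (ltW e0)).
    rewrite -/N ltr_pdivrMr// => h.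
    by rewrite ltr_pdivrMr// -natr1; lra.
  exists (s N); exists N => //= k Nk.
  rewrite /ball/= distrC (le_lt_trans _ BN)//.
  by have := sB N (k - N)%N; rewrite subnKC.
exists (limn s) => // K.
have h : `|s k - s K| @[k --> \oo] --> `|limn s - s K|.
  by apply: cvg_norm; apply: cvgB; [exact: cs|exact: cvg_cst].
apply: (cvgr_to_le h); exists K => //= k Kk.
by have := sB K (k - K)%N; rewrite subnKC.
Qed.

End quadratic_tails.

Section rschwartz.
Context {R : realType} {n : nat}.
Local Notation E := 'rV[R]_n.
Local Notation mu := (lebesgue_rV R n).
Local Notation e_ j := (delta_mx ord0 j : E).
Implicit Types (u : E -> R) (x : E) (j : 'I_n).

(** Decay is measured with [wt], which suits shifts along the coordinate axes
    better than the Euclidean norm; real values allow the mean value theorem. *)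
Definition rschwartz (u : E -> R) : Prop :=
  (forall s x, differentiable (pderivs s u) x) /\
  (forall s N, exists C, forall x, `|pderivs s u x| <= C / wt x ^+ N).

Definition pderiv (j : 'I_n) (u : E -> R) : E -> R := fun x => 'D_(e_ j) u x.

Lemma pderivs_cat s t (u : E -> R) : pderivs (s ++ t) u = pderivs s (pderivs t u).
Proof. by rewrite /pderivs foldr_cat. Qed.

Lemma rschwartz_pderivs s u : rschwartz u -> rschwartz (pderivs s u).
Proof.
move=> [du bu]; split=> [t x|t N].
  by rewrite -pderivs_cat.
by have [C h] := bu (t ++ s) N; exists C => x; rewrite -pderivs_cat.
Qed.

Lemma rschwartz_pderiv j u : rschwartz u -> rschwartz (pderiv j u).
Proof. exact: (@rschwartz_pderivs [:: j]). Qed.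

Lemma rschwartz_decay u N : rschwartz u ->
  exists2 C, 0 < C & forall x, `|u x| <= C / wt x ^+ N.
Proof.
move=> [_ /(_ [::] N)[C h]]; exists (Num.max C 1); first by rewrite lt_max ltr01 orbT.
move=> x; apply: (le_trans (h x)); rewrite ler_wpM2r ?le_max ?lexx//.
by rewrite invr_ge0 ltW// wtX_gt0.
Qed.

Lemma rschwartz_continuous u : rschwartz u -> continuous u.
Proof. by move=> [/(_ [::]) du _] x; exact: differentiable_continuous. Qed.

Lemma kdom_continuous (u : E -> R) C N : (2 * n <= N)%N -> continuous u ->
  (forall x, `|u x| <= C / wt x ^+ N) -> kdom u.
Proof.
move=> nN cu uC; split; first exact: measurable_continuous_rV.
have C0 : 0 <= C.
  have := le_trans (normr_ge0 _) (uC 0).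
  by rewrite pmulr_lge0// invr_gt0 wtX_gt0.
exists C => x; apply: (le_trans (uC x)); rewrite ler_wpM2l//.
apply: le_trans (kappa_wt x); rewrite lef_pV2 ?posrE ?wtX_gt0//.
by rewrite ler_weXn2l// wt_ge1.
Qed.

Lemma rschwartz_kdom u : rschwartz u -> kdom u.
Proof.
move=> su; have [C _ h] := rschwartz_decay (2 * n) su.
exact: kdom_continuous (leqnn _) (rschwartz_continuous su) h.
Qed.

(** Shifting by t costs only the factor (1 + |t|)^N, which a fast enough decay of
    the coefficients in the shift series absorbs. *)
Lemma decay_shift u C N : (forall x, `|u x| <= C / wt x ^+ N) -> 0 < C ->
  forall x j t, `|u (x + t *: e_ j)| <= C * (1 + `|t|) ^+ N / wt x ^+ N.
Proof.
move=> h C0 x j t; apply: (le_trans (h _)); rewrite -mulrA (ler_wpM2l (ltW C0))//.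
have h1 : 0 <= wt x by rewrite ltW// wt_gt0.
have h2 : 0 <= wt (x + t *: e_ j) * (1 + `|t|).
  by rewrite mulr_ge0// ltW// wt_gt0.
have : wt x ^+ N <= (wt (x + t *: e_ j) * (1 + `|t|)) ^+ N.
  by rewrite lerXn2r ?nnegrE// wt_shift.
rewrite exprMn => h3.
by rewrite ler_pdivlMr ?wtX_gt0// mulrC ler_pdivrMr ?wtX_gt0// mulrC.
Qed.

Lemma is_derive_line u x j (t : R) : rschwartz u ->
  is_derive t 1 (fun t => u (x + t *: e_ j)) (pderiv j u (x + t *: e_ j)).
Proof.
move=> [/(_ [::] (x + t *: e_ j))/= du _].
have dv : derivable u (x + t *: e_ j) (e_ j) by exact: diff_derivable.
have e : (fun h => h^-1 *: (u (x + (h *: 1 + t) *: e_ j) - u (x + t *: e_ j))) =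
         (fun h => h^-1 *: (u (h *: e_ j + (x + t *: e_ j)) - u (x + t *: e_ j))).
  apply/funext => h; congr (_ *: (u _ - _)).
  have -> : h *: (1 : R) = h by exact: mulr1.
  by rewrite scalerDl addrCA.
split.
  by rewrite /derivable/= e.
by rewrite /derive/= e.
Qed.

Lemma norm_le_between (s t : R) : Num.min 0 t <= s <= Num.max 0 t -> `|s| <= `|t|.
Proof.
have [t0|t0] := leP 0 t; rewrite ler_norml => /andP[s1 s2].
  by rewrite ger0_norm// (le_trans _ s1)//= oppr_le0.
by rewrite ltr0_norm// opprK s1 (le_trans s2)// oppr_ge0 ltW.
Qed.

Lemma line_increment u x j (t M : R) : rschwartz u ->
  (forall s, `|s| <= `|t| -> `|pderiv j u (x + s *: e_ j)| <= M) ->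
  `|u (x + t *: e_ j) - u x| <= M * `|t|.
Proof.
move=> su h.
have := @MVT_abs R (fun t => u (x + t *: e_ j))
  (fun t => pderiv j u (x + t *: e_ j)) 0 t M.
rewrite scale0r addr0 subr0; apply => s st; split; first exact: is_derive_line.
by apply: h; exact: norm_le_between.
Qed.

(** The mean value theorem, applied twice. *)
Lemma line_increment2 u x j (t M : R) : rschwartz u ->
  (forall s, `|s| <= `|t| -> `|pderiv j (pderiv j u) (x + s *: e_ j)| <= M) ->
  `|u (x + t *: e_ j) - u x - t * pderiv j u x| <= M * `|t| ^+ 2.
Proof.
move=> su h.
have := @MVT_abs R (fun s => u (x + s *: e_ j) - s * pderiv j u x)
  (fun s => pderiv j u (x + s *: e_ j) - pderiv j u x) 0 t (M * `|t|).
rewrite scale0r addr0 mul0r !subr0 => H.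
have -> : u (x + t *: e_ j) - u x - t * pderiv j u x =
  u (x + t *: e_ j) - t * pderiv j u x - u x by ring.
rewrite expr2 mulrA; apply: H => s st; split.
  have := is_derive_line x j s su => d1.
  by apply: is_derive_eq; rewrite /GRing.scale/=; ring.
have sle : `|s| <= `|t| by exact: norm_le_between.
apply: (@le_trans _ _ (M * `|s|)).
  apply: line_increment => [|r rs]; first exact: rschwartz_pderiv.
  by apply: h; exact: le_trans sle.
rewrite ler_wpM2l//.
by apply: le_trans (normr_ge0 _) (h 0 _); rewrite normr0.
Qed.

Lemma Rintegral_translation (t : E) u : kdom u ->
  (\int[mu]_x u (x + t))%R = (\int[mu]_x u x)%R.
Proof.
move=> [mu_ _]; rewrite /Rintegral; congr fine.
rewrite integralE [RHS]integralE; congr (_ - _)%E.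
rewrite -(@integral_translation_rV R n t (EFin \o u)^\+%E)//.
  - by apply: eq_integral => x _; rewrite ?funeposE ?funenegE.
  - by apply: measurable_funepos; exact/measurable_EFinP.
rewrite -(@integral_translation_rV R n t (EFin \o u)^\-%E)//.
- by apply: eq_integral => x _; rewrite ?funeposE ?funenegE.
- by apply: measurable_funeneg; exact/measurable_EFinP.
Qed.

Lemma kdom_wave u (xi : E) th : kdom u -> kdom (fun x => u x * cos (dotp x xi + th)).
Proof.
move=> ku; apply: (kdom_bounded_mul ku (measurable_wave xi th)) => x.
exact: norm_cos_le1.
Qed.

Lemma measurable_wave_sin (xi : E) th :
  measurable_fun [set: E] (fun x => sin (dotp x xi + th)).
Proof.
apply: (@measurableT_comp _ _ _ _ _ _ (@sin R)).
  by apply: continuous_measurable_fun; exact: continuous_sin.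
by apply: measurable_funD => //; exact: measurable_dotp.
Qed.

Lemma kdom_wave_sin u (xi : E) th : kdom u -> kdom (fun x => u x * sin (dotp x xi + th)).
Proof.
move=> ku; apply: (kdom_bounded_mul ku (measurable_wave_sin xi th)) => x.
exact: norm_sin_le1.
Qed.

(** Translation invariance turns the shift of u into a change of phase of the
    wave. *)
Lemma shift_wave u j (t : R) (xi : E) th : kdom u ->
  (\int[mu]_x (u (x + t *: e_ j) * cos (dotp x xi + th)))%R =
  (\int[mu]_x (u x * cos (dotp x xi + (th - t * xi ord0 j))))%R.
Proof.
move=> ku; rewrite -[RHS](Rintegral_translation (t *: e_ j)); last exact: kdom_wave.
apply: eq_Rintegral => x _; congr (_ * cos _).
by rewrite dotpDl dotpZl dotp_deltal; ring.
Qed.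

Lemma kdom_shift u j (t : R) : kdom u -> kdom (fun x => u (x + t *: e_ j)).
Proof.
move=> [mu_ [C uC]]; split.
  by apply: (measurableT_comp mu_); exact: measurable_translation_rV.
have C0 : 0 <= C.
  by have := le_trans (normr_ge0 _) (uC 0); rewrite pmulr_lge0// kappa_gt0.
exists (C * (2 * (1 + t ^+ 2))) => x.
apply: (le_trans (uC _)); rewrite -mulrA ler_wpM2l//.
rewrite /kappa (bigD1 j)//= [in leRHS](bigD1 j)//= mulrA.
rewrite (eq_bigr (fun i => (1 + x ord0 i ^+ 2)^-1)); last first.
  by move=> i ij; rewrite !mxE eqxx (negbTE ij)/= mulr0 addr0.
rewrite ler_wpM2r//.
  by apply: prodr_ge0 => i _; rewrite invr_ge0 addr_ge0 ?sqr_ge0.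
rewrite !mxE !eqxx/= mulr1; set y := x ord0 j.
have p1 : 0 < 1 + (y + t) ^+ 2 by rewrite ltr_pwDl// sqr_ge0.
have p2 : 0 < 1 + y ^+ 2 by rewrite ltr_pwDl// sqr_ge0.
rewrite ler_pdivlMr// mulrC ler_pdivrMr//.
have := sqr_ge0 (y + 2 * t); have := sqr_ge0 (y * t + t ^+ 2); have := sqr_ge0 t; have := sqr_ge0 y; have := sqr_ge0 (y+t).
rewrite !expr2; by nra.
Qed.

End rschwartz.

(** * Derivatives of band-limited functions as series of shifts *)

Section lipschitz_trig.
Context {R : realType}.
Implicit Types (a b : R).

Lemma cvg_inv_bound (s : nat -> R) l B :
  (forall m, `|s m - l| <= B / m.+1%:R) -> s @ \oo --> l.
Proof.
move=> h; apply/cvgrPdist_le => e e0.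
have B0 : 0 <= B by have := h 0%N; rewrite divr1; apply: le_trans.
exists (Num.trunc (B / e)) => //= m Nm.
rewrite distrC (le_trans (h m))// ler_pdivrMr// mulrC -ler_pdivrMr//.
have /andP[_ /ltW] := truncn_itv (divr_ge0 B0 (ltW e0)).
by move=> h1; apply: (le_trans h1); rewrite ler_nat.
Qed.

Lemma sin_lipschitz a b : `|sin (a - b) - sin a| <= `|b|.
Proof.
have := @MVT_abs R (fun s => sin (a - s)) (fun s => - cos (a - s)) 0 b 1.
rewrite !subr0 mul1r; apply => s _; split.
  by apply: is_derive_eq; rewrite /GRing.scale/=; ring.
by rewrite normrN norm_cos_le1.
Qed.

Lemma cos_lipschitz a b : `|cos (a - b) - cos a| <= `|b|.
Proof.
have := @MVT_abs R (fun s => cos (a - s)) (fun s => sin (a - s)) 0 b 1.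
rewrite !subr0 mul1r; apply => s _; split.
  by apply: is_derive_eq; rewrite /GRing.scale/=; ring.
by rewrite norm_sin_le1.
Qed.

Lemma cos_taylor1 a b : `|cos (a - b) - cos a - b * sin a| <= `|b| ^+ 2.
Proof.
have := @MVT_abs R (fun s => cos (a - s) - s * sin a) (fun s => sin (a - s) - sin a) 0 b `|b|.
rewrite !subr0 mul0r subr0 => H.
rewrite addrAC expr2.
apply: H => s st; split.
  apply: is_derive_eq; rewrite /GRing.scale/=; ring.
by apply: (le_trans (sin_lipschitz _ _)); exact: norm_le_between.
Qed.

End lipschitz_trig.

Section reproducing.
Context {R : realType} {n : nat}.
Local Notation E := 'rV[R]_n.
Local Notation mu := (lebesgue_rV R n).
Local Notation e_ j := (delta_mx ord0 j : E).
Implicit Types (u : E -> R) (x : E) (j : 'I_n) (K L N : nat).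

Definition shift_term L j u x k : R := 2 * scoef L k *
  (u (x + (k.+1%:R / 2) *: e_ j) - u (x + (- (k.+1%:R / 2)) *: e_ j)).

(** The partial sums of the series for the j-th partial derivative. A shift by
    (k+1)/2 has the frequency response of sin((k+1) xi_j / 2), and |xi_j / 2| <= 1 on
    the ball of radius 2. *)
Definition shift_sum L K j u x : R := \sum_(k < K) shift_term L j u x k.

(** The Fourier transform of u vanishes outside the closed ball of radius 2, in
    terms of real integrals: the phase th accounts for its real and imaginary parts. *)
Definition bandlimited u : Prop := forall (xi : E) th, 2 < enorm xi ->
  (\int[mu]_x (u x * cos (dotp x xi + th)))%R = 0.

(** The factor (k+1)^N lost in the shift is compensated by the decay of the
    coefficients of order N + 2, which leaves a summable (k+1)^-2. *)
Lemma shift_term_decay u C N : (forall x, `|u x| <= C / wt x ^+ N) -> 0 < C ->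
  exists2 B, 0 < B & forall L j x k, (N.+2 <= L)%N ->
  `|shift_term L j u x k| <= B / wt x ^+ N * (k.+1%:R ^+ 2)^-1.
Proof.
move=> uC C0; have [A [A0 hA]] := @scoef_decay R N.+2.
exists (2 * A * (2 * (C * 2 ^+ N))).
  by rewrite !mulr_gt0// exprn_gt0.
move=> L j x k NL.
set a : R := k.+1%:R; have a1 : 1 <= a by rewrite /a ler1n.
have a0 : 0 < a by exact: lt_le_trans a1.
have wN := wtX_gt0 x N.
have sh s : `|s| = a / 2 -> `|u (x + s *: e_ j)| <= C * (2 * a) ^+ N / wt x ^+ N.
  move=> sa; apply: (le_trans (decay_shift uC C0 _ _ _)).
  rewrite ler_wpM2r ?invr_ge0 ?(ltW wN)// ler_wpM2l ?(ltW C0)//.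
  by rewrite lerXn2r ?nnegrE ?sa ?addr_ge0//; lra.
rewrite /shift_term normrM normrM (ger0_norm (_ : 0 <= 2))//.
apply: (@le_trans _ _ (2 * (A / a ^+ N.+2) * (2 * (C * (2 * a) ^+ N / wt x ^+ N)))).
  apply: ler_pM => //.
    by rewrite ler_wpM2l// hA.
  apply: (le_trans (ler_normB _ _)).
  set Y := C * _ / _; rewrite (_ : 2 * Y = Y + Y); last by ring.
  apply: lerD; apply: sh; rewrite ?normrN gtr0_norm// divr_gt0//.
rewrite exprMn le_eqVlt; apply/orP; left; apply/eqP.
rewrite !exprS; field; rewrite !gt_eqF// exprn_gt0//.
Qed.

Lemma shift_sum_tail u C N : (forall x, `|u x| <= C / wt x ^+ N) -> 0 < C ->
  exists2 B, 0 < B & forall L j x K d, (N.+2 <= L)%N ->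
  `|shift_sum L (K + d)%N j u x - shift_sum L K j u x| <= B / wt x ^+ N / K.+1%:R.
Proof.
move=> uC C0; have [B B0 h] := shift_term_decay uC C0.
exists (B * 2); first by rewrite mulr_gt0.
move=> L j x K d NL; rewrite /shift_sum big_split_ord/= addrAC subrr add0r.
apply: (le_trans (ler_norm_sum _ _ _)).
apply: (@le_trans _ _ (\sum_(k < d) B / wt x ^+ N * ((K + k).+1%:R ^+ 2)^-1)).
  by apply: ler_sum => k _; exact: h.
rewrite -mulr_sumr (_ : B * 2 / _ / _ = B / wt x ^+ N * (2 / K.+1%:R)); last by ring.
by rewrite ler_wpM2l ?sum_inv_sqr// divr_ge0 ?(ltW B0)// ltW// wtX_gt0.
Qed.

#[local] Instance nbhs_rV_filter (y : E) : Filter (nbhs y).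
Proof. exact: (@nbhs_filter (E : topologicalType) y). Qed.

Lemma cvg_translation (c y : E) : (fun x : E => x + c) @ y --> y + c.
Proof.
have h1 : (id : E -> E) @ y --> y.
  exact: cvg_id.
have h2 : (cst c : E -> E) @ y --> c by exact: cvg_cst.
exact: (cvgD h1 h2).
Qed.

Lemma continuous_translate u j (t : R) : continuous u ->
  continuous (fun x => u (x + t *: e_ j)).
Proof.
move=> cu x.
exact: (cvg_comp _ _ (@cvg_translation (t *: e_ j) x) (cu _)).
Qed.

Lemma continuous_shift_sum L K j u : continuous u -> continuous (shift_sum L K j u).
Proof.
move=> cu; elim: K => [|K IH].
  rewrite (_ : shift_sum _ _ _ _ = cst 0); first by move=> x; exact: cvg_cst.
  by apply/funext => x; rewrite /shift_sum big_ord0.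
rewrite (_ : shift_sum _ _ _ _ =
  (fun x => shift_sum L K j u x + shift_term L j u x K)); last first.
  by apply/funext => x; rewrite /shift_sum big_ord_recr.
move=> x; apply: cvgD; first exact: IH.
by apply: cvgM; [exact: cvg_cst|apply: cvgB; exact: continuous_translate].
Qed.

(** The Fourier transform of the partial sum is that of u, multiplied by a
    partial sum of the sine series at xi_j / 2. *)
Lemma shift_sum_wave L K j u (xi : E) th : kdom u ->
  kdom (shift_sum L K j u) /\
  (\int[mu]_x (shift_sum L K j u x * cos (dotp x xi + th)))%R =
  2 * sine_sum L K (xi ord0 j / 2) * (\int[mu]_x (u x * sin (dotp x xi + th)))%R.
Proof.
move=> ku; elim: K => [|K [kK IH]].
  have -> : shift_sum L 0 j u = (fun x => 0 * u x).
    by apply/funext => x; rewrite /shift_sum big_ord0 mul0r.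
  split; first exact: kdomZ.
  rewrite /sine_sum big_ord0 mulr0 mul0r.
  under eq_Rintegral do rewrite mul0r mul0r.
  by rewrite /Rintegral integral0.
set t : R := K.+1%:R / 2.
have kt s : kdom (fun x => u (x + s *: e_ j)) by exact: kdom_shift.
have e x : shift_sum L K.+1 j u x = shift_sum L K j u x +
   2 * scoef L K * (u (x + t *: e_ j) + -1 * u (x + (- t) *: e_ j)).
  by rewrite /shift_sum big_ord_recr/= /shift_term mulN1r.
have kd : kdom (fun x => 2 * scoef L K * (u (x + t *: e_ j) + -1 * u (x + (- t) *: e_ j))).
  by apply/kdomZ/kdomD => //; exact: kdomZ.
split.
  have [mS [C SC]] := kdomD kK kd; split; last by exists C => x; rewrite e.
  by apply: eq_measurable_fun mS => x _; rewrite e.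
have e2 x : shift_sum L K.+1 j u x * cos (dotp x xi + th) =
  shift_sum L K j u x * cos (dotp x xi + th) +
  2 * scoef L K * (u (x + t *: e_ j) * cos (dotp x xi + th) -
     u (x + (- t) *: e_ j) * cos (dotp x xi + th)).
  by rewrite e; ring.
under eq_Rintegral do rewrite e2.
have k1 := kdom_wave xi th (kt t).
have k2 := kdom_wave xi th (kt (- t)).
have kB : kdom (fun x => u (x + t *: e_ j) * cos (dotp x xi + th) -
     u (x + (- t) *: e_ j) * cos (dotp x xi + th)).
  rewrite (_ : (fun _ => _) = (fun x => u (x + t *: e_ j) * cos (dotp x xi + th) +
     -1 * (u (x + (- t) *: e_ j) * cos (dotp x xi + th)))).
    by apply: kdomD => //; exact: kdomZ.
  by apply/funext => x; rewrite mulN1r.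
rewrite RintegralD//; last 2 first.
- exact/integrable_kdom/kdom_wave.
- exact/integrable_kdom/kdomZ.
rewrite IH RintegralZl//; last exact: integrable_kdom.
rewrite RintegralB//; [|exact: integrable_kdom..].
rewrite !shift_wave// -RintegralB//; [|exact/integrable_kdom/kdom_wave..].
have e3 x : u x * cos (dotp x xi + (th - t * xi ord0 j)) -
    u x * cos (dotp x xi + (th - - t * xi ord0 j)) =
  2 * sin (t * xi ord0 j) * (u x * sin (dotp x xi + th)).
  rewrite !addrA mulNr opprK; move: (dotp x xi + th) (t * _) => a b.
  by rewrite cosB cosD; ring.
rewrite [X in _ + _ * X](_ : _ =
    (\int[mu]_x (2 * sin (t * xi ord0 j) * (u x * sin (dotp x xi + th))))%R); last first.
  by apply: eq_Rintegral => x _; exact: e3.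
rewrite RintegralZl//; last exact/integrable_kdom/kdom_wave_sin.
rewrite /sine_sum big_ord_recr/= -/(sine_sum L K (xi ord0 j / 2)).
have -> : K.+1%:R * (xi ord0 j / 2) = t * xi ord0 j by rewrite /t; ring.
ring.
Qed.

Lemma bandlimited_sin u (xi : E) th : bandlimited u -> 2 < enorm xi ->
  (\int[mu]_x (u x * sin (dotp x xi + th)))%R = 0.
Proof.
move=> bu xi2; rewrite -(bu xi (th - pi / 2) xi2); apply: eq_Rintegral => x _.
by rewrite addrA cosBpihalf.
Qed.

(** Integration by parts, obtained by passing to the limit in difference
    quotients: [shift_wave] moves them from u to the wave, and both sides converge
    dominatedly. *)
Lemma pderiv_wave u j (xi : E) th : rschwartz u ->
  (\int[mu]_x (pderiv j u x * cos (dotp x xi + th)))%R =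
  xi ord0 j * (\int[mu]_x (u x * sin (dotp x xi + th)))%R.
Proof.
move=> su; have ku := rschwartz_kdom su.
pose N := (2 * n)%N.
have [C1 C10 h1] := rschwartz_decay N (rschwartz_pderiv j su).
have [C2 C20 h2] := rschwartz_decay 0 (rschwartz_pderiv j (rschwartz_pderiv j su)).
(* d m is the difference quotient of u with step t m along e_j; w m is the
   difference quotient transferred to the wave. *)
pose t m : R := m.+1%:R^-1.
have t0 m : 0 < t m by rewrite invr_gt0.
have t1 m : t m <= 1 by rewrite invf_le1// ler1n.
pose d m x := (t m)^-1 * (u (x + t m *: e_ j) + -1 * u x).
have dC m x : `|d m x| <= C1 * 2 ^+ N / wt x ^+ N.
  rewrite /d normrM gtr0_norm ?invr_gt0// ler_pdivrMl// mulN1r mulrC -{2}(gtr0_norm (t0 m)).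
  apply: line_increment => // s sm.
  apply: (le_trans (decay_shift h1 C10 _ _ _)).
  rewrite ler_wpM2r ?invr_ge0 ?(ltW (wtX_gt0 _ _))// ler_wpM2l ?(ltW C10)//.
  rewrite lerXn2r ?nnegrE ?addr_ge0//.
  by move: sm; rewrite (gtr0_norm (t0 m)); have := t1 m; lra.
have kd m : kdom (d m).
  by apply/kdomZ/kdomD; [exact: kdom_shift|exact: kdomZ].
have dcvg x : d m x @[m --> \oo] --> pderiv j u x.
  apply: (@cvg_inv_bound _ _ _ C2) => m.
  have : `|u (x + t m *: e_ j) - u x - t m * pderiv j u x| <= C2 * `|t m| ^+ 2.
    apply: line_increment2 => // s _.
    by apply: (le_trans (h2 _)); rewrite expr0 divr1.
  have -> : d m x - pderiv j u x = (t m)^-1 * (u (x + t m *: e_ j) - u x - t m * pderiv j u x).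
    by rewrite /d; field; rewrite gt_eqF.
  rewrite normrM (gtr0_norm (t0 m)) (@gtr0_norm _ (t m)^-1) ?invr_gt0// => h.
  rewrite ler_pdivrMl//; apply: (le_trans h).
  by rewrite expr2 mulrCA.
have wC m x : `|d m x * cos (dotp x xi + th)| <= C1 * 2 ^+ N * kappa x.
  rewrite normrM (le_trans (ler_piMr _ _)) ?norm_cos_le1//.
  apply: (le_trans (dC m x)); by rewrite ler_wpM2l ?kappa_wt// mulr_ge0 ?(ltW C10)// exprn_ge0.
have [|_ lim1] := Rintegral_dominated_cvg
   (fun m => (kdom_wave xi th (kd m)).1) wC (u := fun x => pderiv j u x * cos (dotp x xi + th)).
  by move=> x; apply: cvgM; [exact: dcvg|exact: cvg_cst].
pose w m x := (t m)^-1 * (u x * cos (dotp x xi + (th - t m * xi ord0 j)) + -1 * (u x * cos (dotp x xi + th))).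
have kw m : kdom (w m).
  by apply/kdomZ/kdomD; [exact: kdom_wave|exact/kdomZ/kdom_wave].
have dw m : (\int[mu]_x (d m x * cos (dotp x xi + th)))%R = (\int[mu]_x w m x)%R.
  have e x : d m x * cos (dotp x xi + th) = (t m)^-1 *
     (u (x + t m *: e_ j) * cos (dotp x xi + th) + -1 * (u x * cos (dotp x xi + th))).
    by rewrite /d; ring.
  under eq_Rintegral do rewrite e.
  have k1 : kdom (fun x => -1 * (u x * cos (dotp x xi + th))) by exact/kdomZ/kdom_wave.
  have k2 : kdom (fun x => u (x + t m *: e_ j) * cos (dotp x xi + th)).
    exact/kdom_wave/kdom_shift.
  have k3 : kdom (fun x => u x * cos (dotp x xi + (th - t m * xi ord0 j))).
    exact/kdom_wave.
  rewrite RintegralZl//; last exact/integrable_kdom/kdomD.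
  rewrite RintegralD//; [|exact: integrable_kdom..].
  rewrite shift_wave//.
  rewrite [RHS]RintegralZl//; last exact/integrable_kdom/kdomD.
  by rewrite [in RHS]RintegralD//; exact: integrable_kdom.
have [_ [C uC]] := ku.
have wE m x : w m x = u x * ((t m)^-1 * (cos (dotp x xi + th - t m * xi ord0 j) - cos (dotp x xi + th))).
  by rewrite /w addrA; ring.
have wC' m x : `|w m x| <= C * `|xi ord0 j| * kappa x.
  rewrite wE normrM mulrAC; apply: ler_pM => //.
  rewrite normrM (@gtr0_norm _ (t m)^-1) ?invr_gt0// ler_pdivrMl//.
  by apply: (le_trans (cos_lipschitz _ _)); rewrite normrM (gtr0_norm (t0 m)).
have [|_ lim2] := Rintegral_dominated_cvg (fun m => (kw m).1) wC'
   (u := fun x => xi ord0 j * (u x * sin (dotp x xi + th))).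
  move=> x; apply: (@cvg_inv_bound _ _ _ (`|u x| * `|xi ord0 j| ^+ 2)) => m.
  rewrite wE; set a := dotp x xi + th; set b := t m * xi ord0 j.
  have -> : u x * ((t m)^-1 * (cos (a - b) - cos a)) - xi ord0 j * (u x * sin a) =
     u x * ((t m)^-1 * (cos (a - b) - cos a - b * sin a)).
    by rewrite /b; field; rewrite gt_eqF.
  rewrite -[leRHS]mulrA normrM; apply: ler_wpM2l => //; rewrite normrM (@gtr0_norm _ (t m)^-1) ?invr_gt0//.
  rewrite ler_pdivrMl//; apply: (le_trans (cos_taylor1 _ _)).
  rewrite /b normrM (gtr0_norm (t0 m)) /t; move: (_^-1) => r.
  by rewrite le_eqVlt; apply/orP; left; apply/eqP; ring.
rewrite -RintegralZl//; last exact/integrable_kdom/kdom_wave_sin.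
move: lim1; under eq_fun do rewrite dw.
by move=> lim1; apply: (@cvg_unique R^o _ _ _ _ _ lim1 lim2); exact: Rhausdorff.
Qed.

Lemma bandlimited_pderiv u j : rschwartz u -> bandlimited u -> bandlimited (pderiv j u).
Proof.
by move=> su bu xi th xi2; rewrite pderiv_wave// bandlimited_sin// mulr0.
Qed.

Lemma bandlimited_pderivs s u : rschwartz u -> bandlimited u -> bandlimited (pderivs s u).
Proof.
move=> su bu; elim: s => [//|j s IH].
exact: (bandlimited_pderiv j (rschwartz_pderivs s su) IH).
Qed.

(** The partial sums converge at the rate 1/K to a continuous function v. The
    difference of d_j u and v has a vanishing Fourier transform: outside the ball of
    radius 2 both transforms vanish, and inside it the sine series sums to
    xi_j / 2. So d_j u = v. *)
Lemma pderiv_shift_sum u N : rschwartz u -> bandlimited u -> (2 * n <= N)%N ->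
  exists2 B, 0 < B & forall L j x K, (N.+2 <= L)%N ->
  `|pderiv j u x - shift_sum L K j u x| <= B / wt x ^+ N / K.+1%:R.
Proof.
move=> su bu nN.
have [C C0 uC] := rschwartz_decay N su.
have [B B0 tail] := shift_sum_tail uC C0.
exists B => // L j + K NL.
have vP x : {l | shift_sum L K j u x @[K --> \oo] --> l /\
    forall K, `|l - shift_sum L K j u x| <= B / wt x ^+ N / K.+1%:R}.
  apply/cid; have [l l1 l2] := cauchy_inv_cvg (fun K d => tail L j x K d NL).
  by exists l.
pose v x := sval (vP x).
have v1 x : shift_sum L K j u x @[K --> \oo] --> v x by have [] := svalP (vP x).
have v2 x K' : `|v x - shift_sum L K' j u x| <= B / wt x ^+ N / K'.+1%:R.
  by have [_] := svalP (vP x); apply.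
(* The decay rate is now known for v, and only the identification of v is left. *)
suff uv x : pderiv j u x = v x by move=> x; rewrite uv.
have cu := rschwartz_continuous su.
have cpu := rschwartz_continuous (rschwartz_pderiv j su).
have wN y : (wt y ^+ N)^-1 <= 1 by rewrite invf_le1 ?wtX_gt0// exprn_ege1// wt_ge1.
have v2' y K' : `|v y - shift_sum L K' j u y| <= B / K'.+1%:R.
  apply: (le_trans (v2 y K')); rewrite ler_wpM2r ?invr_ge0//.
  by apply: ler_piMr; [exact: ltW|exact: wN].
have cv : continuous v.
  move=> y; apply/cvgrPdist_le => e e0.
  pose K0 := Num.trunc (4 * B / e).
  have K0e : B / K0.+1%:R <= e / 4.
    have /andP[_ /ltW] := truncn_itv (divr_ge0 (mulr_ge0 (ler0n R 4) (ltW B0)) (ltW e0)).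
    rewrite -/K0 ler_pdivrMr// => h.
    by rewrite ler_pdivrMr//; lra.
  have e2 : 0 < e / 2 by rewrite divr_gt0.
  have /cvgrPdist_le/(_ _ e2) := @continuous_shift_sum L K0 j u cu y.
  apply: filterS => z hz.
  have h1 := v2' y K0; have h2 := v2' z K0.
  have -> : v y - v z = (v y - shift_sum L K0 j u y) +
    (shift_sum L K0 j u y - shift_sum L K0 j u z) - (v z - shift_sum L K0 j u z) by ring.
  apply: (le_trans (ler_normB _ _)).
  apply: (le_trans (lerD (ler_normD _ _) (lexx _))).
  have h3 := le_trans h1 K0e; have h4 := le_trans h2 K0e.
  apply: (le_trans (lerD (lerD h3 hz) h4)).
  by rewrite le_eqVlt; apply/orP; left; apply/eqP; field.
have kS K' : kdom (shift_sum L K' j u).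
  by have [] := shift_sum_wave L K' j 0 0 (rschwartz_kdom su).
have SC K' y : `|shift_sum L K' j u y| <= B * kappa y.
  have := tail L j y 0 K' NL; rewrite add0n divr1.
  rewrite {2}/shift_sum big_ord0 subr0 => h; apply: (le_trans h).
  rewrite ler_wpM2l ?(ltW B0)//; apply: le_trans (kappa_wt y).
  by rewrite lef_pV2 ?posrE ?wtX_gt0// ler_weXn2l// wt_ge1.
have [kv _] := Rintegral_dominated_cvg (fun K' => (kS K').1) SC v1.
have kpu := rschwartz_kdom (rschwartz_pderiv j su).
have kD : kdom (fun x => pderiv j u x - v x).
  have := kdomD kpu (kdomZ (-1) kv).
  by rewrite (_ : (fun _ => _) = (fun x => pderiv j u x - v x))//; apply/funext => y; rewrite mulN1r.
apply/eqP; rewrite -subr_eq0; apply/eqP.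
apply: (fourier_injective kD); last first.
  by apply: cvgB; [exact: cpu|exact: cv].
move=> xi th.
have e y : (pderiv j u y - v y) * cos (dotp y xi + th) =
  pderiv j u y * cos (dotp y xi + th) - v y * cos (dotp y xi + th) by ring.
under eq_Rintegral do rewrite e.
rewrite RintegralB//; [|exact/integrable_kdom/kdom_wave..].
rewrite pderiv_wave//; set S := (\int[mu]_x (u x * sin _))%R.
have [||_ lim] := Rintegral_dominated_cvg
   (fun K' => (kdom_wave xi th (kS K')).1) (C := B)
   (u := fun x => v x * cos (dotp x xi + th)).
- by move=> K' y; rewrite normrM (le_trans _ (SC K' y))// ler_piMr// norm_cos_le1.
- by move=> y; apply: cvgM; [exact: v1|exact: cvg_cst].
have [xi2|xi2] := ltP 2 (enorm xi).
  rewrite /S bandlimited_sin// mulr0 sub0r; apply/eqP; rewrite oppr_eq0; apply/eqP.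
  apply: (@cvg_unique R^o _ _ _ _ _ lim); first exact: Rhausdorff.
  rewrite (_ : (fun _ => _) = cst 0); first exact: cvg_cst.
  apply/funext => K'; have [_ ->] := shift_sum_wave L K' j xi th (rschwartz_kdom su).
  by rewrite bandlimited_sin// mulr0.
have xij : `|xi ord0 j / 2| <= 1.
  rewrite normrM (ger0_norm (_ : 0 <= 2^-1))// ler_pdivrMr// mul1r.
  exact: le_trans (enorm_coord _ _) xi2.
have [C' [C'0 hs]] := @sine_sum_cvg_bound R.
apply/eqP; rewrite subr_eq0; apply/eqP.
apply: (@cvg_unique R^o _ _ _ _ _ _ lim); first exact: Rhausdorff.
apply: (@cvg_inv_bound _ _ _ (2 * C' * `|S|)) => m.
have [_ ->] := shift_sum_wave L m j xi th (rschwartz_kdom su).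
have -> : 2 * sine_sum L m (xi ord0 j / 2) * S - xi ord0 j * S =
   2 * - (xi ord0 j / 2 - sine_sum L m (xi ord0 j / 2)) * S by field.
rewrite normrM normrM normrN (ger0_norm (_ : 0 <= 2))//.
rewrite (_ : 2 * C' * `|S| / m.+1%:R = 2 * (C' / m.+1%:R) * `|S|); last by ring.
by rewrite ler_wpM2r// ler_wpM2l// hs.
Qed.

End reproducing.

(** * Affine changes of variables and the error of the shift series *)

Section rschwartz_calculus.
Context {R : realType} {n : nat}.
Local Notation E := 'rV[R]_n.
Local Notation e_ j := (delta_mx ord0 j : E).
Implicit Types (u v w : E -> R) (x y b : E) (j : 'I_n).

(** Reduces partial derivatives to derivatives of functions of one variable, for
    which the chain rule is available. *)
Lemma derive_from_line u y (v : E) (d : R) :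
  is_derive (0 : R) 1 (fun t : R => u (y + t *: v)) d -> 'D_v u y = d.
Proof.
move=> [_ <-].
have e : (fun h : R => h^-1 *: (u (h *: v + y) - u y)) =
  (fun h : R => h^-1 *: (u (y + (h *: (1 : R) + 0) *: v) - u (y + (0 : R) *: v))).
  apply/funext => h; rewrite scale0r addr0.
  have -> : h *: (1 : R) = h by exact: mulr1.
  by rewrite addr0 (addrC y).
by rewrite /derive/= e.
Qed.

Lemma rschwartz_differentiable u x : rschwartz u -> differentiable u x.
Proof. by move=> [/(_ [::] x)]. Qed.

Lemma pderivs_affine u b (r : R) s : rschwartz u ->
  pderivs s (fun y => u (b + r *: y)) =
  (fun y => r ^+ size s * pderivs s u (b + r *: y)).
Proof.
move=> su; elim: s => [|j s IH]; first by apply/funext => y; rewrite expr0 mul1r.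
rewrite /= IH; apply/funext => y; apply: derive_from_line.
have h := is_derive_line (b + r *: y) j (0 * r) (rschwartz_pderivs s su).
have h0 : is_derive (0 : R) 1 (fun t : R => t * r) r.
  by apply: is_derive_eq; rewrite /GRing.scale/=; ring.
have h2 := @is_derive1_comp R (fun t : R => pderivs s u (b + r *: y + t *: e_ j))
  (fun t : R => t * r) 0 _ _ h h0.
have -> : (fun t : R => r ^+ size s * pderivs s u (b + r *: (y + t *: e_ j))) =
   r ^+ size s \*: ((fun t : R => pderivs s u (b + r *: y + t *: e_ j)) \o (fun t => t * r)).
  by apply/funext => t /=; rewrite scalerDr scalerA addrA (mulrC r).
apply: is_derive_eq; rewrite mul0r scale0r addr0 /GRing.scale/= /pderiv.
by rewrite exprSr -mulrA; congr (_ * _); rewrite mulrC.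
Qed.

Lemma pderivs_linear u v (a : R) s : rschwartz u -> rschwartz v ->
  pderivs s (fun y => a * u y + v y) = (fun y => a * pderivs s u y + pderivs s v y).
Proof.
move=> su sv; elim: s => [//|j s IH].
rewrite /= IH; apply/funext => y.
have d1 : derivable (pderivs s u) y (e_ j).
  exact/diff_derivable/rschwartz_differentiable/rschwartz_pderivs.
have d2 : derivable (pderivs s v) y (e_ j).
  exact/diff_derivable/rschwartz_differentiable/rschwartz_pderivs.
have d3 : derivable (a \*: pderivs s u) y (e_ j) by exact: derivableZ.
by have := deriveD d3 d2; rewrite deriveZ.
Qed.

Lemma rschwartz_linear u v (a : R) : rschwartz u -> rschwartz v ->
  rschwartz (fun y => a * u y + v y).
Proof.
move=> su sv; split=> [s x|s N].
  rewrite pderivs_linear//.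
  have d1 := rschwartz_differentiable x (rschwartz_pderivs s su).
  have d2 := rschwartz_differentiable x (rschwartz_pderivs s sv).
  have d3 : differentiable (a \*: pderivs s u) x by exact: differentiableZ.
  exact: (differentiableD d3 d2).
have [C _ hC] := rschwartz_decay N (rschwartz_pderivs s su).
have [D _ hD] := rschwartz_decay N (rschwartz_pderivs s sv).
exists (`|a| * C + D) => x; rewrite pderivs_linear// (le_trans (ler_normD _ _))//.
by rewrite mulrDl lerD// normrM -mulrA ler_wpM2l.
Qed.

Lemma wt_affine b (r : R) y : 1 <= `|r| -> wt y <= wt b * wt (b + r *: y).
Proof.
move=> r1; apply: (@le_trans _ _ (wt (r *: y))).
  by rewrite lerD2l l1normZ ler_peMl// l1norm_ge0.
have := wtD (- b) (b + r *: y).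
by rewrite addKr wtN.
Qed.

(** A dilation by |r| >= 1 does not spoil the decay, and the translation by b costs
    a power of [wt b]. *)
Lemma decay_affine u b (r C : R) N y : 1 <= `|r| -> 0 <= C ->
  `|u (b + r *: y)| <= C / wt (b + r *: y) ^+ N ->
  `|u (b + r *: y)| <= C * wt b ^+ N / wt y ^+ N.
Proof.
move=> r1 C0 h; apply: (le_trans h); rewrite -mulrA ler_wpM2l//.
have w1 := wtX_gt0 y N; have w2 := wtX_gt0 (b + r *: y) N.
rewrite ler_pdivlMr// mulrC ler_pdivrMr// -exprMn.
by rewrite lerXn2r ?nnegrE ?mulr_ge0 ?wt_ge0// wt_affine.
Qed.

Lemma rschwartz_affine u b (r : R) : 1 <= `|r| -> rschwartz u ->
  rschwartz (fun y => u (b + r *: y)).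
Proof.
move=> r1 su; split=> [s x|s N].
  rewrite pderivs_affine//.
  have d1 := rschwartz_differentiable (b + r *: x) (rschwartz_pderivs s su).
  have d2 : differentiable (fun y : E => b + r *: y) x.
    by apply: differentiableD => //; exact: differentiableZ.
  have d3 : differentiable (pderivs s u \o (fun y : E => b + r *: y)) x.
    exact: differentiable_comp.
  have d4 : differentiable (r ^+ size s \*: (pderivs s u \o (fun y : E => b + r *: y))) x.
    exact: differentiableZ.
  exact: d4.
have [C C0 hC] := rschwartz_decay N (rschwartz_pderivs s su).
exists (`|r| ^+ size s * (C * wt b ^+ N)) => y; rewrite pderivs_affine//.
rewrite normrM normrX -mulrA ler_wpM2l ?exprn_ge0//.
exact: (decay_affine (u := pderivs s u) r1 (ltW C0) (hC _)).
Qed.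

Lemma pderivs_translation u (c : E) s : rschwartz u ->
  pderivs s (fun y => u (y + c)) = (fun y => pderivs s u (y + c)).
Proof.
move=> su; have := pderivs_affine c 1 s su.
have e y : c + 1 *: y = y + c by rewrite scale1r addrC.
by under eq_fun do rewrite e; move=> ->; apply/funext => y; rewrite expr1n mul1r e.
Qed.

Lemma rschwartz_translation u (c : E) : rschwartz u -> rschwartz (fun y => u (y + c)).
Proof.
move=> su; have := @rschwartz_affine u c 1.
rewrite normr1 => /(_ (lexx _) su).
rewrite (_ : (fun y => u (c + 1 *: y)) = (fun y => u (y + c)))//.
by apply/funext => y; rewrite scale1r addrC.
Qed.

Lemma pderivs0 s : pderivs s (fun=> 0 : R) = (fun=> 0 : R) :> (E -> R).
Proof.
by elim: s => [//|j s IH]; rewrite /= IH; apply/funext => x; exact: derive_cst.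
Qed.

Lemma rschwartz0 : rschwartz (fun _ : E => 0 : R).
Proof.
by split=> [s x|s N]; rewrite pderivs0//; exists 0 => x; rewrite normr0 mul0r.
Qed.

Lemma shift_sum_rec L K j u :
  shift_sum L K.+1 j u = (fun x => (2 * scoef L K) *
    (-1 * u (x + (- (K.+1%:R / 2)) *: e_ j) + u (x + (K.+1%:R / 2) *: e_ j))
    + shift_sum L K j u x).
Proof.
by apply/funext => x; rewrite /shift_sum big_ord_recr/= /shift_term; ring.
Qed.

Lemma rschwartz_shift_sum L K j u s : rschwartz u ->
  rschwartz (shift_sum L K j u) /\
  pderivs s (shift_sum L K j u) = shift_sum L K j (pderivs s u).
Proof.
move=> su; elim: K => [|K [sK IH]].
  have e w : shift_sum L 0 j w = (fun=> 0).
    by apply/funext => x; rewrite /shift_sum big_ord0.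
  by rewrite !e pderivs0; split=> //; exact: rschwartz0.
have s1 := rschwartz_translation ((K.+1%:R / 2) *: e_ j) su.
have s2 := rschwartz_translation ((- (K.+1%:R / 2)) *: e_ j) su.
have s3 := rschwartz_linear (-1) s2 s1.
rewrite !shift_sum_rec; split; first exact: rschwartz_linear.
by rewrite pderivs_linear// pderivs_linear// !pderivs_translation// IH.
Qed.

(** The error of the first-order expansion of u along e_j, with the partial
    derivative replaced by its approximation. Unlike the derivative, it consists
    of finitely many translates, so that it commutes with tempered
    distributions. *)
Definition taylor_error L K j (t : R) u : E -> R :=
  fun x => (- t) * shift_sum L K j u x + (-1 * u x + u (x + t *: e_ j)).

Lemma rschwartz_taylor_error L K j (t : R) u s : rschwartz u ->
  rschwartz (taylor_error L K j t u) /\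
  pderivs s (taylor_error L K j t u) = taylor_error L K j t (pderivs s u).
Proof.
move=> su; have [sS eS] := rschwartz_shift_sum L K j s su.
have st := rschwartz_translation (t *: e_ j) su.
have s1 := rschwartz_linear (-1) su st.
split; first exact: rschwartz_linear.
by rewrite /taylor_error pderivs_linear// eS pderivs_linear// pderivs_translation.
Qed.

(** The term |t|^2 is the error of Taylor's formula, the term |t| / (K+1) that of the
    shift series. *)
Lemma taylor_error_bound u N : rschwartz u -> bandlimited u -> (2 * n <= N)%N ->
  exists C, 0 < C /\ forall L j x K t, (N.+2 <= L)%N -> `|t| <= 1 ->
  `|taylor_error L K j t u x| <= C * (`|t| ^+ 2 + `|t| / K.+1%:R) / wt x ^+ N.
Proof.
move=> su bu nN.
have hj j : exists C, 0 < C /\ forall L x K t, (N.+2 <= L)%N -> `|t| <= 1 ->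
  `|taylor_error L K j t u x| <= C * (`|t| ^+ 2 + `|t| / K.+1%:R) / wt x ^+ N.
  have [B B0 hB] := pderiv_shift_sum su bu nN.
  have [C C0 hC] := rschwartz_decay N (rschwartz_pderiv j (rschwartz_pderiv j su)).
  pose C' := C * 2 ^+ N.
  have C'0 : 0 < C' by rewrite mulr_gt0// exprn_gt0.
  exists (C' + B); split; first by rewrite addr_gt0.
  move=> L x K t NL t1.
  have wN : 0 < (wt x ^+ N)^-1 by rewrite invr_gt0 wtX_gt0.
  have h1 : `|u (x + t *: e_ j) - u x - t * pderiv j u x| <= C' / wt x ^+ N * `|t| ^+ 2.
    apply: line_increment2 => // r rt.
    apply: (le_trans (decay_shift hC C0 _ _ _)).
    rewrite ler_wpM2r ?(ltW wN)// ler_wpM2l ?(ltW C0)//.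
    by rewrite lerXn2r ?nnegrE ?addr_ge0//; have := le_trans rt t1; lra.
  have h2 : `|t * (pderiv j u x - shift_sum L K j u x)| <= `|t| * (B / wt x ^+ N / K.+1%:R).
    by rewrite normrM ler_wpM2l// hB.
  rewrite /taylor_error (_ : _ + _ = (u (x + t *: e_ j) - u x - t * pderiv j u x) +
    t * (pderiv j u x - shift_sum L K j u x)); last by ring.
  apply: (le_trans (ler_normD _ _)); apply: (le_trans (lerD h1 h2)).
  have a0 : 0 <= `|t| ^+ 2 by rewrite exprn_ge0.
  have b0 : 0 <= `|t| / K.+1%:R by rewrite divr_ge0.
  rewrite (_ : `|t| * (B / _ / _) = B * (`|t| / K.+1%:R) / wt x ^+ N); last by ring.
  rewrite mulrAC -mulrDl ler_wpM2r ?(ltW wN)//.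
  move: (`|t| ^+ 2) (`|t| / _) a0 b0 => a c a0 c0; nra.
have /choice[F hF] := hj.
exists (1 + \sum_j F j); split.
  by rewrite ltr_pwDl// sumr_ge0// => j _; exact: ltW (hF j).1.
move=> L j x K t NL t1; have [F0 h] := hF j.
apply: (le_trans (h L x K t NL t1)).
rewrite ler_wpM2r ?invr_ge0 ?(ltW (wtX_gt0 _ _))//.
apply: ler_wpM2r; first by rewrite addr_ge0 ?exprn_ge0// divr_ge0.
rewrite (bigD1 j)//= addrCA lerDl addr_ge0// sumr_ge0// => i _.
exact: ltW (hF i).1.
Qed.

End rschwartz_calculus.

(** * Tempered distributions acting on rescaled kernels *)

Section complex_modulus.
Context {R : realType}.
Local Notation nc := (@Normc.normc R).
Implicit Types z : R[i].

Lemma normc_ge0 z : 0 <= nc z.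
Proof. by case: z => a b; exact: sqrtr_ge0. Qed.

Lemma normc_Re z : `|complex.Re z| <= nc z.
Proof.
by case: z => a b /=; rewrite -sqrtr_sqr ler_wsqrtr// lerDl sqr_ge0.
Qed.

Lemma normc_Im z : `|complex.Im z| <= nc z.
Proof.
by case: z => a b /=; rewrite -sqrtr_sqr ler_wsqrtr// lerDr sqr_ge0.
Qed.

Lemma normc_le z : nc z <= `|complex.Re z| + `|complex.Im z|.
Proof.
case: z => a b /=; rewrite -[leRHS]ger0_norm ?addr_ge0// -sqrtr_sqr ler_wsqrtr//.
rewrite sqrrD !real_normK ?num_real// addrAC lerDl.
by rewrite mulrn_wge0// mulr_ge0.
Qed.

Lemma normc_real (r : R) : nc (r%:C)%C = `|r|.
Proof. by rewrite /= expr0n/= addr0 sqrtr_sqr. Qed.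

Lemma normc_realM (r : R) z : nc ((r%:C)%C * z) = `|r| * nc z.
Proof. by rewrite Normc.normcM normc_real. Qed.

Lemma normcD z w : nc (z + w) <= nc z + nc w.
Proof. exact: le_normcD. Qed.

Lemma normcB z w : nc (z - w) <= nc z + nc w.
Proof. by apply: (le_trans (normcD _ _)); rewrite normcN. Qed.

Lemma normc_sum (I : Type) (r : seq I) (F : I -> R[i]) :
  nc (\sum_(i <- r) F i) <= \sum_(i <- r) nc (F i).
Proof.
elim: r => [|i r IH]; first by rewrite !big_nil Normc.normc0.
by rewrite !big_cons (le_trans (normcD _ _))// lerD2l.
Qed.

End complex_modulus.

Section tempered.
Context {R : realType} {n : nat}.
Local Notation E := 'rV[R]_n.
Local Notation e_ j := (delta_mx ord0 j : E).
Local Notation nc := (@Normc.normc R).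
Implicit Types (phi psi P : E -> R[i]) (x y b : E) (j : 'I_n) (N : nat).

Definition crschwartz phi : Prop :=
  rschwartz (@complex.Re R \o phi) /\ rschwartz (@complex.Im R \o phi).

(** There are finitely many multi-indices of length at most N, so their
    constants have a common bound. *)
Lemma bounded_seqs (P : seq 'I_n -> R -> Prop) N :
  (forall s, exists C, P s C) -> (forall s C C', P s C -> C <= C' -> P s C') ->
  exists C, 0 < C /\ forall s, (size s <= N)%N -> P s C.
Proof.
move=> /choice[F hF] mono; exists (1 + \sum_(s : N.-bseq 'I_n) `|F s|); split.
  by rewrite ltr_pwDl// sumr_ge0.
move=> s sN; apply: (mono _ _ _ (hF s)).
rewrite (bigD1 (Bseq sN))//= addrCA (le_trans (ler_norm _))// lerDl.
by rewrite addr_ge0// sumr_ge0.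
Qed.

(** Equivalent to a bound on the seminorm of order N, and easier to propagate
    through affine maps. *)
Definition cbound N phi (B : R) : Prop := forall s x, (size s <= N)%N ->
  `|pderivs s (@complex.Re R \o phi) x| + `|pderivs s (@complex.Im R \o phi) x|
    <= B / wt x ^+ N.

Lemma crschwartz_bound phi N : crschwartz phi -> exists2 B, 0 < B & cbound N phi B.
Proof.
move=> [s1 s2].
have [||C [C0 hC]] := @bounded_seqs (fun s C => forall x,
   `|pderivs s (@complex.Re R \o phi) x| + `|pderivs s (@complex.Im R \o phi) x|
     <= C / wt x ^+ N) N.
- move=> s; have [A _ hA] := rschwartz_decay N (rschwartz_pderivs s s1).
  have [B _ hB] := rschwartz_decay N (rschwartz_pderivs s s2).
  by exists (A + B) => x; rewrite mulrDl lerD.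
- move=> s C C' hC CC' x; apply: (le_trans (hC x)).
  by rewrite ler_wpM2r// invr_ge0 exprn_ge0// wt_ge0.
by exists C => // s x sN; exact: hC.
Qed.

Lemma schwartz_crschwartz phi : schwartz phi -> crschwartz phi.
Proof.
move=> [sm fin].
have key s N : exists C, forall x, nc (cpderivs s phi x) <= C / wt x ^+ N.
  pose M := maxn (size s) N.
  have : (schwartz_seminorm M phi < +oo)%E := fin M.
  have ub x : (((1 + enorm x) ^+ M * nc (cpderivs s phi x))%:E <= schwartz_seminorm M phi)%E.
    by apply: ereal_sup_ubound; exists s, x; split=> //; exact: leq_maxl.
  case: (schwartz_seminorm M phi) ub => [C| |] // ub _; last first.
    by have := ub 0; rewrite leeNy_eq.
  exists (n.+1%:R ^+ N * C) => x; have := ub x; rewrite lee_fin => h.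
  have e0 := enorm_ge0 x.
  rewrite ler_pdivlMr ?wtX_gt0//.
  apply: (@le_trans _ _ (nc (cpderivs s phi x) * (n.+1%:R ^+ N * (1 + enorm x) ^+ M))).
    rewrite ler_wpM2l ?normc_ge0//.
    apply: (@le_trans _ _ (n.+1%:R ^+ N * (1 + enorm x) ^+ N)).
      rewrite -exprMn lerXn2r ?nnegrE ?wt_ge0 ?mulr_ge0 ?addr_ge0//.
      rewrite /wt; have := l1norm_le_enorm x; rewrite -natr1.
      have : 0 <= n%:R :> R by [].
      by nra.
    rewrite ler_wpM2l ?exprn_ge0// ler_weXn2l ?leq_maxr//.
    by rewrite lerDl.
  by rewrite mulrCA ler_wpM2l ?exprn_ge0// mulrC.
split; split=> [s x|s N].
- by have [] := sm s x.
- have [C hC] := key s N; exists C => x; apply: le_trans (hC x).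
  exact: (normc_Re (cpderivs s phi x)).
- by have [] := sm s x.
- have [C hC] := key s N; exists C => x; apply: le_trans (hC x).
  exact: (normc_Im (cpderivs s phi x)).
Qed.

Lemma cbound_seminorm N phi B : cbound N phi B ->
  (schwartz_seminorm N phi <= B%:E)%E.
Proof.
move=> h; apply: ge_ereal_sup => _ [s [x [sN ->]]]; rewrite lee_fin.
have := h s x sN; rewrite ler_pdivlMr ?wtX_gt0// mulrC; apply: le_trans.
apply: ler_pM.
- by rewrite exprn_ge0// addr_ge0// enorm_ge0.
- exact: normc_ge0.
- rewrite lerXn2r ?nnegrE ?wt_ge0 ?addr_ge0 ?enorm_ge0//.
  by rewrite lerD2l enorm_le_l1norm.
- exact: (normc_le (cpderivs s phi x)).
Qed.

Lemma crschwartz_schwartz phi : crschwartz phi -> schwartz phi.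
Proof.
move=> cp; split.
  by move=> s x; split; [exact: cp.1.1|exact: cp.2.1].
move=> N; have [B _ hB] := crschwartz_bound N cp.
by apply: (le_lt_trans (cbound_seminorm hB)); rewrite ltry.
Qed.

Lemma Re_real_linear phi psi (a : R) :
  @complex.Re R \o (fun x => (a%:C)%C * phi x + psi x) =
  (fun x => a * (@complex.Re R \o phi) x + (@complex.Re R \o psi) x).
Proof.
apply/funext => x /=; case: (phi x) (psi x) => [p q] [r s] /=.
by rewrite mul0r subr0.
Qed.

Lemma Im_real_linear phi psi (a : R) :
  @complex.Im R \o (fun x => (a%:C)%C * phi x + psi x) =
  (fun x => a * (@complex.Im R \o phi) x + (@complex.Im R \o psi) x).
Proof.
apply/funext => x /=; case: (phi x) (psi x) => [p q] [r s] /=.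
by rewrite mul0r addr0.
Qed.

Lemma crschwartz_linear phi psi (a : R) : crschwartz phi -> crschwartz psi ->
  crschwartz (fun x => (a%:C)%C * phi x + psi x).
Proof.
move=> [p1 p2] [q1 q2]; rewrite /crschwartz Re_real_linear Im_real_linear.
by split; exact: rschwartz_linear.
Qed.

Lemma crschwartz0 : crschwartz (fun _ : E => 0 : R[i]).
Proof. by split; exact: rschwartz0. Qed.

Lemma crschwartz_affine phi b (r : R) : 1 <= `|r| -> crschwartz phi ->
  crschwartz (fun y => phi (b + r *: y)).
Proof.
by move=> r1 [p1 p2]; split; [exact: (rschwartz_affine b r1 p1)|exact: (rschwartz_affine b r1 p2)].
Qed.

Lemma crschwartz_translation phi (c : E) : crschwartz phi ->
  crschwartz (fun y => phi (y + c)).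
Proof.
by move=> [p1 p2]; split; [exact: (rschwartz_translation c p1)|exact: (rschwartz_translation c p2)].
Qed.

Section functional.
Variable f : @tempered_distribution R n.

Lemma tempered_real_linear phi psi (a : R) : crschwartz phi -> crschwartz psi ->
  f (fun x => (a%:C)%C * phi x + psi x) = (a%:C)%C * f phi + f psi.
Proof. by move=> /crschwartz_schwartz ? /crschwartz_schwartz ?; exact: tempered_linear. Qed.

Lemma tempered0 : f (fun=> 0) = 0.
Proof.
have := tempered_real_linear 1 crschwartz0 crschwartz0.
under eq_fun do rewrite mulr0 addr0.
rewrite (_ : (1%:C)%C = 1)// mul1r => h.
by apply/eqP; rewrite -(inj_eq (addrI (f (fun=> 0)))) -h addr0.
Qed.

(** Continuity at 0 gives a ball on which |f| < 1; scale phi into that ball. *)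
Lemma tempered_bound : exists N (C : R), 0 < C /\ forall phi B,
  crschwartz phi -> 0 < B -> cbound N phi B -> nc (f phi) <= C * B.
Proof.
have [N [d [d0 hd]]] := tempered_continuous f (crschwartz_schwartz crschwartz0) ltr01.
exists N, (2 / d); split; first by rewrite divr_gt0.
move=> phi B cp B0 hB.
(* The factor 2 makes the scaled function lie strictly inside the ball. *)
pose c := d / (2 * B).
have c0 : 0 < c by rewrite divr_gt0// mulr_gt0.
have cs := crschwartz_linear c cp crschwartz0.
have e s x : pderivs s (@complex.Re R \o (fun x => (c%:C)%C * phi x + 0)) x =
   c * pderivs s (@complex.Re R \o phi) x.
  by rewrite Re_real_linear pderivs_linear ?pderivs0 ?addr0//; [exact: cp.1|exact: rschwartz0].
have e' s x : pderivs s (@complex.Im R \o (fun x => (c%:C)%C * phi x + 0)) x =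
   c * pderivs s (@complex.Im R \o phi) x.
  by rewrite Im_real_linear pderivs_linear ?pderivs0 ?addr0//; [exact: cp.2|exact: rschwartz0].
have cb : cbound N (fun x => (c%:C)%C * phi x + 0) (d / 2).
  move=> s x sN; rewrite e e' (normrM c) (normrM c) (gtr0_norm c0) -mulrDr.
  rewrite (_ : d / 2 / _ = c * (B / wt x ^+ N)); last first.
    by rewrite /c; field; rewrite !gt_eqF// wtX_gt0.
  by rewrite ler_wpM2l ?(ltW c0)// hB.
have := hd _ (crschwartz_schwartz cs).
rewrite (_ : (fun x => _ - 0) = (fun x => (c%:C)%C * phi x + 0)); last first.
  by apply/funext => x; rewrite subr0.
rewrite tempered_real_linear//; last exact: crschwartz0.
rewrite tempered0 addr0 subr0 normc_realM (gtr0_norm c0) => h.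
have : c * nc (f phi) < 1.
  apply: h; apply: (le_lt_trans (cbound_seminorm cb)); rewrite lte_fin.
  by rewrite ltr_pdivrMr// ltr_pMr// ltr1n.
rewrite mulrC -ltr_pdivlMr// => /ltW h2; apply: (le_trans h2).
by rewrite /c mul1r invf_div mulrAC.
Qed.

Definition cshift_sum L K j P b : R[i] := \sum_(k < K) ((2 * scoef L k)%:C)%C *
  (P (b + (k.+1%:R / 2) *: e_ j) - P (b + (- (k.+1%:R / 2)) *: e_ j)).

Definition ctaylor_error L K j (t : R) P b : R[i] :=
  ((- t)%:C)%C * cshift_sum L K j P b + (((-1)%:C)%C * P b + P (b + t *: e_ j)).

Lemma cshift_sum_rec L K j P :
  cshift_sum L K.+1 j P = (fun x => ((2 * scoef L K)%:C)%C *
    (((-1)%:C)%C * P (x + (- (K.+1%:R / 2)) *: e_ j) + P (x + (K.+1%:R / 2) *: e_ j))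
    + cshift_sum L K j P x).
Proof.
apply/funext => x; rewrite /cshift_sum big_ord_recr/= addrC; congr (_ * _ + _).
by rewrite (_ : ((-1)%:C)%C = -1)//= ?mulN1r ?(addrC (- _))// rmorphN1.
Qed.

Lemma Re_Im_cshift_sum L K j P :
  @complex.Re R \o cshift_sum L K j P = shift_sum L K j (@complex.Re R \o P) /\
  @complex.Im R \o cshift_sum L K j P = shift_sum L K j (@complex.Im R \o P).
Proof.
elim: K => [|K [IH1 IH2]].
  by split; apply/funext => x; rewrite /= /cshift_sum /shift_sum !big_ord0.
by rewrite cshift_sum_rec !shift_sum_rec !(Re_real_linear, Im_real_linear) IH1 IH2; split;
  rewrite ?(Re_real_linear, Im_real_linear).
Qed.

Lemma Re_Im_ctaylor_error L K j (t : R) P :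
  @complex.Re R \o ctaylor_error L K j t P = taylor_error L K j t (@complex.Re R \o P) /\
  @complex.Im R \o ctaylor_error L K j t P = taylor_error L K j t (@complex.Im R \o P).
Proof.
have [h1 h2] := Re_Im_cshift_sum L K j P.
rewrite /ctaylor_error /taylor_error !(Re_real_linear, Im_real_linear) h1 h2.
by split; rewrite ?(Re_real_linear, Im_real_linear).
Qed.

Section scaled.
Variables (P : E -> R[i]) (a : R).
Hypotheses (sP : crschwartz P) (a1 : 1 <= a).

Let na1 : 1 <= `|- a|.
Proof. by rewrite normrN ger0_norm// (le_trans ler01). Qed.

(** For a = 2^v and P the mother kernel this is phi_v * f up to a constant factor, in the
    variable b = 2^v x in which its spectrum lies in the ball of radius 2. *)
Definition rescaled_conv b : R[i] := f (fun y => P (b + (- a) *: y)).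

Lemma rescaled_conv_translation b (c : E) :
  rescaled_conv (b + c) = f (fun y => P (b + (- a) *: y + c)).
Proof. by rewrite /rescaled_conv; congr (f _); apply/funext => y; rewrite addrAC. Qed.

Lemma crschwartz_scaled Q b : crschwartz Q -> crschwartz (fun y => Q (b + (- a) *: y)).
Proof. exact: crschwartz_affine. Qed.

Lemma crschwartz_cshift_sum L K j : crschwartz (cshift_sum L K j P).
Proof.
rewrite /crschwartz; have [-> ->] := Re_Im_cshift_sum L K j P.
by split; [exact: (rschwartz_shift_sum L K j [::] sP.1).1|
           exact: (rschwartz_shift_sum L K j [::] sP.2).1].
Qed.

(** Shifting b is shifting the kernel, and f is linear. *)
Lemma rescaled_conv_cshift_sum L K j b :
  f (fun y => cshift_sum L K j P (b + (- a) *: y)) = cshift_sum L K j rescaled_conv b.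
Proof.
elim: K => [|K IH].
  rewrite /cshift_sum big_ord0 -[RHS]tempered0; congr (f _).
  by apply/funext => y; rewrite big_ord0.
rewrite !cshift_sum_rec -IH !rescaled_conv_translation.
have s1 c : crschwartz (fun y => P (b + (- a) *: y + c)).
  exact: (crschwartz_scaled b (crschwartz_translation c sP)).
have sS := crschwartz_scaled b (crschwartz_cshift_sum L K j).
rewrite tempered_real_linear//; last exact: crschwartz_linear.
by rewrite tempered_real_linear.
Qed.

Lemma rescaled_conv_ctaylor_error L K j (t : R) b :
  f (fun y => ctaylor_error L K j t P (b + (- a) *: y)) =
  ctaylor_error L K j t rescaled_conv b.
Proof.
rewrite /ctaylor_error -rescaled_conv_cshift_sum rescaled_conv_translation.
have s1 c : crschwartz (fun y => P (b + (- a) *: y + c)).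
  exact: (crschwartz_scaled b (crschwartz_translation c sP)).
have s0 := crschwartz_scaled b sP.
have sS := crschwartz_scaled b (crschwartz_cshift_sum L K j).
rewrite tempered_real_linear//; last exact: crschwartz_linear.
by rewrite tempered_real_linear.
Qed.

Lemma cbound_scaled N Q B b : crschwartz Q -> 0 <= B ->
  (forall s x, (size s <= N)%N ->
    `|pderivs s (@complex.Re R \o Q) x| <= B / wt x ^+ N /\
    `|pderivs s (@complex.Im R \o Q) x| <= B / wt x ^+ N) ->
  cbound N (fun y => Q (b + (- a) *: y)) (2 * a ^+ N * B * wt b ^+ N).
Proof.
move=> [q1 q2] B0 h s y sN.
have a0 : 0 <= a by exact: le_trans a1.
have [h1 h2] := h s (b + (- a) *: y) sN.
have main u : rschwartz u -> `|pderivs s u (b + (- a) *: y)| <= B / wt (b + (- a) *: y) ^+ N ->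
    `|pderivs s (fun y => u (b + (- a) *: y)) y| <= a ^+ N * B * wt b ^+ N / wt y ^+ N.
  move=> su hu; rewrite pderivs_affine// normrM normrX normrN (ger0_norm a0).
  rewrite -!mulrA; apply: ler_pM => //; first by rewrite exprn_ge0.
    exact: ler_weXn2l.
  by rewrite mulrA; exact: (decay_affine (u := pderivs s u) na1 B0 hu).
apply: (le_trans (lerD (main _ q1 h1) (main _ q2 h2))).
by rewrite le_eqVlt; apply/orP; left; apply/eqP; ring.
Qed.

(** The seminorms of the kernel translated by b grow polynomially in b. *)
Lemma rescaled_conv_growth : exists N (C : R), forall b, nc (rescaled_conv b) <= C * wt b ^+ N.
Proof.
have [N [C [C0 hC]]] := tempered_bound.
have [B B0 hB] := crschwartz_bound N sP.
have a0 : 0 < a by exact: lt_le_trans a1.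
exists N, (C * (2 * a ^+ N * B)) => b; rewrite -mulrA; apply: hC.
- exact: crschwartz_scaled.
- by rewrite !mulr_gt0// ?exprn_gt0// wt_gt0.
apply: cbound_scaled => //; first exact: ltW.
by move=> s x sN; split; apply: le_trans (hB s x sN); rewrite ?lerDl ?lerDr.
Qed.

Hypotheses (bRe : bandlimited (@complex.Re R \o P))
           (bIm : bandlimited (@complex.Im R \o P)).

(** [taylor_error_bound] holds for all derivatives of the kernel, as these are
    band-limited too. So the test function ctaylor_error of the kernel is small in
    the seminorm that controls f. *)
Lemma rescaled_conv_taylor : exists N (C : R), 0 <= C /\ forall L K j t b, (N <= L)%N ->
  `|t| <= 1 ->
  nc (ctaylor_error L K j t rescaled_conv b) <= C * (`|t| ^+ 2 + `|t| / K.+1%:R) * wt b ^+ N.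
Proof.
have [N0 [C [C0 hC]]] := tempered_bound.
pose N := maxn N0 (2 * n).
have nN : (2 * n <= N)%N by exact: leq_maxr.
have N0N : (N0 <= N)%N by exact: leq_maxl.
pose good u := exists C, 0 < C /\ forall s, (size s <= N)%N ->
  forall L j x K t, (N.+2 <= L)%N -> `|t| <= 1 ->
  `|taylor_error L K j t (pderivs s u) x| <= C * (`|t| ^+ 2 + `|t| / K.+1%:R) / wt x ^+ N.
have key u : rschwartz u -> bandlimited u -> good u.
  move=> su bu; apply: (@bounded_seqs (fun s C => forall L j x K t, (N.+2 <= L)%N -> `|t| <= 1 ->
    `|taylor_error L K j t (pderivs s u) x| <= C * (`|t| ^+ 2 + `|t| / K.+1%:R) / wt x ^+ N) N).
    move=> s; have [D [_ hD]] := taylor_error_bound (rschwartz_pderivs s su)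
      (bandlimited_pderivs s su bu) nN.
    by exists D.
  move=> s D D' hD DD' L j x K t NL t1; apply: (le_trans (hD L j x K t NL t1)).
  apply: ler_wpM2r; first by rewrite invr_ge0 exprn_ge0 ?wt_ge0.
  by apply: ler_wpM2r => //; rewrite addr_ge0 ?exprn_ge0// divr_ge0.
have [D1 [D10 hD1]] := key _ sP.1 bRe.
have [D2 [D20 hD2]] := key _ sP.2 bIm.
have a0 : 0 < a by exact: lt_le_trans a1.
exists N.+2, (C * (2 * a ^+ N0 * (D1 + D2))); split.
  by rewrite !mulr_ge0 ?exprn_ge0 ?addr_ge0 ?(ltW C0) ?(ltW D10) ?(ltW D20) ?(ltW a0).
move=> L K j t b NL t1.
set q := `|t| ^+ 2 + `|t| / K.+1%:R.
have q0 : 0 <= q by rewrite addr_ge0 ?exprn_ge0// divr_ge0.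
have [->|t0] := eqVneq t 0.
  rewrite /ctaylor_error scale0r addr0 oppr0 mul0r add0r (_ : ((-1)%:C)%C = -1) ?mulN1r ?addNr; last first.
    by rewrite rmorphN1.
  rewrite Normc.normc0 mulr_ge0 ?exprn_ge0 ?wt_ge0// mulr_ge0//.
  by rewrite !mulr_ge0 ?exprn_ge0 ?addr_ge0 ?(ltW C0) ?(ltW D10) ?(ltW D20) ?(ltW a0).
have qp : 0 < q by rewrite ltr_pwDl ?exprn_gt0 ?normr_gt0// divr_ge0.
rewrite -rescaled_conv_ctaylor_error.
have sT : crschwartz (ctaylor_error L K j t P).
  rewrite /crschwartz; have [-> ->] := Re_Im_ctaylor_error L K j t P.
  by split; [exact: (rschwartz_taylor_error L K j t [::] sP.1).1|
             exact: (rschwartz_taylor_error L K j t [::] sP.2).1].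
apply: (@le_trans _ _ (C * (2 * a ^+ N0 * ((D1 + D2) * q) * wt b ^+ N0))).
  apply: hC.
  - exact: crschwartz_scaled.
  - have DD := addr_gt0 D10 D20; have aN : 0 < a ^+ N0 by rewrite exprn_gt0.
    by rewrite !mulr_gt0// wtX_gt0.
  apply: cbound_scaled => //.
    exact: (mulr_ge0 (addr_ge0 (ltW D10) (ltW D20)) q0).
  move=> s x sN; have sN' := leq_trans sN N0N.
  have [-> ->] := Re_Im_ctaylor_error L K j t P.
  rewrite (rschwartz_taylor_error L K j t s sP.1).2 (rschwartz_taylor_error L K j t s sP.2).2.
  have wle : (wt x ^+ N)^-1 <= (wt x ^+ N0)^-1.
    by rewrite lef_pV2 ?posrE ?wtX_gt0// ler_weXn2l// wt_ge1.
  have w0 : 0 <= (wt x ^+ N)^-1 by rewrite invr_ge0 exprn_ge0// wt_ge0.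
  split.
    apply: (le_trans (hD1 s sN' L j x K t NL t1)); apply: ler_pM => //.
      by rewrite mulr_ge0 ?(ltW D10).
    by apply: ler_wpM2r => //; rewrite lerDl ltW.
  apply: (le_trans (hD2 s sN' L j x K t NL t1)); apply: ler_pM => //.
    by rewrite mulr_ge0 ?(ltW D20).
  by apply: ler_wpM2r => //; rewrite lerDr ltW.
rewrite [leRHS](_ : _ = C * (2 * a ^+ N0 * ((D1 + D2) * q) * wt b ^+ N.+2)); last by ring.
rewrite ler_wpM2l ?(ltW C0)//; apply: ler_wpM2l.
  by rewrite !mulr_ge0 ?exprn_ge0 ?addr_ge0 ?(ltW D10) ?(ltW D20) ?(ltW a0).
by rewrite ler_weXn2l ?wt_ge1// (leq_trans N0N)// ltnW.
Qed.

End scaled.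
End functional.
End tempered.

(** * Weighted suprema from values on a net *)

Section spectral_bound.
Context {R : realType} {n : nat}.
Local Notation E := 'rV[R]_n.
Local Notation e_ j := (delta_mx ord0 j : E).
Local Notation nc := (@Normc.normc R).
Implicit Types (G : E -> R[i]) (V W : E -> R) (x y z b : E) (j : 'I_n).

(** The two properties of f(P(b - a .)) that carry the sampling argument. Their
    constants may depend on f and on the scale; the bounds obtained from them below
    do not. *)
Definition spectral G : Prop :=
  (exists N (C : R), forall b, nc (G b) <= C * wt b ^+ N) /\
  (exists N (C : R), 0 <= C /\ forall L K j t b, (N <= L)%N -> `|t| <= 1 ->
    nc (ctaylor_error L K j t G b) <=
      C * (`|t| ^+ 2 + `|t| / K.+1%:R) * wt b ^+ N).

(** A Bernstein inequality. Cutting the segment into M pieces, each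
    piece contributes |s|/M times the bound B of the shift series and an error of order
    M^-2, with K + 1 chosen equal to M; the errors add up to something of order 1/M, hence
    disappear, whatever their constants. *)
Lemma spectral_lipschitz G : spectral G -> exists L0, forall L j b (s B : R),
  (L0 <= L)%N ->
  (forall K r, `|r| <= `|s| -> nc (cshift_sum L K j G (b + r *: e_ j)) <= B) ->
  nc (G (b + s *: e_ j) - G b) <= `|s| * B.
Proof.
move=> [_ [N [C [C0 hC]]]]; exists N => L j b s B NL hB.
pose w := (wt b * (1 + `|s|)) ^+ N.
have w0 : 0 <= w by rewrite exprn_ge0// mulr_ge0 ?wt_ge0// addr_ge0.
have step (m : nat) : `|s| <= m.+1%:R ->
    nc (G (b + s *: e_ j) - G b) <= `|s| * B + C * w * (`|s| ^+ 2 + `|s|) / m.+1%:R.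
  move=> sm; set M : R := m.+1%:R.
  have M0 : 0 < M by rewrite ltr0n.
  pose t := s / M.
  have t1 : `|t| <= 1 by rewrite normrM normfV (gtr0_norm M0) ler_pdivrMr// mul1r.
  have H k : (k <= m.+1)%N -> nc (G (b + (k%:R * t) *: e_ j) - G b) <=
      k%:R * (`|t| * B + C * (`|t| ^+ 2 + `|t| / M) * w).
    elim: k => [_|k IH km]; first by rewrite mul0r scale0r addr0 subrr Normc.normc0 mul0r.
    set b' := b + (k%:R * t) *: e_ j.
    have kt : `|k%:R * t| <= `|s|.
      rewrite normrM normr_nat /t normrM normfV (gtr0_norm M0) mulrCA ler_piMr//.
      by rewrite ler_pdivrMr// mul1r ler_nat ltnW.
    have -> : b + (k.+1%:R * t) *: e_ j = b' + t *: e_ j.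
      by rewrite /b' -addrA -scalerDl -natr1 mulrDl mul1r.
    have -> : G (b' + t *: e_ j) - G b = (G b' - G b) +
       (ctaylor_error L m j t G b' + (t%:C)%C * cshift_sum L m j G b').
      rewrite /ctaylor_error (_ : ((- t)%:C)%C = - (t%:C)%C); last by rewrite rmorphN.
      rewrite (_ : ((-1)%:C)%C = -1); last by rewrite rmorphN1.
      by ring.
    apply: (le_trans (normcD _ _)); rewrite -natr1 mulrDl mul1r; apply: lerD.
      by apply: IH; exact: ltnW.
    rewrite addrC; apply: (le_trans (normcD _ _)); apply: lerD.
      by rewrite normc_realM ler_wpM2l// hB.
    apply: (le_trans (hC _ _ _ _ _ NL t1)); apply: ler_wpM2l.
      by rewrite mulr_ge0// addr_ge0 ?exprn_ge0// divr_ge0.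
    rewrite /w lerXn2r ?nnegrE ?wt_ge0 ?mulr_ge0 ?wt_ge0 ?addr_ge0//.
    apply: (le_trans (wtD _ _)); apply: ler_wpM2l; first exact: wt_ge0.
    by rewrite {1}/wt l1normZ l1norm_delta mulr1 lerD2l.
  have := H m.+1 (leqnn _).
  have -> : m.+1%:R * t = s by rewrite /t -/M; field; rewrite gt_eqF.
  move=> h; apply: (le_trans h).
  rewrite -/M /t normrM normfV (gtr0_norm M0) le_eqVlt; apply/orP; left; apply/eqP.
  by field; rewrite gt_eqF.
apply/ler_addgt0Pr => e e0.
set D := C * w * (`|s| ^+ 2 + `|s|) in step.
have D0 : 0 <= D by rewrite !mulr_ge0// addr_ge0// exprn_ge0.
pose m := (Num.trunc (D / e) + Num.trunc `|s|)%N.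
have sm : `|s| <= m.+1%:R.
  have /andP[_ /ltW h] := truncn_itv (normr_ge0 s).
  by apply: (le_trans h); rewrite ler_nat /m ltnS leq_addl.
apply: (le_trans (step m sm)); rewrite lerD2l ler_pdivrMr// mulrC -ler_pdivrMr//.
have /andP[_ /ltW h] := truncn_itv (divr_ge0 D0 (ltW e0)).
by apply: (le_trans h); rewrite ler_nat /m ltnS leq_addr.
Qed.

(** With such a weight, values at distance d differ by at most a factor of polynomial
    growth in d, which a rapidly convergent series of shifts tolerates. *)
Definition moderate (M : nat) (C : R) V : Prop :=
  (forall x, 0 < V x) /\ forall x y, V x <= C * V y * wt (x - y) ^+ M.

(** The constant K0 depends on the weight only through M and Cv. The
    point x of the weight may differ from z, because z will run over the path
    of [spectral_coordinate_path] while x stays fixed. *)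
Lemma cshift_sum_moderate (M : nat) (Cv : R) : 0 < Cv -> exists K0 : R, 0 < K0 /\
  forall V G A, moderate M Cv V -> (forall z, V z * nc (G z) <= A) ->
  forall L K j x z, (M.+2 <= L)%N -> l1norm (x - z) <= n%:R ->
  V x * nc (cshift_sum L K j G z) <= K0 * A.
Proof.
move=> Cv0; have [D [D0 hD]] := @scoef_decay R M.+2.
pose c : R := 4 * D * Cv * (n%:R + 2) ^+ M.
have c0 : 0 < c.
  by rewrite !mulr_gt0// exprn_gt0// ltr_wpDl.
exists (c * 2); split; first by rewrite mulr_gt0.
move=> V G A [V0 mV] hA L K j x z ML xz.
have A0 : 0 <= A by apply: le_trans (hA 0); rewrite mulr_ge0 ?normc_ge0// ltW.
have hz k (r : R) : `|r| = k.+1%:R / 2 ->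
    V x * nc (G (z + r *: e_ j)) <= Cv * A * ((n%:R + 2) * k.+1%:R) ^+ M.
  move=> hr; set z' := z + r *: e_ j.
  apply: (@le_trans _ _ (Cv * V z' * wt (x - z') ^+ M * nc (G z'))).
    by rewrite ler_wpM2r ?normc_ge0.
  rewrite (_ : Cv * V z' * _ * _ = Cv * (V z' * nc (G z')) * wt (x - z') ^+ M); last by ring.
  apply: ler_pM.
  - by rewrite mulr_ge0 ?(ltW Cv0)// mulr_ge0 ?normc_ge0// ltW.
  - by rewrite exprn_ge0// wt_ge0.
  - by rewrite ler_wpM2l ?(ltW Cv0).
  have k1 : 1 <= k.+1%:R :> R by rewrite ler1n.
  have n0 : 0 <= n%:R :> R by [].
  rewrite lerXn2r ?nnegrE ?wt_ge0 ?mulr_ge0 ?addr_ge0//.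
  rewrite /wt /z' opprD addrA (le_trans (lerD (lexx _) (l1normD _ _)))//.
  by rewrite l1normN l1normZ l1norm_delta mulr1 hr; nra.
apply: (@le_trans _ _ (V x * \sum_(k < K) (2 * (D / k.+1%:R ^+ M.+2) *
   (nc (G (z + (k.+1%:R / 2) *: e_ j)) + nc (G (z + (- (k.+1%:R / 2)) *: e_ j)))))).
  apply: ler_wpM2l; first exact: ltW.
  apply: (le_trans (normc_sum _ _)); apply: ler_sum => k _.
  rewrite normc_realM; apply: ler_pM => //; first exact: normc_ge0.
    by rewrite normrM (ger0_norm (_ : 0 <= 2))// ler_wpM2l// hD.
  exact: normcB.
rewrite mulr_sumr; apply: (@le_trans _ _ (\sum_(k < K) c * A * ((0 + k).+1%:R ^+ 2)^-1)).
  apply: ler_sum => k _; rewrite add0n.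
  set a : R := k.+1%:R.
  have a0 : 0 < a by rewrite ltr0n.
  have h1 : V x * nc (G (z + (a / 2) *: e_ j)) <= Cv * A * ((n%:R + 2) * a) ^+ M.
    by apply: hz; rewrite gtr0_norm// divr_gt0.
  have h2 : V x * nc (G (z + (- (a / 2)) *: e_ j)) <= Cv * A * ((n%:R + 2) * a) ^+ M.
    by apply: hz; rewrite normrN gtr0_norm// divr_gt0.
  rewrite mulrCA mulrDr; apply: (@le_trans _ _ (2 * (D / a ^+ M.+2) *
     (Cv * A * ((n%:R + 2) * a) ^+ M + Cv * A * ((n%:R + 2) * a) ^+ M))).
    apply: ler_wpM2l; last exact: lerD.
    by rewrite mulr_ge0// divr_ge0 ?(ltW D0)// exprn_ge0// ltW.
  rewrite le_eqVlt; apply/orP; left; apply/eqP.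
  by rewrite exprMn /c !exprS; field; rewrite !gt_eqF// exprn_gt0.
rewrite -mulr_sumr (_ : c * 2 * A = c * A * 2); last by ring.
apply: ler_wpM2l; first by rewrite mulr_ge0// ltW.
by have := @sum_inv_sqr R 0 K; rewrite divr1.
Qed.

(** Join x to y through the points p k, which have the first k coordinates of y
    and the other coordinates of x. *)
Lemma spectral_coordinate_path G L x y (B : R) : (forall j b (s B : R),
    (forall K r, `|r| <= `|s| -> nc (cshift_sum L K j G (b + r *: e_ j)) <= B) ->
    nc (G (b + s *: e_ j) - G b) <= `|s| * B) ->
  (forall i, `|x ord0 i - y ord0 i| <= 1) -> 0 <= B ->
  (forall K j z, l1norm (x - z) <= n%:R -> nc (cshift_sum L K j G z) <= B) ->
  nc (G y - G x) <= (\sum_i `|x ord0 i - y ord0 i|) * B.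
Proof.
move=> lip xy B0 hB.
pose p k : E := \row_i (if (i < k)%N then y ord0 i else x ord0 i).
have px k i : `|x ord0 i - p k ord0 i| <= 1.
  by rewrite mxE; case: ifP => _; rewrite ?subrr ?normr0.
have H k : (k <= n)%N -> nc (G (p k) - G x) <=
    (\sum_(i < n | (i < k)%N) `|x ord0 i - y ord0 i|) * B.
  elim: k => [_|k IH kn].
    have -> : p 0%N = x by apply/rowP => i; rewrite mxE.
    by rewrite subrr Normc.normc0 big_pred0 ?mul0r.
  pose j := Ordinal kn; pose s := y ord0 j - x ord0 j.
  have pS : p k.+1 = p k + s *: e_ j.
    apply/rowP => i; rewrite !mxE eqxx/= ltnS.
    have [->|ij] := eqVneq i j; first by rewrite leqnn ltnn /s mulr1 addrC subrK.
    rewrite mulr0 addr0 leq_eqVlt; case: eqP => //= ik.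
    by move: ij; rewrite -(inj_eq val_inj)/= ik eqxx.
  rewrite (bigD1 j)//= mulrDl.
  have -> : G (p k.+1) - G x = (G (p k.+1) - G (p k)) + (G (p k) - G x) by rewrite addrA subrK.
  apply: (le_trans (normcD _ _)); apply: lerD.
    rewrite pS distrC; apply: lip => K r rs; apply: hB.
    rewrite -[n in n%:R]card_ord -sumr_const; apply: ler_sum => i _.
    rewrite !mxE eqxx/=; have [->|ij] := eqVneq i j; last first.
      by rewrite mulr0 addr0; have := px k i; rewrite mxE.
    rewrite ltnn mulr1 opprD addNKr normrN.
    by apply: (le_trans rs); rewrite /s distrC.
  rewrite (eq_bigl (fun i : 'I_n => (i < k)%N)); first exact/IH/ltnW.
  move=> i; rewrite ltnS leq_eqVlt.
  have [->|ij] := eqVneq i j; first by rewrite /= ltnn andbF.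
  by rewrite andbT -(inj_eq val_inj)/= in ij *; rewrite (negbTE ij).
have pn : p n = y by apply/rowP => i; rewrite mxE ltn_ord.
have := H n (leqnn n); rewrite pn => h; apply: (le_trans h).
rewrite le_eqVlt; apply/orP; left; apply/eqP; congr (_ * _).
by apply: eq_bigl => i; rewrite ltn_ord.
Qed.

Definition net (l : nat) V G (B : R) : Prop := forall x, exists y,
  (forall i, `|x ord0 i - y ord0 i| <= 2^-1 ^+ l) /\ V y * nc (G y) <= B.

(** Let S be the finite weighted supremum. The net has a point y at distance at most
    2^-l from x, so |G(x)| <= |G(y)| + n 2^-l K0 S / V(x). For l large the last
    term is at most half of S / V(x), and can be absorbed. *)
Lemma bounded_net_bound (M : nat) (Cv : R) : 0 < Cv -> exists l (C1 : R), 0 < C1 /\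
  forall V G A B, spectral G -> moderate M Cv V ->
  (forall z, V z * nc (G z) <= A) -> net l V G B ->
  forall x, V x * nc (G x) <= C1 * B.
Proof.
move=> Cv0; have [K0 [K00 hK]] := cshift_sum_moderate M Cv0.
have [l hl] : exists l : nat, n%:R * (2^-1 : R) ^+ l * K0 <= 1 / 2.
  have e0 : 0 < 1 / (2 * (n.+1%:R * K0)) by rewrite divr_gt0// !mulr_gt0.
  have := @cvg_geometric R 1 2^-1.
  rewrite ger0_norm// invf_lt1// ltr1n => /(_ isT)/cvgrPdist_le/(_ _ e0)[l _ hl].
  exists l; have := hl l (leqnn l).
  rewrite /= sub0r normrN !mul1r ger0_norm ?exprn_ge0// => h.
  have nK : 0 <= n%:R * K0 by rewrite mulr_ge0// ltW.
  rewrite mulrAC; apply: (le_trans (ler_wpM2l nK h)).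
  have N0 : 0 < n.+1%:R :> R by [].
  rewrite (_ : n%:R * K0 * _ = 1 / 2 * (n%:R / n.+1%:R)); last first.
    by move: (n.+1%:R) N0 => N N0; field; rewrite !gt_eqF.
  by rewrite mul1r ler_piMr// ler_pdivrMr// mul1r ler_nat.
pose C1 := Cv * (n%:R + 1) ^+ M.
exists l, (2 * C1); split.
  by rewrite !mulr_gt0// exprn_gt0// ltr_wpDl.
move=> V G A B sG mV hA hnet x0.
have [V0 mV2] := mV.
pose S := [set V z * nc (G z) | z in [set: E]].
have supS : has_sup S.
  split; first by exists (V 0 * nc (G 0)); exists 0.
  by exists A => _ [z _ <-].
have Sle z : V z * nc (G z) <= sup S.
  by apply: ub_le_sup => //; [exact: supS.2|exists z].
have [L0 lip] := spectral_lipschitz sG.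
(* L0 depends on G; the constant K0 is uniform in L, hence does not. *)
pose L := maxn L0 M.+2.
suff : sup S <= C1 * B + sup S / 2.
  by move=> h; apply: (le_trans (Sle x0)); lra.
apply: ge_sup; first exact: supS.1.
move=> _ [x _ <-].
have [y [xy yB]] := hnet x.
have d1 : (2^-1 : R) ^+ l <= 1 by rewrite exprn_ile1// invf_le1// ler1n.
have sup0 : 0 <= sup S.
  by apply: le_trans (Sle 0); rewrite mulr_ge0 ?normc_ge0// ltW.
have step : nc (G y - G x) <= (\sum_i `|x ord0 i - y ord0 i|) * (K0 * sup S / V x).
  apply: (@spectral_coordinate_path G L).
  - by move=> j b s B' hB'; apply: lip hB'; exact: leq_maxl.
  - by move=> i; apply: le_trans d1.
  - by rewrite divr_ge0 ?(ltW (V0 x))// mulr_ge0// ltW.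
  move=> K j z xz; rewrite ler_pdivlMr// mulrC.
  by apply: hK => //; exact: leq_maxr.
have sumd : \sum_i `|x ord0 i - y ord0 i| <= n%:R * 2^-1 ^+ l.
  rewrite -[n in n%:R]card_ord -sumr_const mulr_suml; apply: ler_sum => i _.
  by rewrite mul1r.
have hy : V x * nc (G y) <= C1 * B.
  apply: (@le_trans _ _ (Cv * V y * wt (x - y) ^+ M * nc (G y))).
    by rewrite ler_wpM2r ?normc_ge0.
  rewrite (_ : Cv * V y * _ * _ = Cv * wt (x - y) ^+ M * (V y * nc (G y))); last by ring.
  apply: ler_pM => //.
  - by rewrite mulr_ge0 ?exprn_ge0 ?wt_ge0// ltW.
  - by rewrite mulr_ge0 ?normc_ge0// ltW.
  rewrite ler_wpM2l ?(ltW Cv0)// lerXn2r ?nnegrE ?wt_ge0 ?addr_ge0//.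
  rewrite /wt addrC lerD2r (le_trans _ (_ : n%:R * 2^-1 ^+ l <= _)) ?ler_piMr//.
  rewrite (le_trans _ sumd)// le_eqVlt; apply/orP; left; apply/eqP.
  by apply: eq_bigr => i _; rewrite !mxE.
have -> : G x = G y - (G y - G x) by rewrite opprB addrC subrK.
apply: (@le_trans _ _ (V x * (nc (G y) + nc (G y - G x)))).
  by rewrite ler_wpM2l ?normcB// ltW.
rewrite mulrDr lerD//.
have -> : sup S / 2 = V x * ((1 / 2) * (sup S / V x)) by field; rewrite gt_eqF.
rewrite ler_wpM2l ?(ltW (V0 x))//; apply: (le_trans step).
rewrite -[K0 * _ / _]mulrA [X in X <= _]mulrA; apply: ler_wpM2r.
  by rewrite divr_ge0// ltW.
by apply: le_trans hl; rewrite ler_wpM2r// ltW.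
Qed.

(** Dividing by a power of wt (x - x0) makes W |G| bounded and does not
    change W at x0; the constant Cv is unaffected. *)
Lemma moderate_localize (M N : nat) (Cv : R) W x0 : 0 < Cv -> moderate M Cv W ->
  moderate (M + N) Cv (fun x => W x / wt (x - x0) ^+ N).
Proof.
move=> Cv0 [W0 mW]; split=> [x|x y]; first by rewrite divr_gt0 ?wtX_gt0.
have w1 := wtX_gt0 (x - x0) N; have w2 := wtX_gt0 (y - x0) N.
have h : wt (y - x0) ^+ N <= wt (x - x0) ^+ N * wt (x - y) ^+ N.
  rewrite -exprMn lerXn2r ?nnegrE ?mulr_ge0 ?wt_ge0//.
  have := wtD (x - x0) (- (x - y)); rewrite wtN.
  by rewrite (_ : x - x0 - (x - y) = y - x0)//; apply/rowP => i; rewrite !mxE; ring.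
rewrite ler_pdivrMr// exprD.
apply: (le_trans (mW x y)).
rewrite (_ : Cv * _ * _ * _ = Cv * W y * wt (x - y) ^+ M *
   (wt (x - x0) ^+ N * wt (x - y) ^+ N / wt (y - x0) ^+ N)); last first.
  by field; rewrite gt_eqF.
apply: ler_peMr; last by rewrite ler_pdivlMr// mul1r.
by rewrite !mulr_ge0 ?exprn_ge0 ?wt_ge0// ltW.
Qed.

(** [bounded_net_bound] requires the supremum to be finite. First apply it to
    weights localized at x, with a power N given by the growth of G: this bounds
    W |G| at every x, with a constant that depends on N. Then apply it to W itself, which
    yields a constant independent of G. *)
Lemma net_bound (M : nat) (Cv : R) (B : nat -> R) : 0 < Cv -> exists C : R,
  forall W G, spectral G -> moderate M Cv W -> (forall l, net l W G (B l)) ->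
  forall x, W x * nc (G x) <= C.
Proof.
move=> Cv0; have [l [C1 [C10 h1]]] := bounded_net_bound M Cv0.
exists (C1 * B l) => W G sG mW hnet.
have [W0 mW2] := mW.
have [[N [D hD]] _] := sG.
have [l' [C2 [C20 h2]]] := bounded_net_bound (M + (M + N)) Cv0.
suff fin x : W x * nc (G x) <= C2 * B l' by exact: (h1 W G _ _ sG mW fin (hnet l)).
pose V z := W z / wt (z - x) ^+ (M + N).
have -> : W x = V x by rewrite /V subrr /wt (_ : l1norm 0 = 0) ?addr0 ?expr1n ?divr1// /l1norm big1// => i _; rewrite mxE normr0.
have D0 : 0 <= D by have := le_trans (normc_ge0 _) (hD 0); rewrite pmulr_lge0// wtX_gt0.
apply: (h2 V G (Cv * W x * (D * wt x ^+ N)) _ sG).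
- exact: moderate_localize.
- move=> z; rewrite /V mulrAC ler_pdivrMr ?wtX_gt0//.
  apply: (@le_trans _ _ (Cv * W x * wt (z - x) ^+ M * (D * (wt (z - x) * wt x) ^+ N))).
    apply: ler_pM => //; [exact: ltW|exact: normc_ge0|].
    apply: (le_trans (hD z)); rewrite ler_wpM2l// lerXn2r ?nnegrE ?mulr_ge0 ?wt_ge0//.
    by have := wtD (z - x) x; rewrite subrK.
  by rewrite exprMn exprD le_eqVlt; apply/orP; left; apply/eqP; ring.
move=> z; have [y [zy yB]] := hnet l' z; exists y; split=> //.
apply: le_trans yB; rewrite ler_wpM2r ?normc_ge0// /V ler_pdivrMr ?wtX_gt0//.
by rewrite ler_peMr ?(ltW (W0 y))// exprn_ege1// wt_ge1.
Qed.

End spectral_bound.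

(** * Littlewood-Paley kernels and log-Hoelder weights *)

Section littlewood_paley.
Context {R : realType} {n : nat}.
Local Notation E := 'rV[R]_n.
Local Notation mu := (lebesgue_rV R n).
Local Notation nc := (@Normc.normc R).
Implicit Types (phi psi : E -> R[i]) (x y xi : E) (f : @tempered_distribution R n).

Lemma enormN xi : enorm (- xi) = enorm xi.
Proof. by congr Num.sqrt; apply: eq_bigr => i _; rewrite mxE sqrrN. Qed.

Lemma fourier_parts phi xi : crschwartz phi -> fourier phi xi = 0 ->
  (\int[mu]_x (complex.Re (phi x) * cos (dotp x xi + 0)))%R +
  (\int[mu]_x (complex.Im (phi x) * sin (dotp x xi + 0)))%R = 0 /\
  (\int[mu]_x (complex.Im (phi x) * cos (dotp x xi + 0)))%R -
  (\int[mu]_x (complex.Re (phi x) * sin (dotp x xi + 0)))%R = 0.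
Proof.
move=> [s1 s2] /eqP; rewrite /fourier mulf_eq0 => /orP[/eqP[]|/eqP[]].
  by move=> /eqP; rewrite gt_eqF// powR_gt0// mulr_gt0// pi_gt0.
move=> h1 h2.
have k1 := kdom_wave xi 0 (rschwartz_kdom s1).
have k2 := kdom_wave_sin xi 0 (rschwartz_kdom s1).
have k3 := kdom_wave xi 0 (rschwartz_kdom s2).
have k4 := kdom_wave_sin xi 0 (rschwartz_kdom s2).
rewrite -RintegralD//; [|exact: integrable_kdom..].
rewrite -RintegralB//; [|exact: integrable_kdom..].
rewrite -[X in _ = X /\ _]h1 -[X in _ /\ _ = X]h2.
split; apply: eq_Rintegral => x _ /=; rewrite addr0 /expi cosN sinN;
  case: (phi x) => a b /=; ring.
Qed.

(** The transforms of the real and imaginary parts are recovered from the transform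
    of phi at xi and at - xi, both outside the ball of radius 2. *)
Lemma bandlimited_Re_Im phi : crschwartz phi ->
  Defs.support (fourier phi) `<=` [set xi | enorm xi <= 2] ->
  bandlimited (@complex.Re R \o phi) /\ bandlimited (@complex.Im R \o phi).
Proof.
move=> cp sp.
have zero xi : 2 < enorm xi -> fourier phi xi = 0.
  move=> xi2; apply/eqP; apply: contraT => h.
  have /sp/= : Defs.support (fourier phi) xi by apply: subset_closure.
  by rewrite leNgt xi2.
have parts xi : 2 < enorm xi ->
    [/\ (\int[mu]_x (complex.Re (phi x) * cos (dotp x xi + 0)))%R = 0,
        (\int[mu]_x (complex.Re (phi x) * sin (dotp x xi + 0)))%R = 0,
        (\int[mu]_x (complex.Im (phi x) * cos (dotp x xi + 0)))%R = 0 &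
        (\int[mu]_x (complex.Im (phi x) * sin (dotp x xi + 0)))%R = 0].
  move=> xi2; have [h1 h2] := fourier_parts cp (zero xi xi2).
  have [|h3 h4] := fourier_parts cp (zero (- xi) _); first by rewrite enormN.
  have c u : (\int[mu]_x (u x * cos (dotp x (- xi) + 0)))%R =
             (\int[mu]_x (u x * cos (dotp x xi + 0)))%R.
    by apply: eq_Rintegral => x _; rewrite !addr0 dotpNr cosN.
  have s u : kdom u -> (\int[mu]_x (u x * sin (dotp x (- xi) + 0)))%R =
             - (\int[mu]_x (u x * sin (dotp x xi + 0)))%R.
    move=> ku; rewrite -mulN1r -RintegralZl//; last exact/integrable_kdom/kdom_wave_sin.
    by apply: eq_Rintegral => x _; rewrite !addr0 dotpNr sinN; ring.
  rewrite c s in h3; last exact: rschwartz_kdom cp.2.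
  rewrite c s in h4; last exact: rschwartz_kdom cp.1.
  by split; lra.
have combine u xi th : kdom u ->
    (\int[mu]_x (u x * cos (dotp x xi + 0)))%R = 0 ->
    (\int[mu]_x (u x * sin (dotp x xi + 0)))%R = 0 ->
    (\int[mu]_x (u x * cos (dotp x xi + th)))%R = 0.
  move=> ku h1 h2.
  have e x : u x * cos (dotp x xi + th) =
     cos th * (u x * cos (dotp x xi + 0)) - sin th * (u x * sin (dotp x xi + 0)).
    by rewrite addr0 cosD; ring.
  under eq_Rintegral do rewrite e.
  have k1 := kdomZ (cos th) (kdom_wave xi 0 ku).
  have k2 := kdomZ (sin th) (kdom_wave_sin xi 0 ku).
  rewrite RintegralB//; [|exact: integrable_kdom..].
  rewrite !RintegralZl//; last exact/integrable_kdom/kdom_wave.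
    by rewrite h1 h2 !mulr0 subr0.
  exact/integrable_kdom/kdom_wave_sin.
split=> xi th xi2; have [p1 p2 p3 p4] := parts xi xi2.
  exact: (combine (@complex.Re R \o phi) _ _ (rschwartz_kdom cp.1)).
exact: (combine (@complex.Im R \o phi) _ _ (rschwartz_kdom cp.2)).
Qed.

Lemma convolution_rescaled_conv f Phi phi v x : crschwartz Phi -> crschwartz phi ->
  convolution (lp_kernel Phi phi v) f x = ((2 ^+ (v * n))%:C)%C *
    rescaled_conv f (if v == 0%N then Phi else phi) (2 ^+ v) (2 ^+ v *: x).
Proof.
move=> s1 s2; rewrite /convolution /lp_kernel /rescaled_conv.
have [->|v0] := eqVneq v 0%N.
  rewrite mul0n !expr0 mul1r; congr (f _); apply/funext => y.
  by rewrite scale1r scaleN1r.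
have a1 : 1 <= `|- 2 ^+ v| :> R.
  by rewrite normrN ger0_norm ?exprn_ge0// exprn_ege1// ler1n.
have := tempered_real_linear f (2 ^+ (v * n)) (crschwartz_affine (2 ^+ v *: x) a1 s2) crschwartz0.
rewrite tempered0 addr0 => <-; congr (f _); apply/funext => y.
by rewrite addr0 scalerBr scaleNr.
Qed.

Lemma spectral_rescaled_conv f phi (a : R) : crschwartz phi -> 1 <= a ->
  bandlimited (@complex.Re R \o phi) -> bandlimited (@complex.Im R \o phi) ->
  spectral (rescaled_conv f phi a).
Proof. by move=> sp a1 b1 b2; split; [exact: rescaled_conv_growth|exact: rescaled_conv_taylor]. Qed.

End littlewood_paley.

Section weights.
Context {R : realType} {n : nat}.
Local Notation E := 'rV[R]_n.
Implicit Types (s : E -> R) (x y : E).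

Lemma powR2D (a b : R) : 2 `^ (a + b) = 2 `^ a * 2 `^ b :> R.
Proof. by rewrite powRD// pnatr_eq0 implybT. Qed.

Lemma powR2_expR (a : R) : 2 `^ a = expR (a * ln 2) :> R.
Proof. by rewrite /powR pnatr_eq0. Qed.

Lemma powR2_le (a b : R) : a <= b -> 2 `^ a <= 2 `^ b :> R.
Proof. by apply: ler_powR; rewrite ler1n. Qed.

Lemma ln2_gt0 : 0 < ln 2 :> R.
Proof. by rewrite ln_gt0// ltr1n. Qed.

Lemma enorm_eq0 x : enorm x = 0 -> x = 0.
Proof.
move=> h; apply/rowP => i; rewrite mxE; apply/eqP; rewrite -normr_le0 -h.
exact: enorm_coord.
Qed.

Lemma enormZ (a : R) x : 0 <= a -> enorm (a *: x) = a * enorm x.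
Proof.
move=> a0; rewrite /enorm -{2}(ger0_norm a0) -sqrtr_sqr -sqrtrM ?sqr_ge0//.
by congr Num.sqrt; rewrite mulr_sumr; apply: eq_bigr => i _; rewrite mxE exprMn.
Qed.

(** With m = wt(2^v (x - y)), |x - y| <= m 2^-v. If m^2 >= 2^v the left-hand side is at
    most v ln 2 c <= 2 c ln m. Otherwise 1/|x - y| >= 2^(v/2), so that
    the logarithm in the definition is at least v ln 2 / 2. *)
Lemma Clog_loc_dyadic s : Clog_loc s -> exists c : R, 0 < c /\
  forall (v : nat) x y, v%:R * ln 2 * `|s x - s y| <=
    c * (1 + ln (wt (2 ^+ v *: (x - y)))).
Proof.
move=> [c [c0 hs]]; exists (2 * c); split; first by rewrite mulr_gt0.
move=> v x y; set m := wt _.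
have m1 : 1 <= m := wt_ge1 _.
have m0 : 0 < m by exact: lt_le_trans m1.
have lm : 0 <= ln m by exact: ln_ge0.
have l2 := ln2_gt0.
have p0 : 0 < 2 ^+ v :> R by rewrite exprn_gt0.
have [xy|xy] := eqVneq x y.
  rewrite xy subrr normr0 mulr0 mulr_ge0 ?addr_ge0// mulr_ge0// ltW//.
set d := enorm (x - y).
have d0 : 0 < d.
  rewrite lt_neqAle enorm_ge0 andbT eq_sym; apply: contra xy => /eqP/enorm_eq0 h.
  by rewrite -subr_eq0 h.
have dm : 2 ^+ v * d <= m.
  rewrite /d -enormZ ?(ltW p0)// (le_trans (enorm_le_l1norm _))// /m /wt.
  by rewrite lerDr.
have e1 : 1 <= expR 1 :> R by rewrite -expR0 ler_expR.
have arg : expR 1 <= expR 1 + d^-1 by rewrite lerDl invr_ge0 ltW.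
have lnge1 : 1 <= ln (expR 1 + d^-1).
  rewrite -[leLHS](expRK (1 : R)) ler_ln ?posrE ?expR_gt0//.
  by rewrite (lt_le_trans _ arg)// expR_gt0.
have lnpos : 0 < ln (expR 1 + d^-1) by exact: lt_le_trans lnge1.
have lv : ln (2 ^+ v) = v%:R * ln 2 :> R by rewrite lnXn// mulr_natl.
have hxy := hs x y; rewrite -/d in hxy.
have [small|big] := lerP (v%:R * ln 2) (2 * ln m).
  have h1 : `|s x - s y| <= c.
    apply: (le_trans hxy); rewrite ler_pdivrMr//.
    by apply: ler_peMr => //; exact: ltW.
  apply: (@le_trans _ _ (2 * ln m * c)).
    by apply: ler_pM => //; rewrite mulr_ge0// ltW.
  by nra.
have lnbig : v%:R * ln 2 / 2 <= ln (expR 1 + d^-1).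
  have dinv : 2 ^+ v / m <= d^-1.
    by rewrite ler_pdivrMr// mulrC ler_pdivlMr.
  have q0 : 0 < 2 ^+ v / m by rewrite divr_gt0.
  apply: (@le_trans _ _ (ln (2 ^+ v / m))).
    by rewrite ln_div ?posrE// lv; lra.
  rewrite ler_ln ?posrE//; last by rewrite (lt_le_trans _ arg)// expR_gt0.
  by rewrite (le_trans dinv)// lerDr (le_trans _ e1).
have v0 : 0 < v%:R * ln 2 :> R by apply: le_lt_trans big; rewrite mulr_ge0.
apply: (@le_trans _ _ (v%:R * ln 2 * (c / ln (expR 1 + d^-1)))).
  by apply: ler_wpM2l => //; exact: ltW.
apply: (@le_trans _ _ (2 * c)); last by rewrite ler_peMr ?mulr_ge0 ?(ltW c0)// lerDl.
rewrite mulrA ler_pdivrMr//.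
rewrite (_ : v%:R * ln 2 * c = 2 * c * (v%:R * ln 2 / 2)); last by field.
by apply: ler_wpM2l => //; rewrite mulr_ge0// ltW.
Qed.

(** In the variable b = 2^v x the weights 2^(v s) are moderate uniformly in v and in
    the constant factor. *)
Lemma Clog_loc_moderate s : Clog_loc s -> exists (M : nat) (Cv : R), 0 < Cv /\
  forall (v : nat) (k : R), 0 < k ->
  moderate M Cv (fun b : E => k * 2 `^ (v%:R * s ((2 ^+ v)^-1 *: b))).
Proof.
move=> /Clog_loc_dyadic[c [c0 hc]].
pose M := (Num.trunc c).+1.
have cM : c <= M%:R by have /andP[_ /ltW] := truncn_itv (ltW c0).
exists M, (expR c); split; first exact: expR_gt0.
move=> v k k0; split=> [x|x y]; first by rewrite mulr_gt0// powR_gt0.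
rewrite mulrCA -[_ * _ * wt _ ^+ _]mulrA ler_wpM2l ?(ltW k0)//.
have p0 : 0 < 2 ^+ v :> R by rewrite exprn_gt0.
have := hc v ((2 ^+ v)^-1 *: x) ((2 ^+ v)^-1 *: y).
rewrite -scalerBr scalerA divff ?gt_eqF// scale1r.
set a := s _; set b := s _; set m := wt _ => h.
have m1 : 1 <= m := wt_ge1 _.
have l2 := ln2_gt0.
rewrite !powR2_expR -[m ^+ M]lnK ?posrE ?exprn_gt0 ?(lt_le_trans _ m1)//.
rewrite lnXn ?(lt_le_trans _ m1)// -!expRD ler_expR -mulr_natl.
have lm : 0 <= ln m by exact: ln_ge0.
have h1 : v%:R * ln 2 * (a - b) <= v%:R * ln 2 * `|a - b|.
  by apply: ler_wpM2l; [rewrite mulr_ge0// ltW|exact: ler_norm].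
have h2 : c * ln m <= M%:R * ln m by rewrite ler_wpM2r.
by lra.
Qed.

End weights.

(** * Monotonicity of the norm functionals *)

Section norm_functionals.
Context {R : realType}.

(** The Luxemburg functional integrates functions whose measurability is not
    assumed; monotonicity of the integral of nonnegative functions holds for these as
    well, since it is a supremum over simple minorants. *)
Lemma ge0_le_integral_any d (T : measurableType d) (mu : {measure set T -> \bar R})
    (f g : T -> \bar R) :
  (forall x, 0 <= f x)%E -> (forall x, f x <= g x)%E ->
  (\int[mu]_x f x <= \int[mu]_x g x)%E.
Proof.
move=> f0 fg; have g0 x : (0 <= g x)%E by exact: le_trans (fg x).
rewrite !ge0_integralTE//; apply: le_ereal_sup => _ [h hf <-].
by exists h => // x; exact: le_trans (hf x) (fg x).
Qed.

Lemma lq_norm_from_ge (v0 v : nat) (q : R) (a : nat -> R) : 0 < q -> (v0 <= v)%N ->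
  (`|a v|%:E <= lq_norm_from v0 q%:E a)%E.
Proof.
move=> q0 vv; rewrite /lq_norm_from Lnorm_counting//.
pose u k : \bar R := (if (v0 <= k)%N then a k else 0)%:E.
rewrite -[leRHS]/((\sum_(k <oo) `|u k| `^ q) `^ q^-1)%E.
have uv : u v = (a v)%:E by rewrite /u vv.
have un k : (0 <= `|u k| `^ q)%E by exact: poweR_ge0.
have h : (`|u v| `^ q <= \sum_(k <oo) `|u k| `^ q)%E.
  have := @nneseries_lim_ge R (fun k => `|u k| `^ q)%E xpredT 0 v.+1 (fun k _ _ => un k).
  apply: le_trans; rewrite big_nat_recr//= leeDr//.
  by apply: sume_ge0.
have -> : (`|a v|%:E = (`|u v| `^ q) `^ q^-1)%E.
  by rewrite -poweRrM divff ?gt_eqF// poweRe1// uv.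
by apply: gt0_ler_poweR => //; rewrite ?invr_ge0 ?ltW// in_itv/= ?leey ?andbT//;
  apply: nneseries_ge0.
Qed.

Lemma lq_norm_from_le (v0 : nat) (a : nat -> R) (B : R) : 0 <= B ->
  (forall v, (v0 <= v)%N -> `|a v| <= B) -> (lq_norm_from v0 +oo%E a <= B%:E)%E.
Proof.
move=> B0 h; rewrite /lq_norm_from unlock; case: ifP => [_|_]; last by rewrite lee_fin.
apply/ess_supP; apply: aeW => v /=; rewrite lee_fin.
by case: ifP => [vv|_]; [exact: h|rewrite normr0].
Qed.

End norm_functionals.

(** * The pointwise estimate and the embedding *)

Section embedding.
Context {R : realType} {n : nat}.
Local Notation E := 'rV[R]_n.
Local Notation leb := (lebesgue_rV R n).
Local Notation nc := (@Normc.normc R).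
Implicit Types (Phi phi : E -> R[i]) (f : @tempered_distribution R n) (x y : E).

Lemma dyadic_cube_powR (v : int) m (t : R) :
  (fine (leb (dyadic_cube v m))) `^ t = 2 `^ (- (v%:~R * n%:R * t)).
Proof.
rewrite lebesgue_dyadic_cube/=.
have p0 : 0 < (2 ^ v)^-1 :> R by rewrite invr_gt0 exprz_gt0.
have -> : (2 ^ v)^-1 ^+ n = 2 `^ (- (v%:~R * n%:R)) :> R.
  by rewrite -powR_mulrn ?(ltW p0)// invr_expz -powR_intmul ?pnatr_eq0// -powRrM mulrNz mulNr.
by rewrite -powRrM mulNr.
Qed.

Lemma luxemburg_lt (p : E -> R) (F : E -> \bar R) (lam : R) :
  (luxemburg p F < lam%:E)%E -> exists2 mu : R, 0 < mu < lam &
  (\int[leb]_x ((`|F x| * (mu^-1)%:E) `^ p x) <= 1)%E.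
Proof.
move=> /ereal_inf_lt[_ [mu /= [mu0 h] <-]]; rewrite lte_fin => mul.
by exists mu => //; rewrite mu0.
Qed.

Lemma luxemburg_le (p : E -> R) (F : E -> \bar R) (lam : R) : 0 < lam ->
  (\int[leb]_x ((`|F x| * (lam^-1)%:E) `^ p x) <= 1)%E ->
  (luxemburg p F <= lam%:E)%E.
Proof. by move=> l0 h; apply: ereal_inf_lbound; exists lam. Qed.

(** Otherwise the integrand of the modular is at least 2 2^((v+l) n) on the
    dyadic cube Q of side 2^-(v+l) around x, which lies in the cube P of side
    2^-v; so the modular is at least 2. The factor 2^((1 + l n) / c), raised to
    the power p >= c, accounts for the 2 and for the ratio of the volumes of P and
    Q. *)
Lemma selected_point Phi phi (alpha tau p q : E -> R) (c : R) f (lam : R) :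
  0 < c -> (forall x, c <= p x) -> (forall x, 0 < q x) ->
  (Fnorm Phi phi alpha tau p (EFin \o q) f < lam%:E)%E ->
  forall (v l : nat) x, exists y,
    (forall i, `|x ord0 i - y ord0 i| <= 2^-1 ^+ (v + l)) /\
    2 `^ (v%:R * (alpha y + n%:R * tau y - n%:R / p y)) *
      nc (convolution (lp_kernel Phi phi v) f y) <=
    lam * 2 `^ ((1 + l%:R * n%:R) / c).
Proof.
move=> c0 cp q0 fl v l x; apply: contrapT => none.
pose P : set E := dyadic_cube (v : int) (dyadic_index v x).
pose Q : set E := dyadic_cube (v + l)%N (dyadic_index (v + l)%N x).
have large y : Q y -> lam * 2 `^ ((1 + l%:R * n%:R) / c) <
    2 `^ (v%:R * (alpha y + n%:R * tau y - n%:R / p y)) *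
      nc (convolution (lp_kernel Phi phi v) f y).
  move=> Qy; rewrite ltNge; apply/negP => h; apply: none; exists y; split=> //.
  exact: dyadic_cube_dist Qy.
have [|mu /andP[mu0 mul]] := @luxemburg_lt p (fun x => lq_norm_from `|Num.max (v : int) 0|%N (q x)%:E
      (fun v => 2 `^ (v%:R * alpha x) *
                nc (convolution (lp_kernel Phi phi v) f x) /
                (fine (leb P)) `^ tau x * \1_P x)) lam.
  apply: le_lt_trans fl; apply: ereal_sup_ubound.
  by exists (v : int), (dyadic_index v x).
apply/negP; rewrite -ltNge.
pose h := 2 * 2 ^+ (v + l) ^+ n : R.
have h0 : 0 <= h by rewrite mulr_ge0// exprn_ge0// exprn_ge0.
apply: (@lt_le_trans _ _ (\int[leb]_y (h * \1_Q y)%:E)%E).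
  have mQ : measurable Q by exact: measurable_dyadic_cube.
  under eq_integral do rewrite EFinM.
  rewrite ge0_integralZl//; last exact/measurable_EFinP/measurable_indic.
  rewrite integral_indic// setIT.
  rewrite [X in (_ * X)%E](@lebesgue_dyadic_cube R n (v + l)%N (dyadic_index (v + l)%N x)).
  by rewrite -EFinM lte_fin -exprnP /h exprVn -mulrA divff ?mulr1 ?ltr1n.
apply: ge0_le_integral_any => y; first by rewrite lee_fin mulr_ge0.
have [Qy|Qy] := boolP (y \in Q); last first.
  by rewrite indicE (negbTE Qy) mulr0 poweR_ge0.
have Py : y \in P.
  by move: Qy; rewrite !inE => /dyadic_cube_nested.
rewrite inE in Qy; rewrite indicE mem_set// mulr1.
have py : 0 < p y by exact: lt_le_trans (cp y).
set N := lq_norm_from _ _ _.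
(* The l^q norm dominates the single term of index v, and |P| = 2^(- v n). *)
have N1 : ((2 `^ ((v%:R * n%:R) / p y + (1 + l%:R * n%:R) / c) * mu)%:E <= N)%E.
  apply: le_trans (@lq_norm_from_ge _ _ v _ _ (q0 y) _); last first.
    by rewrite (@max_l _ int)// absz_nat.
  rewrite lee_fin indicE Py mulr1; apply: le_trans (ler_norm _).
  rewrite dyadic_cube_powR powRN invrK.
  apply: (@le_trans _ _ (2 `^ ((v%:R * n%:R) / p y) * (lam * 2 `^ ((1 + l%:R * n%:R) / c)))).
    rewrite powR2D -mulrA ler_wpM2l ?powR_ge0//.
    by rewrite mulrC ler_wpM2r ?powR_ge0// ltW.
  apply: (@le_trans _ _ (2 `^ ((v%:R * n%:R) / p y) * (2 `^ (v%:R * (alpha y + n%:R * tau y - n%:R / p y)) *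
      nc (convolution (lp_kernel Phi phi v) f y)))).
    by rewrite ler_wpM2l ?powR_ge0// ltW// large.
  rewrite [leLHS]mulrA -powR2D [leRHS]mulrAC -powR2D le_eqVlt; apply/orP; left; apply/eqP.
  congr (2 `^ _ * _); rewrite -[(v : int)%:~R]/(v%:R); ring.
apply: (@le_trans _ _ ((2 `^ ((v%:R * n%:R) / p y + (1 + l%:R * n%:R) / c)) `^ p y)%:E).
  rewrite lee_fin -powRrM mulrDl divfK ?gt_eqF//.
  apply: (@le_trans _ _ (2 `^ (v%:R * n%:R + (1 + l%:R * n%:R)))).
    rewrite /h -exprM le_eqVlt; apply/orP; left; apply/eqP.
    rewrite -exprS -powR_mulrn//; congr (_ `^ _).
    by rewrite -addn1 natrD natrM natrD; ring.
  apply: powR2_le; rewrite lerD2l mulrAC -mulrA ler_peMr ?addr_ge0 ?mulr_ge0//.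
  by rewrite ler_pdivlMr// mul1r.
rewrite -poweR_EFin.
have N0 : (0 <= N)%E by apply: le_trans N1; rewrite lee_fin mulr_ge0 ?powR_ge0// ltW.
rewrite gee0_abs//.
apply: gt0_ler_poweR => //.
- exact: ltW.
- by rewrite in_itv/= leey andbT lee_fin powR_ge0.
- by rewrite in_itv/= leey andbT mule_ge0// lee_fin invr_ge0 ltW.
by rewrite EFinM in N1; rewrite lee_pdivlMr.
Qed.

End embedding.

Section embedding_bounds.
Context {R : realType} {n : nat}.
Local Notation E := 'rV[R]_n.
Local Notation leb := (lebesgue_rV R n).
Local Notation nc := (@Normc.normc R).
Implicit Types (Phi phi : E -> R[i]) (f : @tempered_distribution R n) (x y : E).

Lemma Clog_loc_linear (a : R) (g h : E -> R) : Clog_loc g -> Clog_loc h ->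
  Clog_loc (fun x => g x + a * h x).
Proof.
move=> [c [c0 hc]] [d [d0 hd]]; exists (c + `|a| * d); split.
  by rewrite ltr_pwDl// mulr_ge0// ltW.
move=> x y; rewrite opprD addrACA -mulrBr (le_trans (ler_normD _ _))//.
rewrite mulrDl lerD// normrM -mulrA ler_wpM2l//.
Qed.

(** [net_bound], applied in the variable b = 2^v x to the points found by
    [selected_point]. *)
Lemma local_bound Phi phi (alpha tau p q : E -> R) :
  admissible_pair Phi phi -> Clog_loc alpha -> Clog_loc tau -> P0log p ->
  (forall x, 0 < q x) ->
  exists2 C : R, 1 <= C & forall f (lam : R), 0 < lam ->
    (Fnorm Phi phi alpha tau p (EFin \o q) f < lam%:E)%E ->
    forall (v : nat) x,
      2 `^ (v%:R * (alpha x + n%:R * tau x - n%:R / p x)) *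
      nc (convolution (lp_kernel Phi phi v) f x) <= C * lam.
Proof.
move=> [sPhi sphi [c0 [_ supPhi _ supphi _]]] la lt [[_ [c [c_gt0 cp]]] [lp _]] q0.
have [cPhi cphi] := (schwartz_crschwartz sPhi, schwartz_crschwartz sphi).
have [bPhi1 bPhi2] := bandlimited_Re_Im cPhi supPhi.
have [bphi1 bphi2] := bandlimited_Re_Im cphi (subset_trans supphi (@subIset _ _ _ _ (or_introl (@subset_refl _ _)))).
pose s x := alpha x + n%:R * tau x - n%:R / p x.
have ls : Clog_loc s.
  have := Clog_loc_linear (- n%:R) (Clog_loc_linear n%:R la lt) lp.
  by congr Clog_loc; apply/funext => x; rewrite /s mulNr.
have [M [Cv [Cv0 hM]]] := Clog_loc_moderate ls.
have [C hC] := @net_bound R n M Cv (fun l => 2 `^ ((1 + l%:R * n%:R) / c)) Cv0.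
exists (Num.max C 1); first by rewrite le_max lexx orbT.
move=> f lam lam0 fl v x.
have a0 : 0 < 2 ^+ v :> R by rewrite exprn_gt0.
have a1 : 1 <= 2 ^+ v :> R by rewrite exprn_ege1// ler1n.
pose G := rescaled_conv f (if v == 0%N then Phi else phi) (2 ^+ v).
(* 2^(v n) relates phi_v * f to the rescaled convolution, and 1 / lam normalizes
   the bounds on the net. *)
pose k : R := 2 ^+ (v * n) / lam.
have k0 : 0 < k by rewrite divr_gt0// exprn_gt0.
pose W (b : E) := k * 2 `^ (v%:R * s ((2 ^+ v)^-1 *: b)).
have convE z : lam^-1 * (2 `^ (v%:R * s z) * nc (convolution (lp_kernel Phi phi v) f z)) =
    W (2 ^+ v *: z) * nc (G (2 ^+ v *: z)).
  rewrite convolution_rescaled_conv// normc_realM ger0_norm ?exprn_ge0//.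
  have e : (2 ^+ v)^-1 *: (2 ^+ v *: z) = z by rewrite scalerA mulVf ?scale1r// gt_eqF.
  rewrite /W e /k /G.
  move: (2 `^ _) (2 ^+ (v * n)) (nc _) => D T N.
  by ring.
have sG : spectral G by rewrite /G; case: (v == 0%N); apply: spectral_rescaled_conv.
have netW l : net l W G (2 `^ ((1 + l%:R * n%:R) / c)).
  move=> b; have [y [yb hy]] := selected_point c_gt0 cp q0 fl v l ((2 ^+ v)^-1 *: b).
  exists (2 ^+ v *: y); split=> [i|].
    have /(ler_wpM2l (ltW a0)) := yb i.
    rewrite -{1}(gtr0_norm a0) -normrM mulrBr !mxE mulrA divff ?gt_eqF// mul1r.
    by rewrite exprD mulrA -exprMn divff// expr1n mul1r.
  by rewrite -convE mulrC ler_pdivrMr// [leRHS]mulrC.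
have := hC W G sG (hM v k k0) netW (2 ^+ v *: x).
rewrite -convE mulrC ler_pdivrMr// => /le_trans; apply.
by rewrite ler_wpM2r ?(ltW lam0)// le_max lexx.
Qed.

(** The geometric mean of the two bounds with weights p0 / p1 and 1 - p0 / p1, for which the
    powers of 2 cancel. *)
Lemma interpolation (A r K p0 p1 t : R) : 0 <= A -> 0 <= r -> 0 < K -> 0 < p0 -> p0 < p1 ->
  A <= 2 `^ (- (t * (p0^-1 - p1^-1))) * r -> A <= K * 2 `^ (t / p1) ->
  A <= K * (r / K) `^ (p0 / p1).
Proof.
move=> A0 r0 K0 p00 p01 h1 h2.
have p10 : 0 < p1 by exact: lt_trans p01.
set th := p0 / p1.
have th0 : 0 <= th by rewrite divr_ge0// ltW.
have th1 : 0 <= 1 - th by rewrite subr_ge0 ler_pdivrMr// mul1r ltW.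
have Ae : A = A `^ th * A `^ (1 - th).
  have e1 : th + (1 - th) = 1 by rewrite addrC subrK.
  by rewrite -powRD e1 ?powRr1// oner_eq0.
rewrite [leLHS]Ae.
apply: (@le_trans _ _ ((2 `^ (- (t * (p0^-1 - p1^-1))) * r) `^ th * (K * 2 `^ (t / p1)) `^ (1 - th))).
  apply: ler_pM; [exact: powR_ge0|exact: powR_ge0| |]; apply: ge0_ler_powR => //.
    by rewrite nnegrE mulr_ge0// powR_ge0.
  by rewrite nnegrE mulr_ge0 ?powR_ge0// ltW.
have Kinv : K^-1 `^ th = (K `^ th)^-1.
  by rewrite -powR_inv1 ?(ltW K0)// -powRrM mulN1r powRN.
rewrite !powRM ?powR_ge0 ?invr_ge0 ?(ltW K0)// Kinv -!powRrM.
rewrite powRB ?(gt_eqF K0) ?implybT// powRr1 ?(ltW K0)//.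
have e : 2 `^ (- (t * (p0^-1 - p1^-1)) * th) * 2 `^ (t / p1 * (1 - th)) = 1 :> R.
  rewrite -powR2D (_ : _ + _ = 0) ?powRr0//.
  by rewrite /th; field; rewrite !gt_eqF.
set X := 2 `^ _ in e *; set Y := 2 `^ _ in e *.
rewrite (_ : X * _ * _ = (X * Y) * (K * (r `^ th / K `^ th))); last by ring.
by rewrite e mul1r.
Qed.

End embedding_bounds.

Section embedding_proof.
Context {R : realType} {n : nat}.
Local Notation E := 'rV[R]_n.
Local Notation leb := (lebesgue_rV R n).
Local Notation nc := (@Normc.normc R).
Implicit Types (Phi phi : E -> R[i]) (f : @tempered_distribution R n) (x y : E).

(** tau is nonnegative almost everywhere and continuous: if tau x < 0 then tau is
    negative on a small dyadic cube around x, which has positive measure. *)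
Lemma ess_inf_pos_ge0 (tau : E -> R) : Clog_loc tau ->
  (0 < ess_inf leb (EFin \o tau))%E -> forall x, 0 <= tau x.
Proof.
move=> /Clog_loc_dyadic[c [c0 hc]] tau_inf x; rewrite leNgt; apply/negP => tx.
have l2 := @ln2_gt0 R.
(* On the cube of side 2^-v around x, wt (2^v (x - y)) <= 1 + n, so tau varies by
   at most B / (v ln 2). *)
pose B : R := c * (1 + ln (1 + n%:R)).
pose v := (Num.trunc (B / (- tau x * ln 2))).+1.
have vB : B < v%:R * ln 2 * - tau x.
  have d0 : 0 < - tau x * ln 2 by rewrite mulr_gt0// oppr_gt0.
  rewrite -mulrA [ln 2 * _]mulrC -ltr_pdivrMr//.
  exact: truncnS_gt.
pose Q : set E := dyadic_cube v (dyadic_index v x).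
have neg y : Q y -> tau y < 0.
  move=> /dyadic_cube_dist dxy; rewrite ltNge; apply/negP => ty.
  have wle : wt (2 ^+ v *: (x - y)) <= 1 + n%:R.
    have -> : n%:R = \sum_(i < n) 1 :> R by rewrite sumr_const card_ord.
    rewrite /wt lerD2l /l1norm; apply: ler_sum => i _; rewrite !mxE normrM ger0_norm ?exprn_ge0//.
    have /(ler_wpM2l (exprn_ge0 v (ler0n R 2))) := dxy i.
    by rewrite -exprMn divff// expr1n.
  have := hc v x y; apply/negP; rewrite -ltNge.
  apply: (@le_lt_trans _ _ B).
    by rewrite ler_wpM2l ?(ltW c0)// lerD2l ler_ln ?posrE ?wt_gt0//.
  apply: (lt_le_trans vB); rewrite ler_wpM2l ?mulr_ge0 ?(ltW l2)//.
  by rewrite distrC (le_trans _ (ler_norm _))//; lra.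
have [N [mN N0 hN]] := ess_inf_le leb (EFin \o tau).
have QN : Q `<=` N.
  move=> y Qy; apply: hN => /=; apply/negP; rewrite -ltNge.
  by apply: lt_trans tau_inf; rewrite lte_fin neg.
have : (leb Q <= leb N)%E.
  by apply: le_measure; rewrite ?inE//; exact: measurable_dyadic_cube.
rewrite N0 [X in (X <= _)%E](@lebesgue_dyadic_cube R n v (dyadic_index v x)) lee_fin.
by apply/negP; rewrite -ltNge exprn_gt0// invr_gt0 exprz_gt0.
Qed.

Lemma luxemburg_ge0 (p : E -> R) (F : E -> \bar R) : (0 <= luxemburg p F)%E.
Proof. by apply: le_ereal_inf_tmp => _ [mu [mu0 _] <-]; rewrite lee_fin ltW. Qed.

Lemma Fnorm_ge0 Phi phi (alpha tau p : E -> R) (q : E -> \bar R) f :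
  (0 <= Fnorm Phi phi alpha tau p q f)%E.
Proof.
apply: le_trans (ereal_sup_ubound _); last by exists 0, 0.
exact: luxemburg_ge0.
Qed.

(** At a point of P, the two bounds of each term of the target sequence are combined by
    [interpolation] with t = v n, which gives a pointwise comparison of the
    integrands of the two modulars. *)
Lemma Fnorm_le Phi phi (alpha0 alpha1 tau p0 p1 q : E -> R) (C lam : R) f :
  (0 < n)%N -> (forall x, 0 <= tau x) -> (forall x, 0 < p0 x) -> (forall x, 0 < p1 x) ->
  (forall x, 0 < q x) ->
  (forall x, alpha1 x < alpha0 x) ->
  (forall x, alpha0 x - n%:R / p0 x = alpha1 x - n%:R / p1 x) ->
  1 <= C -> 0 < lam ->
  (forall v x, 2 `^ (v%:R * (alpha0 x + n%:R * tau x - n%:R / p0 x)) *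
    nc (convolution (lp_kernel Phi phi v) f x) <= C * lam) ->
  (Fnorm Phi phi alpha0 tau p0 (EFin \o q) f < lam%:E)%E ->
  (Fnorm Phi phi alpha1 tau p1 (cst +oo%E) f <= (C * lam)%:E)%E.
Proof.
move=> n0 tau0 p00 p10 q0 a01 sob C1 lam0 loc fl.
apply: ge_ereal_sup => _ [vP [m ->]]; set P : set E := dyadic_cube vP m.
have C0 : 0 < C by exact: lt_le_trans C1.
have K0 : 0 < C * lam by exact: mulr_gt0.
set v0 := `|_|%N.
pose a (alpha : E -> R) x v := 2 `^ (v%:R * alpha x) *
                nc (convolution (lp_kernel Phi phi v) f x) /
                (fine (leb P)) `^ tau x * \1_P x.
rewrite -/P.
have a_ge0 al x v : 0 <= a al x v.
  by rewrite /a !mulr_ge0 ?invr_ge0 ?powR_ge0 ?normc_ge0.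
pose F0 x := lq_norm_from v0 (q x)%:E (a alpha0 x).
have [|mu /andP[mu0 mul]] := @luxemburg_lt R n p0 F0 lam.
  by apply: le_lt_trans fl; apply: ereal_sup_ubound; exists vP, m.
move=> int1; apply: luxemburg_le => //; apply: le_trans int1.
apply: ge0_le_integral_any => x; first exact: poweR_ge0.
have F0a v : (v0 <= v)%N -> ((a alpha0 x v)%:E <= F0 x)%E.
  by move=> vv; rewrite -(ger0_norm (a_ge0 alpha0 x v)); exact: (lq_norm_from_ge _ (q0 x) vv).
have F0_ge0 : (0 <= F0 x)%E by apply: le_trans (F0a v0 (leqnn _)); rewrite lee_fin.
rewrite (gee0_abs F0_ge0).
have p0n : p0 x != 0 by rewrite gt_eqF.
(* Where the source sequence is not in l^q, the right-hand side is infinite. *)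
have [F0oo|F0fin] := eqVneq (F0 x) +oo%E.
  by rewrite F0oo gt0_mulye ?lte_fin ?invr_gt0// poweRyr// leey.
have : (F0 x \is a fin_num) by rewrite ge0_fin_numE// ltey.
move=> /fineK; set r := fine _ => rE; rewrite -rE in F0a F0_ge0 *.
rewrite lee_fin in F0_ge0.
have n0R : 0 < n%:R :> R by rewrite ltr0n.
have p01 : p0 x < p1 x.
  have h : n%:R / p1 x < n%:R / p0 x by have := sob x; have := a01 x; lra.
  by move: h; rewrite ltr_pM2l// ltf_pV2 ?posrE.
have F1 : (lq_norm_from v0 +oo%E (a alpha1 x) <= (C * lam * (r / (C * lam)) `^ (p0 x / p1 x))%:E)%E.
  apply: lq_norm_from_le => [|v vv]; first by rewrite mulr_ge0 ?powR_ge0// ltW.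
  rewrite ger0_norm//.
  have [Px|Px] := boolP (x \in P); last first.
    by rewrite /a indicE (negbTE Px) mulr0 mulr_ge0 ?powR_ge0// ltW.
  have := F0a v vv; rewrite lee_fin /a indicE Px !mulr1 => ar.
  set g := nc _ in ar *; have g0 : 0 <= g by exact: normc_ge0.
  have al : alpha1 x = alpha0 x - n%:R * ((p0 x)^-1 - (p1 x)^-1).
    by have := sob x; lra.
  apply: (@interpolation _ _ _ _ _ _ (v%:R * n%:R)) => //.
  - by rewrite !mulr_ge0 ?invr_ge0 ?powR_ge0.
  - apply: (@le_trans _ _ (2 `^ (- (v%:R * n%:R * ((p0 x)^-1 - (p1 x)^-1))) *
       (2 `^ (v%:R * alpha0 x) * g / fine (leb P) `^ tau x))); last first.
      by rewrite ler_wpM2l ?powR_ge0.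
    rewrite !mulrA -powR2D le_eqVlt; apply/orP; left; apply/eqP.
    by congr (2 `^ _ * _ / _); rewrite al; ring.
  - rewrite dyadic_cube_powR powRN invrK.
    have := ler_wpM2r (powR_ge0 2 (v%:R * n%:R / p1 x)) (loc v x).
    apply: le_trans; rewrite -/g [leLHS]mulrAC [leRHS]mulrAC -!powR2D.
    rewrite ler_wpM2r// powR2_le//.
    have : vP%:~R * n%:R * tau x <= v%:R * n%:R * tau x.
      rewrite -!mulrA ler_wpM2r ?mulr_ge0// -[v%:R]/((v : int)%:~R) ler_int.
      apply: (@le_trans _ _ (v0 : int)); last by rewrite lez_nat.
      by rewrite /v0 gez0_abs le_max lexx ?orbT.
    by have := sob x; move=> h; rewrite al; lra.
have F1_ge0 : (0 <= lq_norm_from v0 +oo%E (a alpha1 x))%E by exact: Lnorm_ge0.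
rewrite /= (gee0_abs F1_ge0).
apply: (@le_trans _ _ (((r / (C * lam)) `^ (p0 x / p1 x))%:E `^ p1 x)%E).
  apply: gt0_ler_poweR; first exact: ltW.
  - by rewrite in_itv/= leey andbT mule_ge0// lee_fin invr_ge0 ltW.
  - by rewrite in_itv/= leey andbT lee_fin powR_ge0.
  by rewrite lee_pdivrMr// -EFinM mulrC.
rewrite poweR_EFin lee_fin -powRrM divfK ?gt_eqF//.
apply: ge0_ler_powR; rewrite ?nnegrE ?divr_ge0 ?(ltW K0) ?(ltW mu0) ?(ltW (p00 x))//.
rewrite ler_wpM2l// lef_pV2// ?posrE//.
by rewrite (le_trans (ltW mul))// ler_peMl// ltW.
Qed.

End embedding_proof.

Theorem theorem7 (R : realType) (n : nat) (n_gt0 : (0 < n)%N)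
    (Phi phi : 'rV[R]_n -> R[i]) (Phi_phi : admissible_pair Phi phi)
    (alpha0 alpha1 tau : 'rV[R]_n -> R) (p0 p1 q : 'rV[R]_n -> R)
    (alpha0_log : Clog_loc alpha0) (alpha1_log : Clog_loc alpha1)
    (tau_log : Clog_loc tau)
    (tau_inf : (0 < ess_inf (lebesgue_rV R n) (EFin \o tau))%E)
    (p0_log : P0log p0) (p1_log : P0log p1) (q_log : P0log q)
    (p0_sup : (0 < ess_sup (lebesgue_rV R n) (EFin \o p0) < +oo)%E)
    (p1_sup : (0 < ess_sup (lebesgue_rV R n) (EFin \o p1) < +oo)%E)
    (q_sup : (0 < ess_sup (lebesgue_rV R n) (EFin \o q) < +oo)%E)
    (alpha01 : forall x, alpha1 x < alpha0 x)
    (sobolev : forall x,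
      alpha0 x - n%:R / p0 x = alpha1 x - n%:R / p1 x)
    (p01_sup : (0 < ess_sup (lebesgue_rV R n)
                      (fun x => (p0 x / p1 x)%:E) < 1)%E) :
  embeds (Fspace Phi phi alpha0 tau p0 (EFin \o q))
         (Fnorm Phi phi alpha0 tau p0 (EFin \o q))
         (Fspace Phi phi alpha1 tau p1 (cst +oo%E))
         (Fnorm Phi phi alpha1 tau p1 (cst +oo%E)).
Proof.
have P0_gt0 (r : 'rV[R]_n -> R) : P0log r -> forall x, 0 < r x.
  by move=> [[_ [c [c0 cr]]] _] x; exact: lt_le_trans (cr x).
have [C C1 loc] := local_bound Phi_phi alpha0_log tau_log p0_log (P0_gt0 _ q_log).
have C0 : 0 < C by exact: lt_le_trans C1.
have tau0 := ess_inf_pos_ge0 tau_log tau_inf.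
have bound f : Fspace Phi phi alpha0 tau p0 (EFin \o q) f ->
    (Fnorm Phi phi alpha1 tau p1 (cst +oo%E) f <=
     C%:E * Fnorm Phi phi alpha0 tau p0 (EFin \o q) f)%E.
  rewrite /Fspace/= => f_oo; have N0 := Fnorm_ge0 Phi phi alpha0 tau p0 (EFin \o q) f.
  set N := Fnorm _ _ _ _ _ _ _ in f_oo N0 *.
  have Nfin : N \is a fin_num by rewrite ge0_fin_numE.
  apply/lee_addgt0Pr => e e0.
  have eC : 0 < e / C by exact: divr_gt0.
  have NE : (fine N)%:E = N by exact: fineK.
  (* The bound holds for every lam above the source norm; let lam decrease to it. *)
  have lt_lam : (N < (fine N + e / C)%:E)%E by rewrite -{1}NE lte_fin ltrDl.
  have lam0 : 0 < fine N + e / C by rewrite ltr_wpDl// fine_ge0.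
  have := Fnorm_le n_gt0 tau0 (P0_gt0 _ p0_log) (P0_gt0 _ p1_log) (P0_gt0 _ q_log)
    alpha01 sobolev C1 lam0 (loc _ _ lam0 lt_lam) lt_lam.
  by rewrite mulrDr mulrCA divff ?gt_eqF// mulr1 EFinD EFinM NE.
split=> [f hf|]; last by exists C.
by rewrite /Fspace/=; apply: le_lt_trans (bound f hf) _; rewrite lte_mul_pinfty// ?lee_fin ?ltW.
Qed.
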